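(* Let $n\geq 1$ be an integer, let $\mathbb{F}_q$ be a finite field, and let $A$ be the path algebra over $\mathbb{F}_q$ of the bound quiver with vertices $1,2,\ldots,n$, one arrow $i\to i+1$ for each $1\leq i\leq n-1$, one loop $\alpha$ at the vertex $n$, and the single relation $\alpha^2=0$. Then $A$ has Hall polynomials.
   Context: Modules are finite-dimensional left modules. Modules over the algebra $A$ of the bound quiver over a field $K$ are identified with the finite-dimensional representations over $K$ of the quiver $1\to 2\to\cdots\to n$ with a loop $\alpha$ at $n$, satisfying $\alpha^2=0$. The algebra $A$ is finite-dimensional and representation-finite (finitely many isomorphism classes of indecomposable modules). Hall numbers: for modules $N_1,N_2,M$ over a finite-dimensional algebra over a finite field, $F_{N_1N_2}^M$ denotes the number of submodules $U$ of $M$ such that $U\cong N_2$ and $M/U\cong N_1$. Conservative extensions: let $K$ be a finite field and $A$ a representation-finite finite-dimensional $K$-algebra. For a field extension $E$ of $K$ and a $K$-space $V$ put $V^E:=V\otimes_K E$. A (finite) field extension $E$ of $K$ is conservative for $A$ if $(\mathrm{End}\,M/\mathrm{rad}\,\mathrm{End}\,M)^E$ is a field for every indecomposable $A$-module $M$. $A$ has Hall polynomials if for all $A$-modules $X,Y,M$ there exists a polynomial $\varphi_{XY}^M\in\mathbb{Z}[T]$ such that for every conservative field extension $E$ of $K$ one has $\varphi_{XY}^M(|E|)=F_{X^E\,Y^E}^{M^E}$, where the Hall number on the right is computed for modules over $A^E$. *)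

(* Defs.v *)
From HB Require Import structures.
From mathcomp Require Import all_boot all_order all_algebra.

Set Implicit Arguments.
Unset Strict Implicit.
Unset Printing Implicit Defensive.

Import GRing.Theory.
Local Open Scope ring_scope.

(* The K-algebra \prod_i End_K(K^(d i)). Matrices act on row vectors from the
   right, so composing x after y multiplies the matrices in the order y i, x i. *)
Definition mxfam (K : finFieldType) (I : finType) (d : I -> nat) : Type :=
  {dffun forall i : I, 'M[K]_(d i)}.

Section MxFam.
Variables (K : finFieldType) (I : finType) (d : I -> nat).
Local Notation T := (mxfam K d).

HB.instance Definition _ := Finite.on T.

Definition mxfam_fun (x : T) : forall i, 'M[K]_(d i) := fun_of_fin x.
Coercion mxfam_fun : mxfam >-> Funclass.

Definition mxfam_of (f : forall i, 'M[K]_(d i)) : T := finfun f.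

Lemma mxfam_ofE f i : mxfam_of f i = f i. Proof. exact: ffunE. Qed.

Lemma mxfamP (x y : T) : (forall i, x i = y i) -> x = y.
Proof. by move=> exy; apply/ffunP. Qed.

Definition mxfam_zero : T := mxfam_of (fun=> 0).
Definition mxfam_opp (x : T) : T := mxfam_of (fun i => - x i).
Definition mxfam_add (x y : T) : T := mxfam_of (fun i => x i + y i).
Definition mxfam_one : T := mxfam_of (fun=> 1%:M).
Definition mxfam_mul (x y : T) : T := mxfam_of (fun i => y i *m x i).
Definition mxfam_scale (a : K) (x : T) : T := mxfam_of (fun i => a *: x i).

Fact mxfam_addA : associative mxfam_add.
Proof. by move=> x y z; apply/mxfamP => i; rewrite !mxfam_ofE addrA. Qed.
Fact mxfam_addC : commutative mxfam_add.
Proof. by move=> x y; apply/mxfamP => i; rewrite !mxfam_ofE addrC. Qed.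
Fact mxfam_add0 : left_id mxfam_zero mxfam_add.
Proof. by move=> x; apply/mxfamP => i; rewrite !mxfam_ofE add0r. Qed.
Fact mxfam_addN : left_inverse mxfam_zero mxfam_opp mxfam_add.
Proof. by move=> x; apply/mxfamP => i; rewrite !mxfam_ofE addNr. Qed.
HB.instance Definition _ := GRing.isZmodule.Build T
  mxfam_addA mxfam_addC mxfam_add0 mxfam_addN.

Fact mxfam_mulA : associative mxfam_mul.
Proof. by move=> x y z; apply/mxfamP => i; rewrite !mxfam_ofE mulmxA. Qed.
Fact mxfam_mul1 : left_id mxfam_one mxfam_mul.
Proof. by move=> x; apply/mxfamP => i; rewrite !mxfam_ofE mulmx1. Qed.
Fact mxfam_mulx1 : right_id mxfam_one mxfam_mul.
Proof. by move=> x; apply/mxfamP => i; rewrite !mxfam_ofE mul1mx. Qed.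
Fact mxfam_mulDl : left_distributive mxfam_mul +%R.
Proof. by move=> x y z; apply/mxfamP => i; rewrite !mxfam_ofE mulmxDr. Qed.
Fact mxfam_mulDr : right_distributive mxfam_mul +%R.
Proof. by move=> x y z; apply/mxfamP => i; rewrite !mxfam_ofE mulmxDl. Qed.
HB.instance Definition _ := GRing.Zmodule_isPzRing.Build T
  mxfam_mulA mxfam_mul1 mxfam_mulx1 mxfam_mulDl mxfam_mulDr.

Fact mxfam_scaleA a b x :
  mxfam_scale a (mxfam_scale b x) = mxfam_scale (a * b) x.
Proof. by apply/mxfamP => i; rewrite !mxfam_ofE scalerA. Qed.
Fact mxfam_scale1 : left_id 1 mxfam_scale.
Proof. by move=> x; apply/mxfamP => i; rewrite !mxfam_ofE scale1r. Qed.
Fact mxfam_scaleDr : right_distributive mxfam_scale +%R.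
Proof. by move=> a x y; apply/mxfamP => i; rewrite !mxfam_ofE scalerDr. Qed.
Fact mxfam_scaleDl x : {morph mxfam_scale^~ x : a b / a + b}.
Proof. by move=> a b; apply/mxfamP => i; rewrite !mxfam_ofE scalerDl. Qed.
HB.instance Definition _ := GRing.Zmodule_isLmodule.Build K T
  mxfam_scaleA mxfam_scale1 mxfam_scaleDr mxfam_scaleDl.

End MxFam.

(* Below, B is (the underlying set of) a subring of the finite ring R. *)
Section Radical.
Variables (R : finPzRingType) (B : {set R}).

Definition left_ideal (I : {set R}) : bool :=
  [&& I \subset B, 0 \in I,
      [forall x in I, forall y in I, x + y \in I]
    & [forall b in B, forall x in I, b * x \in I]].

Definition maximal_left_ideal (I : {set R}) : bool :=
  maxset (fun J => left_ideal J && (J != B)) I.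

Definition radical : {set R} :=
  B :&: \bigcap_(I : {set R} | maximal_left_ideal I) I.

(* For a two-sided ideal J of B: the quotient ring B / J is a field. *)
Definition quotient_is_field (J : {set R}) : Prop :=
  [/\ 1 \notin J,
      {in B &, forall x y, x * y - y * x \in J}
    & {in B, forall x, x \notin J -> exists2 y, y \in B & x * y - 1 \in J}].

End Radical.

Section ScalarExtension.
Variables (K E : finFieldType) (iota : {rmorphism K -> E}).
Variables (I : finType) (d : I -> nat).

Definition mxfam_ext (x : mxfam K d) : mxfam E d :=
  mxfam_of (fun i => map_mx iota (x i)).

(* As mxfam E d is the tensor product of mxfam K d with E over K, the tensor
   product of a K-subspace V of mxfam K d with E is the E-span of V in
   mxfam E d. *)
Definition span_ext (V : {set mxfam K d}) : {set mxfam E d} :=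
  [set \sum_(x in V) c x *: mxfam_ext x | c : {ffun mxfam K d -> E}].

End ScalarExtension.

Record quiver := Quiver {
  vertex : finType;
  arrow : finType;
  src : arrow -> vertex;
  tgt : arrow -> vertex }.

(* The space at the vertex v is 'rV_(dimv v); the arrow a acts by u |-> u *m act a. *)
Record rep (K : finFieldType) (Q : quiver) := Rep {
  dimv : vertex Q -> nat;
  act : forall a : arrow Q, 'M[K]_(dimv (src a), dimv (tgt a)) }.

Section Representations.
Variables (K : finFieldType) (Q : quiver).
Implicit Types M N : rep K Q.

Definition is_hom M N (g : forall v, 'M[K]_(dimv M v, dimv N v)) : bool :=
  [forall a, act M a *m g (tgt a) == g (src a) *m act N a].

Definition iso M N : bool :=
  [exists g : {dffun forall v, 'M[K]_(dimv M v, dimv N v)},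
    is_hom g && [forall v, row_free (g v) && row_full (g v)]].

Definition is_zero M : bool := [forall v, dimv M v == 0].

Definition dsum M N : rep K Q :=
  @Rep K Q (fun v => dimv M v + dimv N v)%N
    (fun a => block_mx (act M a) 0 0 (act N a)).

Definition indecomposable M : Prop :=
  ~~ is_zero M /\ forall M1 M2, iso M (dsum M1 M2) -> is_zero M1 || is_zero M2.

Definition endo M : {set mxfam K (dimv M)} := [set g | is_hom (g : mxfam _ _)].

(* A subspace of 'rV_(dimv M v) is the row space of a unique square matrix that
   is fixed by <<_>>%MS, so distinct elements of submodule M are distinct
   submodules. *)
Definition is_submodule M (U : mxfam K (dimv M)) : bool :=
  [forall v, <<U v>>%MS == U v] &&
  [forall a, (U (src a) *m act M a <= U (tgt a))%MS].

Definition submodule M := {U : mxfam K (dimv M) | is_submodule U}.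

Section SubQuotient.
Variables (M : rep K Q) (U : submodule M).

Definition sub_incl v : 'M[K]_(\rank (val U v), dimv M v) := row_base (val U v).

Definition sub_rep : rep K Q :=
  @Rep K Q (fun v => \rank (val U v))
    (fun a => sub_incl (src a) *m act M a *m pinvmx (sub_incl (tgt a))).

(* The kernel of (u |-> u *m cokermx (U v)) is the row space of U v, and its
   image, the row space of cokermx (U v), has coordinates given by col_base. *)
Definition quo_proj v : 'M[K]_(dimv M v, \rank (cokermx (val U v))) :=
  col_base (cokermx (val U v)).

Definition quo_rep : rep K Q :=
  @Rep K Q (fun v => \rank (cokermx (val U v)))
    (fun a => pinvmx (quo_proj (src a)) *m act M a *m quo_proj (tgt a)).

Lemma sub_incl_hom : is_hom (M := sub_rep) (N := M) sub_incl.
Proof.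
apply/forallP => a; have /andP[_ /forallP/(_ a) Ua] := valP U.
rewrite /= mulmxKpV // (eqmxMr _ (eq_row_base _)).
by rewrite (submx_trans Ua) // eq_row_base.
Qed.

Lemma sub_incl_free v : row_free (sub_incl v).
Proof. exact: row_base_free. Qed.

Lemma sub_incl_image v : (sub_incl v :=: val U v)%MS.
Proof. exact: eq_row_base. Qed.

Lemma quo_proj_full v : row_full (quo_proj v).
Proof. exact: col_base_full. Qed.

Lemma quo_proj_ker v m (x : 'M_(m, dimv M v)) :
  (x *m quo_proj v == 0) = (x <= val U v)%MS.
Proof.
rewrite submxE -[cokermx _ in RHS]mulmx_base mulmxA.
apply/idP/idP => [/eqP-> | ]; first by rewrite mul0mx.
move/eqP=> e0; rewrite -[x *m _]mulmx1 -(mulmxVp (row_base_free (cokermx (val U v)))).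
by rewrite mulmxA e0 mul0mx.
Qed.

Lemma quo_proj_hom : is_hom (M := M) (N := quo_rep) quo_proj.
Proof.
apply/forallP => a; have /andP[_ /forallP/(_ a) Ua] := valP U.
have pK v : quo_proj v *m pinvmx (quo_proj v) *m quo_proj v = quo_proj v.
  by rewrite mulmxKpV.
have e : (quo_proj (src a) *m pinvmx (quo_proj (src a)) *m act M a - act M a)
           *m quo_proj (tgt a) == 0.
  rewrite quo_proj_ker -[X in (_ - X <= _)%MS]mul1mx -mulmxBl.
  apply: submx_trans Ua; apply: submxMr.
  by rewrite -quo_proj_ker mulmxBl mul1mx pK subrr.
rewrite eq_sym -subr_eq0; move: e; rewrite mulmxBl -!mulmxA.
by [].
Qed.

End SubQuotient.

(* The Hall number F_{N1 N2}^M. *)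
Definition hall_number N1 N2 M : nat :=
  #|[set U : submodule M | iso (sub_rep U) N2 && iso (quo_rep U) N1]|.

End Representations.

Definition rep_ext (K E : finFieldType) (iota : {rmorphism K -> E})
    (Q : quiver) (M : rep K Q) : rep E Q :=
  @Rep E Q (dimv M) (fun a => map_mx iota (act M a)).

(* The quiver 1 -> 2 -> ... -> n with a loop at n, for n > 0: vertices are numbered
   from 0, Some i is the arrow i -> i.+1 and None is the loop at the last vertex. *)
Definition loop_quiver (n : nat) : quiver :=
  @Quiver 'I_n.-1.+1 (option 'I_n.-1)
    (fun a => if a is Some i then widen_ord (leqnSn n.-1) i else ord_max)
    (fun a => if a is Some i then lift ord0 i else ord_max).

Section BoundQuiver.
Variable n : nat.

Definition loop_action (K : finFieldType) (M : rep K (loop_quiver n)) :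
  'M[K]_(dimv M (ord_max : vertex (loop_quiver n))) := act M None.

(* Modules over the path algebra of loop_quiver n bound by loop ^ 2 = 0. *)
Definition is_module (K : finFieldType) (M : rep K (loop_quiver n)) : bool :=
  loop_action M *m loop_action M == 0.

(* By exactness of the tensor product, the extension of End M / rad End M to E is
   the quotient of the extensions of End M and rad End M. *)
Definition conservative (K E : finFieldType) (iota : {rmorphism K -> E}) : Prop :=
  forall M : rep K (loop_quiver n), is_module M -> indecomposable M ->
    quotient_is_field (span_ext iota (endo M)) (span_ext iota (radical (endo M))).

Definition has_hall_polynomials (K : finFieldType) : Prop :=
  forall X Y M : rep K (loop_quiver n),
    is_module X -> is_module Y -> is_module M ->
  exists phi : {poly int},
    forall (E : finFieldType) (iota : {rmorphism K -> E}), conservative iota ->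
      phi.[#|E|%:R] =
        (hall_number (rep_ext iota X) (rep_ext iota Y) (rep_ext iota M))%:R.

End BoundQuiver.

(* Main.v *)
(* The Hall number of [X], [Y], [M] is the sum, over the submodules [U] of [M]
   isomorphic to [Y], of the indicator function of [X] at [M / U]. Call a function
   [phi] of modules good if for all [Y] and [M] the sum of [phi (M / U)] over these
   [U] is a rational function of |E| with monic denominator; as Hall numbers are
   integers, it is then a polynomial whenever [phi] is an indicator function.
   Since |Hom| = |E|^d with [d] independent of E, the orders of automorphism
   groups and, recursively, the numbers of submodules of a given type are rational
   functions of |E|; hence the constant 1 is good. Good functions are closed under
   convolution and under multiplication by functions of the dimension vector, and
   by an argument of Guo and Peng all indicator functions are good as soon as
   those of the indecomposable modules are.
   The indecomposable modules are the uniserial modules without loop action and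
   the string modules M(i, j) in which the loop maps the socle of the uniserial
   module starting at [i] onto the socle of the one starting at [j]. They are
   singled out by their dimension vector, by torsion-freeness for the torsion pair
   of the modules supported below a vertex, and by the rank of the loop, which is
   detected by the number of simple submodules at the last vertex; only M(i, j) and
   M(j, i) are not separated in this way. For i < j, the uniserial module
   starting at [i] is a submodule, with uniserial quotient starting at [j], of
   M(j, i) in exactly one way, and of M(i, j) in none. *)

Require Import Defs.
From mathcomp Require Import all_boot all_order all_algebra.
From mathcomp Require Import all_field zify ring lra.
Set Implicit Arguments.
Unset Strict Implicit.
Unset Printing Implicit Defensive.
Import Order.TTheory GRing.Theory Num.Theory.
Local Open Scope ring_scope.

(** The recursions need an index set that does not move with the field. String modules are given by
    matrices with entries 0 and 1, so splitting off strings shows that every module over an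
    extension comes from [K]; as hom counts determine a module, modules that are not isomorphic over
    [K] stay so. One finite list of [K]-modules per dimension thus serves every extension. Monic
    denominators matter because the recursions divide, by orders of automorphism groups and by Hall
    numbers of split extensions. These are quotients of monic polynomials: at most a fraction dim/q
    of the endomorphisms is singular, so |Aut| has the leading term of |End|. Division by a monic
    polynomial stays over the integers, and a remainder that is small against its divisor but yields
    integers at arbitrarily large q vanishes. Torsion-freeness is not a function of the dimension
    vector. It is reached by writing a function as the convolution of its torsion-free part with the
    torsion indicator and inverting a unitriangular system. In the Guo-Peng step the product of two
    indicators is a multiple of that of the direct sum plus terms with smaller endomorphism
    rings. *)

(** * Modules as families of matrices indexed by generators *)

(** One space for the whole module instead of one per vertex: a homomorphism is then a single matrix
    and a submodule a single row space. The vertices return as idempotent generators. *)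
Record lmod (G : finType) (F : finFieldType) := Lmod {
  ldim : nat;
  lop : G -> 'M[F]_ldim }.
Arguments Lmod {G F}.

Section Lmod.
Variables (G : finType) (F : finFieldType).
Implicit Types (M N X Y Z A B C : lmod G F).

Definition lhom M N (f : 'M[F]_(ldim M, ldim N)) : bool :=
  [forall g, lop M g *m f == f *m lop N g].

Definition liso M N : bool :=
  [exists f : 'M[F]_(ldim M, ldim N), [exists f' : 'M[F]_(ldim N, ldim M),
     [&& lhom f, f *m f' == 1%:M & f' *m f == 1%:M]]].

(** Requiring [<<U>>%MS == U] selects one matrix per row space, so sums over such [U] are sums over
    submodules. *)
Definition submod M (U : 'M[F]_(ldim M)) : bool :=
  (<<U>>%MS == U) && [forall g, (U *m lop M g <= U)%MS].

Definition subl M (U : 'M[F]_(ldim M)) : lmod G F :=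
  Lmod (\rank U) (fun g => row_base U *m lop M g *m pinvmx (row_base U)).

(** [cokermx U] has kernel [U] but is square; [col_base] keeps the kernel and makes the map
    surjective. *)
Definition proj M (U : 'M[F]_(ldim M)) : 'M[F]_(ldim M, \rank (cokermx U)) :=
  col_base (cokermx U).

Definition quol M (U : 'M[F]_(ldim M)) : lmod G F :=
  Lmod (\rank (cokermx U)) (fun g => pinvmx (proj U) *m lop M g *m proj U).

Lemma lhomP M N (f : 'M[F]_(ldim M, ldim N)) :
  reflect (forall g, lop M g *m f = f *m lop N g) (lhom f).
Proof. exact: 'forall_eqP. Qed.

Lemma lhom1 M : lhom (M := M) (N := M) 1%:M.
Proof. by apply/lhomP => g; rewrite mulmx1 mul1mx. Qed.

Lemma lhom_comp M N Z (f : 'M_(ldim M, ldim N)) (h : 'M_(ldim N, ldim Z)) :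
  lhom f -> lhom h -> lhom (M := M) (N := Z) (f *m h).
Proof.
by move=> /lhomP hf /lhomP hh; apply/lhomP => g; rewrite mulmxA hf -!mulmxA hh.
Qed.

Lemma lhomB M N (f h : 'M_(ldim M, ldim N)) : lhom f -> lhom h -> lhom (f - h).
Proof.
by move=> /lhomP hf /lhomP hh; apply/lhomP => g; rewrite mulmxBr mulmxBl hf hh.
Qed.

Lemma lhomD M N (f h : 'M_(ldim M, ldim N)) : lhom f -> lhom h -> lhom (f + h).
Proof.
by move=> /lhomP hf /lhomP hh; apply/lhomP => g; rewrite mulmxDr mulmxDl hf hh.
Qed.

Lemma lhom0 M N : lhom (M := M) (N := N) 0.
Proof. by apply/lhomP => g; rewrite mulmx0 mul0mx. Qed.

Lemma lhomZ M N a (f : 'M_(ldim M, ldim N)) : lhom f -> lhom (a *: f).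
Proof. by move=> /lhomP hf; apply/lhomP => g; rewrite -scalemxAr -scalemxAl hf. Qed.

Lemma lhom_factor_inj A B M (f : 'M_(ldim A, ldim M)) (i : 'M_(ldim B, ldim M)) :
  lhom f -> lhom i -> row_free i -> (f <= i)%MS ->
  lhom (M := A) (N := B) (f *m pinvmx i) /\ f *m pinvmx i *m i = f.
Proof.
move=> /lhomP hf /lhomP hi fi le; have e := mulmxKpV le; split=> //.
apply/lhomP => g; apply: (row_free_inj fi).
by rewrite -[RHS]mulmxA hi -mulmxA e mulmxA e hf.
Qed.

(** The rows of [h *m pinvmx h - 1%:M] lie in the kernel of [h], hence are killed by [f]. *)
Lemma pinvmx_full_ker m n p (h : 'M[F]_(m, n)) (f : 'M_(m, p)) :
  row_full h -> kermx h *m f = 0 -> h *m (pinvmx h *m f) = f.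
Proof.
move=> fh ke; apply/eqP; rewrite mulmxA -subr_eq0 -[X in _ - X]mul1mx -mulmxBl.
have : (h *m pinvmx h - 1%:M <= kermx h)%MS.
  by rewrite sub_kermx mulmxBl -mulmxA mulVpmx // mulmx1 mul1mx subrr.
by case/submxP => D ->; rewrite -mulmxA ke mulmx0.
Qed.

Lemma row_full_inj m n p (h : 'M[F]_(m, n)) (x y : 'M_(n, p)) :
  row_full h -> h *m x = h *m y -> x = y.
Proof.
by move=> fh e; rewrite -[x]mul1mx -[y]mul1mx -(mulVpmx fh) -!mulmxA e.
Qed.

Lemma lhom_factor_epi M B C (h : 'M_(ldim M, ldim B)) (f : 'M_(ldim M, ldim C)) :
  lhom h -> row_full h -> lhom f -> kermx h *m f = 0 ->
  lhom (M := B) (N := C) (pinvmx h *m f) /\ h *m (pinvmx h *m f) = f.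
Proof.
move=> /lhomP hh fh /lhomP hf ke.
have e := pinvmx_full_ker fh ke; split=> //.
apply/lhomP => g; apply: (row_full_inj fh).
by rewrite mulmxA -hh -mulmxA e [RHS]mulmxA e hf.
Qed.

Lemma submod_gen M n (f : 'M_(n, ldim M)) :
  (forall g, (f *m lop M g <= f)%MS) -> submod <<f>>%MS.
Proof.
move=> h; rewrite /submod genmx_id eqxx; apply/forallP => g.
by rewrite genmxE (eqmxMr _ (genmxE f)).
Qed.

Lemma submod_im N M (f : 'M_(ldim N, ldim M)) : lhom f -> submod <<f>>%MS.
Proof.
by move=> /lhomP hf; apply: submod_gen => g; rewrite -hf submxMl.
Qed.

Lemma submod_ker N M (f : 'M_(ldim N, ldim M)) :
  lhom f -> submod (M := N) <<kermx f>>%MS.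
Proof.
move=> /lhomP hf; apply: submod_gen => g.
by rewrite sub_kermx -mulmxA hf mulmxA mulmx_ker mul0mx.
Qed.

Lemma submodP M (U : 'M_(ldim M)) g : submod U -> (U *m lop M g <= U)%MS.
Proof. by case/andP => _ /forallP. Qed.

Lemma submodE M (U : 'M_(ldim M)) : submod U -> <<U>>%MS = U.
Proof. by case/andP => /eqP. Qed.

Lemma submod_eq M (U V : 'M_(ldim M)) :
  submod U -> submod V -> (U :=: V)%MS -> U = V.
Proof. by move=> /submodE eU /submodE eV /eq_genmx; rewrite eU eV. Qed.

Lemma incl_hom M (U : 'M_(ldim M)) :
  submod U -> lhom (M := subl U) (N := M) (row_base U).
Proof.
move=> sU; apply/lhomP => g; rewrite /= mulmxKpV //.
by rewrite (eqmxMr _ (eq_row_base _)) eq_row_base submodP.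
Qed.

Lemma proj_full M (U : 'M_(ldim M)) : row_full (proj U).
Proof. exact: col_base_full. Qed.

Lemma proj_ker M (U : 'M_(ldim M)) m (x : 'M_(m, ldim M)) :
  (x *m proj U == 0) = (x <= U)%MS.
Proof.
rewrite submxE -[cokermx _ in RHS]mulmx_base mulmxA.
apply/idP/idP => [/eqP-> | /eqP e0]; first by rewrite mul0mx.
by apply/eqP; apply: (row_free_inj (row_base_free (cokermx U))); rewrite e0 mul0mx.
Qed.

Lemma kermx_proj M (U : 'M_(ldim M)) : (kermx (proj U) :=: U)%MS.
Proof.
apply/eqmxP; rewrite -proj_ker mulmx_ker eqxx /= sub_kermx.
by rewrite proj_ker.
Qed.

Lemma proj_hom M (U : 'M_(ldim M)) :
  submod U -> lhom (M := M) (N := quol U) (proj U).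
Proof.
move=> sU; apply/lhomP => g; rewrite /= -[X in _ = _ *m X]mulmxA.
rewrite pinvmx_full_ker ?proj_full //; apply/eqP; rewrite mulmxA proj_ker.
by rewrite (eqmxMr _ (kermx_proj U)) submodP.
Qed.

Lemma lisoP M N : reflect (exists f : 'M_(ldim M, ldim N), exists f' : 'M_(ldim N, ldim M),
   [/\ lhom f, lhom f', f *m f' = 1%:M & f' *m f = 1%:M]) (liso M N).
Proof.
apply: (iffP existsP) => -[f].
  case/existsP => f' /and3P[hf /eqP e /eqP e']; exists f, f'; split=> //.
  apply/lhomP => g; have /lhomP/(_ g) h := hf.
  by rewrite -[RHS]mulmx1 -e mulmxA -(mulmxA f') h mulmxA e' mul1mx.
by case=> f' [hf _ e e']; exists f; apply/existsP; exists f'; rewrite hf e e' !eqxx.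
Qed.

Lemma liso_hom M N (f : 'M_(ldim M, ldim N)) :
  lhom f -> row_free f -> row_full f -> liso M N.
Proof.
move=> hf fr fu; apply/existsP; exists f; apply/existsP; exists (pinvmx f).
by rewrite hf mulmxVp // mulVpmx // !eqxx.
Qed.

Lemma liso_refl M : liso M M.
Proof. by apply/lisoP; exists 1%:M, 1%:M; rewrite lhom1 mulmx1. Qed.

Lemma liso_sym M N : liso M N = liso N M.
Proof.
by apply/lisoP/lisoP => -[f [f' [*]]]; exists f', f; split.
Qed.

Lemma liso_trans : transitive liso.
Proof.
move=> N M Z /lisoP[f [f' [hf hf' e e']]] /lisoP[h [h' [hh hh' a a']]].
apply/lisoP; exists (f *m h), (h' *m f'); split; try exact: lhom_comp.
  by rewrite mulmxA -(mulmxA f) a mulmx1.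
by rewrite mulmxA -(mulmxA h') e' mulmx1.
Qed.

Lemma liso_ltrans M N : liso M N -> liso M =1 liso N.
Proof.
move=> h Z; apply/idP/idP; last exact: liso_trans h.
by apply: liso_trans; rewrite liso_sym.
Qed.

Lemma liso_rtrans M N Z : liso M N -> liso Z M = liso Z N.
Proof. by rewrite !(liso_sym Z) => /liso_ltrans. Qed.

Lemma row_free_inv m n (f : 'M[F]_(m, n)) (f' : 'M_(n, m)) :
  f *m f' = 1%:M -> row_free f.
Proof. by move=> e; apply/row_freeP; exists f'. Qed.

Lemma row_full_inv m n (f : 'M[F]_(m, n)) (f' : 'M_(n, m)) :
  f' *m f = 1%:M -> row_full f.
Proof. by move=> e; apply/row_fullP; exists f'. Qed.

Lemma liso_dim M N : liso M N -> ldim M = ldim N.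
Proof.
case/lisoP => f [f' [_ _ e e']].
have /eqP r := row_free_inv e; have /eqP r' := row_free_inv e'.
by apply/eqP; rewrite eqn_leq -{1}r rank_leq_col -{1}r' rank_leq_col.
Qed.

Lemma liso_free M N (f : 'M_(ldim M, ldim N)) :
  lhom f -> row_free f -> ldim M = ldim N -> liso M N.
Proof.
move=> hf fr d; apply: (liso_hom hf fr).
by apply/eqP; apply: etrans d; apply/eqP.
Qed.

Lemma liso_full M N (f : 'M_(ldim M, ldim N)) :
  lhom f -> row_full f -> ldim M = ldim N -> liso M N.
Proof.
move=> hf fr d; apply: (liso_hom hf) => //.
by apply/eqP; apply: etrans (esym d); apply/eqP.
Qed.

Lemma liso_subl Y M (U : 'M_(ldim M)) (f : 'M_(ldim Y, ldim M)) :
  submod U -> lhom f -> row_free f -> (f :=: U)%MS -> liso Y (subl U).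
Proof.
move=> sU hf fr e.
have le : (f <= row_base U)%MS by rewrite eq_row_base e.
have [hc ec] := lhom_factor_inj hf (incl_hom sU) (row_base_free U) le.
apply: (liso_free hc); last first.
  by have /eqP <- := fr; rewrite e.
rewrite /row_free eqn_leq rank_leq_row -[X in (X <= _)%N](eqP fr) -{1}ec.
exact: mxrankM_maxl.
Qed.

Lemma liso_quol X M (U : 'M_(ldim M)) (h : 'M_(ldim M, ldim X)) :
  submod U -> lhom h -> row_full h -> (kermx h :=: U)%MS -> liso (quol U) X.
Proof.
move=> sU hh fu e.
have ke : kermx (proj U) *m h = 0.
  by apply/eqP; rewrite -sub_kermx (kermx_proj U) -(e).
have [hc ec] := lhom_factor_epi (proj_hom sU) (proj_full U) hh ke.
apply: (liso_full hc).
  rewrite /row_full eqn_leq rank_leq_col -[X in (X <= _)%N](eqP fu) -{1}ec.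
  exact: mxrankM_maxr.
by rewrite /= mxrank_coker -e mxrank_ker subKn ?rank_leq_row //; apply/eqP.
Qed.

Lemma first_iso A B (f : 'M_(ldim A, ldim B)) (U : 'M_(ldim A)) (V : 'M_(ldim B)) :
  lhom f -> submod U -> submod V -> (kermx f :=: U)%MS -> (f :=: V)%MS ->
  liso (quol U) (subl V).
Proof.
move=> hf sU sV eU eV.
have le : (f <= row_base V)%MS by rewrite eq_row_base eV.
have [hc ec] := lhom_factor_inj hf (incl_hom sV) (row_base_free V) le.
apply: (liso_quol sU hc).
  rewrite /row_full eqn_leq rank_leq_col /=.
  by apply: leq_trans (mxrankM_maxl _ (row_base V)); rewrite ec eV.
apply: eqmx_trans eU; apply/eqmxP/andP; split; rewrite sub_kermx.
  by rewrite -[X in _ *m X]ec mulmxA mulmx_ker mul0mx.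
apply/eqP; apply: (row_free_inj (row_base_free V)).
by rewrite mul0mx -mulmxA ec mulmx_ker.
Qed.

End Lmod.

(** * Sums over submodules and over chains of two submodules *)

Section Chains.
Variables (G : finType) (F : finFieldType).
Implicit Types (M N X Y Z A B C : lmod G F).

Lemma eqmx_sub m1 m2 n (A : 'M[F]_(m1, n)) (B : 'M[F]_(m2, n)) :
  (forall m (x : 'M_(m, n)), (x <= A)%MS = (x <= B)%MS) -> (A :=: B)%MS.
Proof. by move=> h; apply/eqmxP; rewrite -(h _ A) (h _ B) !submx_refl. Qed.

Lemma sub_kermx_comp m n p k (x : 'M[F]_(k, m)) (f : 'M_(m, n)) (h : 'M_(n, p)) :
  (x <= kermx (f *m h))%MS = (x *m f <= kermx h)%MS.
Proof. by rewrite !sub_kermx mulmxA. Qed.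

Lemma subl_mono M M' (U : 'M_(ldim M)) (f : 'M_(ldim M, ldim M')) :
  submod U -> lhom f -> row_free f ->
  submod (M := M') <<U *m f>>%MS /\ liso (subl U) (subl (M := M') <<U *m f>>%MS).
Proof.
move=> sU hf fr; have hi := lhom_comp (incl_hom sU) hf.
have e : (row_base U *m f :=: <<U *m f>>)%MS.
  by apply: eqmx_trans (eqmx_sym (genmxE _)); apply: eqmxMr; apply: eq_row_base.
have s : submod (M := M') <<U *m f>>%MS.
  have := submod_im hi; suff -> : <<row_base U *m f>>%MS = <<U *m f>>%MS by [].
  by rewrite (eq_genmx e) genmx_id.
split=> //; apply: (liso_subl s hi) e.
by rewrite /row_free mxrankMfree //; apply: row_base_free.
Qed.

Lemma row_full_mul m n p (A : 'M[F]_(m, n)) (B : 'M_(n, p)) :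
  row_full A -> row_full B -> row_full (A *m B).
Proof. by move=> fA fB; rewrite /row_full (eqmxMfull _ fA). Qed.

Lemma quol_iso M M' (U : 'M_(ldim M)) (f : 'M_(ldim M, ldim M')) :
  submod U -> lhom f -> row_free f -> row_full f ->
  liso (quol U) (quol (M := M') <<U *m f>>%MS).
Proof.
move=> sU hf fr fu; have [s _] := subl_mono sU hf fr.
apply: (liso_quol sU (lhom_comp hf (proj_hom s))).
  exact: row_full_mul fu (proj_full _).
apply: eqmx_sub => m x.
by rewrite sub_kermx_comp (kermx_proj (M := M')) genmxE submxMfree.
Qed.

(** An isomorphism carries submodules to submodules together with their quotients. The values lie in
    any [nmodType] so that both counts and rational sums are covered. *)
Lemma sum_submod_iso (V : nmodType) (Phi : lmod G F -> lmod G F -> V) M M' :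
  (forall A A' B B', liso A A' -> liso B B' -> Phi A B = Phi A' B') ->
  liso M M' ->
  \sum_(U : 'M_(ldim M) | submod U) Phi (subl U) (quol U) =
  \sum_(U : 'M_(ldim M') | submod U) Phi (subl U) (quol U).
Proof.
move=> hPhi /lisoP[f [f' [hf hf' e e']]].
have fr := row_free_inv e; have fu := row_full_inv e'.
have fr' := row_free_inv e'.
rewrite [RHS](reindex_onto (fun U : 'M_(ldim M) => <<U *m f>>%MS : 'M_(ldim M'))
   (fun U => <<U *m f'>>%MS)) /=; last first.
  move=> U sU; rewrite -[RHS](submodE sU); apply/eq_genmx.
  by apply: eqmx_trans (eqmxMr _ (genmxE _)) _; rewrite -mulmxA e' mulmx1.
have cc (U : 'M_(ldim M)) : <<<<U *m f>>%MS *m f'>>%MS = <<U>>%MS.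
  apply/eq_genmx.
  by apply: eqmx_trans (eqmxMr _ (genmxE _)) _; rewrite -mulmxA e mulmx1.
apply: eq_big => [U | U sU].
  rewrite cc; apply/idP/idP => [sU | /andP[sU /eqP eU]].
    by have [-> _] := subl_mono sU hf fr; rewrite submodE ?eqxx.
  by have [] := subl_mono sU hf' fr'; rewrite cc eU.
have [_ i] := subl_mono sU hf fr.
exact: hPhi i (quol_iso sU hf fr fu).
Qed.

(** For [U] inside [W]: the submodule [U] in the coordinates of the chosen basis of [W]. *)
Definition relmx M (U W : 'M[F]_(ldim M)) : 'M_(\rank W) :=
  <<U *m pinvmx (row_base W)>>%MS.

Lemma relmxE M (U W : 'M[F]_(ldim M)) : (U <= W)%MS ->
  (relmx U W *m row_base W :=: U)%MS.
Proof.
move=> le; apply: eqmx_trans (eqmxMr _ (genmxE _)) _.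
by rewrite mulmxKpV // eq_row_base.
Qed.

Lemma relmx_sub M (U W : 'M[F]_(ldim M)) m (x : 'M_(m, \rank W)) : (U <= W)%MS ->
  (x <= relmx U W)%MS = (x *m row_base W <= U)%MS.
Proof.
move=> le; rewrite -(relmxE le) submxMfree //; exact: row_base_free.
Qed.

Lemma submod_relmx M (U W : 'M_(ldim M)) :
  submod U -> submod W -> (U <= W)%MS -> submod (M := subl W) (relmx U W).
Proof.
move=> sU sW le; apply: (submod_gen (M := subl W)) => g.
have le' : (U <= row_base W)%MS by rewrite eq_row_base.
rewrite -(submxMfree _ _ (row_base_free W)) -[X in (X <= _)%MS]mulmxA.
have /= -> := lhomP _ (incl_hom sW) g.
by rewrite mulmxA mulmxKpV // submodP.
Qed.

(** Half of the associativity of Hall multiplication: chains [U <= W] with [W] fixed. The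
    subquotient has the same form as in [chain_quol], so that the two sums can be exchanged. *)
Lemma chain_subl (V : nmodType) (Phi : lmod G F -> lmod G F -> V) M (W : 'M_(ldim M)) :
  (forall A A' B B', liso A A' -> liso B B' -> Phi A B = Phi A' B') ->
  submod W ->
  \sum_(U : 'M_(ldim (subl W)) | submod U) Phi (subl U) (quol U) =
  \sum_(U : 'M_(ldim M) | submod U && (U <= W)%MS)
     Phi (subl U) (quol (M := subl W) (relmx U W)).
Proof.
move=> hPhi sW.
rewrite [RHS](reindex_onto (fun U : 'M_(ldim (subl W)) => <<U *m row_base W>>%MS : 'M_(ldim M))
   (fun U => relmx U W)) /=; last first.
  move=> U /andP[sU le]; rewrite -[RHS](submodE sU); apply/eq_genmx.
  exact: relmxE.
have le (U : 'M_(\rank W)) : (<<U *m row_base W>> <= W)%MS.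
  by rewrite genmxE -(eq_row_base W) submxMl.
have cc (U : 'M_(\rank W)) : relmx (M := M) <<U *m row_base W>>%MS W = <<U>>%MS.
  rewrite -[LHS]genmx_id; apply/eq_genmx; apply: eqmx_sub => m x.
  by rewrite relmx_sub // genmxE submxMfree // row_base_free.
apply: eq_big => [U | U sU].
  rewrite cc le andbT; apply/idP/idP => [sU | /andP[sU /eqP eU]].
    have [-> _] := subl_mono sU (incl_hom sW) (row_base_free W).
    by apply/eqP/(submodE sU).
  by have := submod_relmx sU sW (le U); rewrite cc eU.
rewrite cc; have -> : <<U>>%MS = U := submodE sU.
apply: hPhi; last exact: liso_refl.
by have [] := subl_mono sU (incl_hom sW) (row_base_free W).
Qed.

Lemma subl_quol M (U W : 'M_(ldim M)) (W' : 'M_(ldim (quol U))) :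
  submod U -> submod W -> submod W' -> (U <= W)%MS -> (W *m proj U :=: W')%MS ->
  liso (subl W') (quol (M := subl W) (relmx U W)).
Proof.
move=> sU sW sW' le e; rewrite liso_sym.
apply: (first_iso (lhom_comp (incl_hom sW) (proj_hom sU))) => //.
- exact: submod_relmx.
- apply: eqmx_sub => m x; rewrite relmx_sub // sub_kermx_comp.
  by rewrite (kermx_proj (M := M)).
- by apply: eqmx_trans (eqmxMr _ (eq_row_base _)) e.
Qed.

(** The other half, with [U] fixed: the correspondence theorem together with the third isomorphism
    theorem. *)
Lemma chain_quol (V : nmodType) (Phi : lmod G F -> lmod G F -> V) M (U : 'M_(ldim M)) :
  (forall A A' B B', liso A A' -> liso B B' -> Phi A B = Phi A' B') ->
  submod U ->
  \sum_(W' : 'M_(ldim (quol U)) | submod W') Phi (subl W') (quol W') =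
  \sum_(W : 'M_(ldim M) | submod W && (U <= W)%MS)
     Phi (quol (M := subl W) (relmx U W)) (quol W).
Proof.
move=> hPhi sU.
(* The preimage of [W'], as the kernel of the map from [M] to the quotient of [quol U] by [W']. *)
pose pre (W' : 'M_(ldim (quol U))) : 'M_(ldim M) :=
  <<kermx (proj U *m proj (M := quol U) W')>>%MS.
have preE W' m (x : 'M_(m, ldim M)) :
    (x <= pre W')%MS = (x *m proj U <= W')%MS.
  by rewrite genmxE sub_kermx_comp (kermx_proj (M := quol U)).
have preU W' : (U <= pre W')%MS.
  rewrite preE; suff /eqP -> : U *m proj U == 0 by rewrite sub0mx.
  by rewrite (proj_ker (M := M)).
have cc W' : (pre W' *m proj U :=: W')%MS.
  apply/eqmxP; rewrite -preE submx_refl /=.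
  rewrite -[X in (X <= _)%MS]mulmx1 -(mulVpmx (proj_full U)) mulmxA.
  by apply: submxMr; rewrite preE -mulmxA (mulVpmx (proj_full U)) mulmx1.
rewrite [RHS](reindex_onto pre (fun W => <<W *m proj U>>%MS)) /=; last first.
  move=> W /andP[sW le]; rewrite -[RHS](submodE sW) -[LHS]genmx_id.
  apply/eq_genmx; apply: eqmx_sub => m x; rewrite preE genmxE.
  apply/idP/idP => [|/submxMr -> //] /submxP[D e].
  have : (x - D *m W <= U)%MS by rewrite -proj_ker mulmxBl e mulmxA subrr.
  move=> /submx_trans /(_ le) h; rewrite -[x](subrK (D *m W)).
  by rewrite addmx_sub // submxMl.
apply: eq_big => [W' | W' sW'].
  rewrite preU andbT; apply/idP/idP => [sW' | /andP[sW' /eqP eW]].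
    rewrite (submod_ker (lhom_comp (proj_hom sU) (proj_hom sW'))) /=.
    by apply/eqP; rewrite -[RHS](submodE sW'); apply/eq_genmx.
  rewrite -eW; apply: (submod_gen (M := quol U)) => g.
  rewrite -mulmxA; have /= <- := lhomP _ (proj_hom sU) g; rewrite mulmxA.
  by apply: submxMr; apply: submodP.
have sW : submod (pre W') := submod_ker (lhom_comp (proj_hom sU) (proj_hom sW')).
apply: hPhi; first exact: subl_quol.
rewrite liso_sym; apply: (liso_quol sW (lhom_comp (proj_hom sU) (proj_hom sW'))).
  by apply: row_full_mul; [exact: (proj_full (M := M)) | exact: (proj_full (M := quol U))].
exact: eqmx_sym (genmxE _).
Qed.

End Chains.

(** * Counting homomorphisms, injections, surjections and submodules *)

Section Counts.
Variables (G : finType) (F : finFieldType).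
Implicit Types (M N X Y Z A B C : lmod G F).

Definition nhom M N := #|[set f : 'M_(ldim M, ldim N) | lhom f]|.
Definition ninj M N := #|[set f : 'M_(ldim M, ldim N) | lhom f && row_free f]|.
Definition nepi M N := #|[set f : 'M_(ldim M, ldim N) | lhom f && row_full f]|.
Definition naut M := ninj M M.
Definition nsub Y M := #|[set U : 'M_(ldim M) | submod U && liso (subl U) Y]|.
Definition nquo X M := #|[set U : 'M_(ldim M) | submod U && liso (quol U) X]|.
Definition nhall X Y M :=
  #|[set U : 'M_(ldim M) | [&& submod U, liso (subl U) Y & liso (quol U) X]]|.

(** Two injections with the same image differ by a unique automorphism of [Y]. The boolean factor
    makes the count zero when no injection has image [U]. *)
Lemma ninj_im Y M (U : 'M_(ldim M)) : submod U ->
  #|[set f : 'M_(ldim Y, ldim M) | lhom f && row_free f && (<<f>>%MS == U)]| =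
  (liso (subl U) Y * naut Y)%N.
Proof.
move=> sU; have [i|ni] := boolP (liso _ _); last first.
  rewrite mul0n; apply/eqP; rewrite cards_eq0; apply/eqP/setP => f; rewrite !inE.
  apply/negP => /andP[/andP[hf fr] /eqP e]; case/negP: ni; rewrite liso_sym.
  by apply: (liso_subl sU hf fr); rewrite -e; apply: eqmx_sym (genmxE f).
rewrite mul1n; move: i; rewrite liso_sym => /lisoP[t [t' [ht ht' e e']]].
set k := t *m row_base U.
have hk : lhom (M := Y) (N := M) k by apply: lhom_comp (incl_hom sU).
have fk : row_free k.
  rewrite /row_free mxrankMfree ?row_base_free //; exact: row_free_inv e.
have ek : (k :=: U)%MS.
  apply: eqmx_trans (eqmxMfull _ (row_full_inv e')) _; exact: eq_row_base.
rewrite /naut /ninj -(card_imset _ (row_free_inj fk : injective (mulmx^~ k))).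
apply: eq_card => f; rewrite !inE; apply/idP/imsetP.
  case/andP=> /andP[hf fr] /eqP ef.
  have le : (f <= k)%MS by rewrite ek -ef genmxE.
  have [hc ec] := lhom_factor_inj hf hk fk le.
  exists (f *m pinvmx k); last by rewrite ec.
  rewrite inE hc /row_free -(mxrankMfree _ fk) ec; exact: fr.
case=> phi; rewrite inE => /andP[hp fp] ->.
rewrite (lhom_comp hp hk) /=; apply/andP; split.
  by rewrite /row_free mxrankMfree.
apply/eqP; rewrite -[RHS](submodE sU); apply/eq_genmx; apply: eqmx_trans ek.
by apply: eqmxMfull; rewrite row_full_unit -row_free_unit.
Qed.

Lemma card_set_sum (T : finType) (P : pred T) : #|[set x | P x]| = \sum_(x | P x) 1%N.
Proof. by rewrite sum1dep_card. Qed.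

Lemma card_fibers (T T' : finType) (P : pred T) (Q : pred T') (h : T -> T') :
  (forall x, P x -> Q (h x)) ->
  #|[set x | P x]| = (\sum_(y | Q y) #|[set x | P x && (h x == y)]|)%N.
Proof.
move=> hQ; rewrite card_set_sum (partition_big h Q) //.
by apply: eq_bigr => y _; rewrite card_set_sum.
Qed.

Lemma nsubE Y M :
  nsub Y M = (\sum_(U : 'M_(ldim M) | submod U) liso (subl U) Y)%N.
Proof. by rewrite /nsub card_set_sum big_mkcondr; apply: eq_bigr => U _; case: ifP. Qed.

Lemma nquoE X M :
  nquo X M = (\sum_(U : 'M_(ldim M) | submod U) liso (quol U) X)%N.
Proof. by rewrite /nquo card_set_sum big_mkcondr; apply: eq_bigr => U _; case: ifP. Qed.

Lemma ninjE Y M : ninj Y M = (nsub Y M * naut Y)%N.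
Proof.
rewrite /ninj (card_fibers (Q := @submod G F M) (h := fun f => <<f>>%MS)); last first.
  by move=> f /andP[hf _]; apply: submod_im hf.
rewrite nsubE big_distrl /=.
by apply: eq_bigr => U sU; rewrite -(ninj_im Y sU).
Qed.

(** A homomorphism is the projection modulo its kernel followed by a unique injection. *)
Lemma nhom_ker Y M : nhom Y M = (\sum_(W : 'M_(ldim Y) | submod W) ninj (quol W) M)%N.
Proof.
rewrite /nhom (card_fibers (Q := @submod G F Y) (h := fun f => <<kermx f>>%MS)); last first.
  by move=> f; apply: submod_ker.
apply: eq_bigr => W sW.
have inj : injective (mulmx (proj W) : 'M[F]_(_, ldim M) -> _).
  by move=> x y e; apply: (row_full_inj (proj_full (M := Y) W)) e.
rewrite /ninj -(card_imset _ inj).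
apply: eq_card => f; rewrite !inE; apply/idP/imsetP.
  case/andP=> hf /eqP ef.
  have ek : (kermx f :=: W)%MS by rewrite -ef; apply: eqmx_sym (genmxE _).
  have ke : kermx (proj W) *m f = 0.
    by apply/eqP; rewrite -sub_kermx (kermx_proj (M := Y)) ek.
  have [hc ec] := lhom_factor_epi (proj_hom sW) (proj_full W) hf ke.
  exists (pinvmx (proj W) *m f); last by rewrite ec.
  rewrite inE hc -kermx_eq0 -submx0.
  rewrite -(mulmx1 (kermx _)) -(mulVpmx (proj_full W)) mulmxA.
  rewrite (_ : _ *m proj W = 0) ?sub0mx //; apply/eqP; rewrite (proj_ker (M := Y)).
  by rewrite -ek sub_kermx -mulmxA mulmx_ker.
case=> phi; rewrite inE => /andP[hp fp] ->.
rewrite (lhom_comp (proj_hom sW) hp) /=; apply/eqP; rewrite -[RHS](submodE sW).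
apply/eq_genmx; apply: eqmx_sub => m x.
by rewrite sub_kermx_comp sub_kermx mulmx_free_eq0 // (proj_ker (M := Y)).
Qed.

Lemma nhom_im Y M : nhom Y M = (\sum_(U : 'M_(ldim M) | submod U) nepi Y (subl U))%N.
Proof.
rewrite /nhom (card_fibers (Q := @submod G F M) (h := fun f => <<f>>%MS)); last first.
  by move=> f; apply: submod_im.
apply: eq_bigr => U sU.
rewrite /nepi -(card_imset _ (row_free_inj (row_base_free U) : injective (mulmx^~ _))).
apply: eq_card => f; rewrite !inE; apply/idP/imsetP.
  case/andP=> hf /eqP ef.
  have le : (f <= row_base U)%MS by rewrite eq_row_base -ef genmxE.
  have [hc ec] := lhom_factor_inj hf (incl_hom sU) (row_base_free U) le.
  exists (f *m pinvmx (row_base U)); last by rewrite ec.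
  rewrite inE hc /row_full eqn_leq rank_leq_col /=.
  apply: leq_trans (mxrankM_maxl _ (row_base U)); rewrite ec -{1}ef.
  by rewrite genmxE.
case=> phi; rewrite inE => /andP[hp fp] ->.
rewrite (lhom_comp hp (incl_hom sU)) /=; apply/eqP; rewrite -[RHS](submodE sU).
apply/eq_genmx; apply: eqmx_trans (eqmxMfull _ fp) _; exact: eq_row_base.
Qed.

(** Two surjections with the same kernel differ by a unique automorphism of [X]. *)
Lemma nepi_ker X M (W : 'M_(ldim M)) : submod W ->
  #|[set f : 'M_(ldim M, ldim X) | lhom f && row_full f && (<<kermx f>>%MS == W)]| =
  (liso (quol W) X * naut X)%N.
Proof.
move=> sW; have [i|ni] := boolP (liso _ _); last first.
  rewrite mul0n; apply/eqP; rewrite cards_eq0; apply/eqP/setP => f; rewrite !inE.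
  apply/negP => /andP[/andP[hf fr] /eqP e]; case/negP: ni.
  by apply: (liso_quol sW hf fr); rewrite -e; apply: eqmx_sym (genmxE _).
rewrite mul1n; case/lisoP: i => [t [t' [ht ht' e e']]].
set k := proj W *m t.
have hk : lhom (M := M) (N := X) k by apply: lhom_comp (proj_hom sW) ht.
have fk : row_full k.
  by apply: row_full_mul; [exact: (proj_full (M := M)) | exact: row_full_inv e'].
have ek : (kermx k :=: W)%MS.
  apply: eqmx_sub => m x; rewrite sub_kermx_comp sub_kermx mulmx_free_eq0.
    exact: (proj_ker (M := M)).
  exact: row_free_inv e.
have inj : injective (mulmx k : 'M[F]_(_, ldim X) -> _).
  by move=> x y exy; apply: (row_full_inj fk) exy.
rewrite /naut /ninj -(card_imset _ inj).
apply: eq_card => f; rewrite !inE; apply/idP/imsetP.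
  case/andP=> /andP[hf fu] /eqP ef.
  have ke : kermx k *m f = 0.
    by apply/eqP; rewrite -sub_kermx ek -ef genmxE.
  have [hc ec] := lhom_factor_epi hk fk hf ke.
  exists (pinvmx k *m f); last by rewrite ec.
  rewrite inE hc row_free_unit -row_full_unit.
  rewrite /row_full eqn_leq rank_leq_col -[X in (X <= _)%N](eqP fu) -{1}ec.
  exact: mxrankM_maxr.
case=> phi; rewrite inE => /andP[hp fp] ->.
rewrite (lhom_comp hk hp) /=; apply/andP; split.
  by apply: row_full_mul => //; rewrite row_full_unit -row_free_unit.
apply/eqP; rewrite -[RHS](submodE sW); apply/eq_genmx.
apply: eqmx_sub => m x; rewrite -ek.
by rewrite sub_kermx_comp !sub_kermx mulmx_free_eq0.
Qed.

Lemma nepiE X M : nepi M X = (nquo X M * naut X)%N.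
Proof.
rewrite /nepi (card_fibers (Q := @submod G F M) (h := fun f => <<kermx f>>%MS)); last first.
  by move=> f /andP[hf _]; apply: submod_ker hf.
rewrite nquoE big_distrl /=.
by apply: eq_bigr => U sU; rewrite -(nepi_ker X sU).
Qed.

Lemma nhom_iso A A' B B' : liso A A' -> liso B B' -> nhom A B = nhom A' B'.
Proof.
have le C C' D D' : liso C C' -> liso D D' -> (nhom C D <= nhom C' D')%N.
  move=> /lisoP[f [f' [hf hf' e e']]] /lisoP[k [k' [hk hk' a a']]].
  have inj : injective (fun x : 'M[F]_(ldim C, ldim D) => f' *m x *m k).
    move=> x y /(row_free_inj (row_free_inv a)) exy.
    by apply: (row_full_inj (row_full_inv e)) exy.
  rewrite /nhom -(card_imset _ inj); apply/subset_leq_card/subsetP => x.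
  case/imsetP => z; rewrite !inE => hz ->.
  exact: lhom_comp (lhom_comp hf' hz) hk.
move=> iA iB; apply/eqP; by rewrite eqn_leq !le // liso_sym.
Qed.

Lemma liso_ninj_gt0 M N : ldim M = ldim N -> liso M N = (0 < ninj M N)%N.
Proof.
move=> d; rewrite /ninj; apply/idP/card_gt0P => [/lisoP[f [f' [hf hf' e e']]]|[f]].
  by exists f; rewrite inE hf (row_free_inv e).
by rewrite inE => /andP[hf ff]; apply: (liso_free hf ff d).
Qed.

Lemma naut_gt0 M : (0 < naut M)%N.
Proof. by rewrite -liso_ninj_gt0 // liso_refl. Qed.

Lemma nhall_iso X X' Y Y' M M' : liso X X' -> liso Y Y' -> liso M M' ->
  nhall X Y M = nhall X' Y' M'.
Proof.
move=> iX iY iM.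
have E A B Z : nhall A B Z =
    (\sum_(U : 'M_(ldim Z) | submod U) (liso (subl U) B && liso (quol U) A : nat))%N.
  rewrite /nhall card_set_sum big_mkcondr; apply: eq_bigr => U _.
  by case: (_ && _).
rewrite !E.
have := @sum_submod_iso G F nat (fun A B => liso A Y && liso B X : nat) M M'; rewrite /= => ->//.
  by apply: eq_bigr => U _; rewrite (liso_rtrans _ iY) (liso_rtrans _ iX).
by move=> A A' B B' iA iB; rewrite (liso_ltrans iA) (liso_ltrans iB).
Qed.

Lemma nquo_iso Y Y' M M' : liso Y Y' -> liso M M' -> nquo Y M = nquo Y' M'.
Proof.
move=> iY iM; rewrite !nquoE.
have := @sum_submod_iso G F nat (fun A B => liso B Y : nat) M M'; rewrite /= => ->//.
  by apply: eq_bigr => U _; rewrite (liso_rtrans _ iY).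
by move=> A A' B B' _ iA; rewrite (liso_ltrans iA).
Qed.

Lemma ninj_iso A A' B B' : liso A A' -> liso B B' -> ninj A B = ninj A' B'.
Proof.
have le C C' D D' : liso C C' -> liso D D' -> (ninj C D <= ninj C' D')%N.
  move=> /lisoP[f [f' [hf hf' a a']]] /lisoP[k [k' [hk hk' b b']]].
  have inj : injective (fun x : 'M[F]_(ldim C, ldim D) => f' *m x *m k).
    move=> x y /(row_free_inj (row_free_inv b)) exy.
    by apply: (row_full_inj (row_full_inv a)) exy.
  rewrite /ninj -(card_imset _ inj); apply/subset_leq_card/subsetP => x.
  case/imsetP => z; rewrite !inE => /andP[hz fz] ->.
  rewrite (lhom_comp (lhom_comp hf' hz) hk) /=.
  have /row_freeP[w ew] := fz.
  apply: (@row_free_inv _ _ _ _ (k' *m w *m f)).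
  by rewrite !mulmxA -(mulmxA _ k) b mulmx1 -(mulmxA f') ew mulmx1.
move=> iA iB; apply/eqP; by rewrite eqn_leq !le // liso_sym.
Qed.

Lemma nepi_iso A A' B B' : liso A A' -> liso B B' -> nepi A B = nepi A' B'.
Proof. by move=> iA iB; rewrite !nepiE (nquo_iso iB iA) /naut (ninj_iso iB iB). Qed.

End Counts.

(** * Direct sums and scalar extension *)

Section DirectSum.
Variables (G : finType) (F : finFieldType).
Implicit Types (M N X Y Z A B C : lmod G F).

Definition dsuml M N : lmod G F :=
  Lmod (ldim M + ldim N) (fun g => block_mx (lop M g) 0 0 (lop N g)).

Lemma lhom_col A B C (f : 'M_(ldim A, ldim C)) (h : 'M_(ldim B, ldim C)) :
  lhom (M := dsuml A B) (N := C) (col_mx f h) = lhom f && lhom h.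
Proof.
have e g : (lop (dsuml A B) g *m col_mx f h == col_mx f h *m lop C g) =
  (lop A g *m f == f *m lop C g) && (lop B g *m h == h *m lop C g).
  rewrite /= mul_block_col mul_col_mx !mul0mx addr0 add0r.
  by apply/eqP/andP => [/eq_col_mx[-> ->]|[/eqP-> /eqP->]].
apply/forallP/andP => [H|[/forallP H1 /forallP H2] g]; last by rewrite e H1 H2.
by split; apply/forallP => g; move: (H g); rewrite e => /andP[].
Qed.

Lemma lhom_row A B C (f : 'M_(ldim C, ldim A)) (h : 'M_(ldim C, ldim B)) :
  lhom (M := C) (N := dsuml A B) (row_mx f h) = lhom f && lhom h.
Proof.
have e g : (lop C g *m row_mx f h == row_mx f h *m lop (dsuml A B) g) =
  (lop C g *m f == f *m lop A g) && (lop C g *m h == h *m lop B g).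
  rewrite /= mul_row_block mul_mx_row !mulmx0 addr0 add0r.
  by apply/eqP/andP => [/eq_row_mx[-> ->]|[/eqP-> /eqP->]].
apply/forallP/andP => [H|[/forallP H1 /forallP H2] g]; last by rewrite e H1 H2.
by split; apply/forallP => g; move: (H g); rewrite e => /andP[].
Qed.

Lemma nhom_dsuml A B C : nhom (dsuml A B) C = (nhom A C * nhom B C)%N.
Proof.
rewrite /nhom -cardsX.
have inj : injective (fun p : 'M[F]_(ldim A, ldim C) * 'M[F]_(ldim B, ldim C) =>
  col_mx p.1 p.2) by move=> [a b] [c d] /eq_col_mx /= [-> ->].
rewrite -(card_imset _ inj); apply: eq_card => f; apply/idP/imsetP.
  rewrite inE -[f]vsubmxK lhom_col => /andP[h1 h2].
  by exists (usubmx f, dsubmx f); rewrite // !inE h1.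
by case=> -[a b]; rewrite !inE /= => /andP[ha hb] ->; rewrite lhom_col ha.
Qed.

Lemma nhom_dsumr A B C : nhom C (dsuml A B) = (nhom C A * nhom C B)%N.
Proof.
rewrite /nhom -cardsX.
have inj : injective (fun p : 'M[F]_(ldim C, ldim A) * 'M[F]_(ldim C, ldim B) =>
  row_mx p.1 p.2) by move=> [a b] [c d] /eq_row_mx /= [-> ->].
rewrite -(card_imset _ inj); apply: eq_card => f; apply/idP/imsetP.
  rewrite inE -[f]hsubmxK lhom_row => /andP[h1 h2].
  by exists (lsubmx f, rsubmx f); rewrite // !inE h1.
by case=> -[a b]; rewrite !inE /= => /andP[ha hb] ->; rewrite lhom_row ha.
Qed.

Lemma lhom_block A A' B B' (f : 'M_(ldim A, ldim A')) (h : 'M_(ldim B, ldim B')) :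
  lhom f -> lhom h ->
  lhom (M := dsuml A B) (N := dsuml A' B') (block_mx f 0 0 h).
Proof.
by move=> hf hh; rewrite lhom_col !lhom_row hf hh !lhom0.
Qed.

Lemma dsuml_iso A A' B B' :
  liso A A' -> liso B B' -> liso (dsuml A B) (dsuml A' B').
Proof.
move=> /lisoP[f [f' [hf hf' e e']]] /lisoP[k [k' [hk hk' b b']]].
apply/lisoP; exists (block_mx f 0 0 k), (block_mx f' 0 0 k').
split; rewrite ?lhom_block //.
  by rewrite mulmx_block !mulmx0 !mul0mx !addr0 !add0r e b -scalar_mx_block.
by rewrite mulmx_block !mulmx0 !mul0mx !addr0 !add0r e' b' -scalar_mx_block.
Qed.

Lemma dsumlC A B : liso (dsuml A B) (dsuml B A).
Proof.
have h X Y : lhom (M := dsuml X Y) (N := dsuml Y X) (block_mx 0 1%:M 1%:M 0).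
  by rewrite lhom_col !lhom_row !lhom0 !lhom1.
apply/lisoP; exists (block_mx 0 1%:M 1%:M 0), (block_mx 0 1%:M 1%:M 0).
split; rewrite ?h //.
  by rewrite mulmx_block !mulmx0 !mul0mx !addr0 !add0r !mulmx1 -scalar_mx_block.
by rewrite mulmx_block !mulmx0 !mul0mx !addr0 !add0r !mulmx1 -scalar_mx_block.
Qed.

(** A retract splits off: the image of [s] and the kernel of [r] are complementary. *)
Lemma dsuml_retract X Z (s : 'M_(ldim Z, ldim X)) (r : 'M_(ldim X, ldim Z)) :
  lhom s -> lhom r -> s *m r = 1%:M ->
  submod (M := X) <<kermx r>>%MS /\
  liso X (dsuml Z (subl (M := X) <<kermx r>>%MS)).
Proof.
move=> hs hr e; have sW := submod_ker hr; split=> //.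
set W : 'M_(ldim X) := <<kermx r>>%MS in sW *.
rewrite liso_sym.
have ir : row_base W *m r = 0.
  by apply/eqP; rewrite -sub_kermx eq_row_base genmxE.
apply: (@liso_free _ _ (dsuml Z (subl W)) X (col_mx s (row_base W))).
- by rewrite lhom_col hs; apply: incl_hom.
- rewrite -kermx_eq0; apply/eqP/row_matrixP => i; rewrite row0.
  set u := row i _; have : u *m col_mx s (row_base W) = 0.
    by rewrite /u -row_mul mulmx_ker row0.
  rewrite -[u]hsubmxK mul_row_col => e0.
  have e1 : lsubmx u = 0.
    have := congr1 (mulmx^~ r) e0.
    by rewrite mulmxDl -[X in X + _]mulmxA e -[X in _ + X]mulmxA ir mulmx1 mulmx0 addr0 mul0mx.
  have e2 : rsubmx u = 0.
    apply: (row_free_inj (row_base_free W)); rewrite mul0mx.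
    by move: e0; rewrite e1 mul0mx add0r.
  by rewrite e1 e2 row_mx0.
- rewrite /= (_ : \rank W = (ldim X - ldim Z)%N).
    by rewrite subnKC // -(eqP (row_free_inv e)) rank_leq_col.
  by rewrite genmxE mxrank_ker (eqP (row_full_inv e)).
Qed.

End DirectSum.

(** * Hom spaces under scalar extension; modules determined by hom counts *)

Section HomCount.
Variables (G : finType).

(** The intertwining condition for [g] as a linear system in [mxvec f], so that hom spaces become
    kernels of matrices. *)
Definition homsys (F : finFieldType) (M N : lmod G F) g :
    'M[F]_(ldim M * ldim N, ldim M * ldim N) :=
  lin_mulmx (lop M g) - lin_mulmxr (lop N g).

Definition homker (F : finFieldType) (M N : lmod G F) :=
  (\bigcap_g kermx (homsys M N g))%MS.

Lemma homkerE (F : finFieldType) (M N : lmod G F) (f : 'M_(ldim M, ldim N)) :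
  (mxvec f <= homker M N)%MS = lhom f.
Proof.
have e g : (mxvec f <= kermx (homsys M N g))%MS = (lop M g *m f == f *m lop N g).
  by rewrite sub_kermx mulmxBr !mul_vec_lin /= -linearB mxvec_eq0 subr_eq0.
apply/idP/lhomP => [/sub_bigcapmxP H g | H].
  by apply/eqP; rewrite -e H.
by apply/sub_bigcapmxP => g _; rewrite e H.
Qed.

Lemma card_submx (F : finFieldType) m n (A : 'M[F]_(m, n)) :
  #|[set u : 'rV_n | (u <= A)%MS]| = (#|F| ^ \rank A)%N.
Proof.
have inj := row_free_inj (row_base_free A) : injective (fun u : 'rV_ _ => u *m row_base A).
rewrite -[X in (_ ^ X)%N]mul1n -card_mx -cardsT -(card_imset _ inj).
apply: eq_card => u; rewrite inE -(eq_row_base A).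
by apply/submxP/imsetP => [[D ->]|[D _ ->]]; exists D.
Qed.

Definition dhom (F : finFieldType) (M N : lmod G F) := \rank (homker M N).

Lemma nhomE (F : finFieldType) (M N : lmod G F) :
  nhom M N = (#|F| ^ dhom M N)%N.
Proof.
rewrite -card_submx /nhom -(card_imset _ (can_inj (@mxvecK _ _ _))).
apply: eq_card => u; apply/imsetP/idP => [[f]|].
  by rewrite !inE -homkerE => h ->.
by rewrite inE -{1}(vec_mxK u) homkerE => h; exists (vec_mx u); rewrite ?inE ?vec_mxK.
Qed.

Section Extension.
Variables (K E : finFieldType) (iota : {rmorphism K -> E}).

Definition lext (M : lmod G K) : lmod G E :=
  Lmod (ldim M) (fun g => map_mx iota (lop M g)).

(** The linear system has coefficients in [K], and ranks of kernels and intersections survive a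
    field extension. *)
Lemma dhom_ext (M N : lmod G K) : dhom (lext M) (lext N) = dhom M N.
Proof.
rewrite /dhom -(mxrank_map iota (homker M N)).
suff h : (map_mx iota (homker M N) :=: homker (lext M) (lext N))%MS by rewrite h.
apply: (big_ind2 (fun A B => map_mx iota A :=: B)%MS) => [|A A' B B' eA eB|g _].
- by rewrite map_mx1.
- by apply: eqmx_trans (map_capmx _ _ _) _; apply: cap_eqmx.
rewrite map_kermx (_ : map_mx _ _ = homsys (lext M) (lext N) g) //.
rewrite /homsys map_mxB; congr (_ - _); apply: map_lin_mx => A /=.
  by rewrite map_mxM.
by rewrite map_mxM.
Qed.

Lemma nhom_ext (M N : lmod G K) : nhom (lext M) (lext N) = (#|E| ^ dhom M N)%N.
Proof. by rewrite nhomE dhom_ext. Qed.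

Lemma lhom_map (M N : lmod G K) (f : 'M_(ldim M, ldim N)) :
  lhom (M := lext M) (N := lext N) (map_mx iota f) = lhom f.
Proof.
apply/forallP/forallP => H g; move: (H g); rewrite /= -!map_mxM.
  by move=> /eqP /map_mx_inj ->.
by move/eqP->.
Qed.

Lemma liso_ext (M N : lmod G K) : liso M N -> liso (lext M) (lext N).
Proof.
case/lisoP => f [f' [hf hf' e e']].
apply/lisoP; exists (map_mx iota f), (map_mx iota f').
by split; rewrite ?lhom_map //= -map_mxM ?e ?e' map_mx1.
Qed.

Lemma lext_dsuml (M N : lmod G K) :
  liso (lext (dsuml M N)) (dsuml (lext M) (lext N)).
Proof.
apply/lisoP; exists 1%:M, 1%:M; rewrite mulmx1.
suff h : lhom (M := lext (dsuml M N)) (N := dsuml (lext M) (lext N)) 1%:M.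
  by split=> //; apply/lhomP => g; rewrite mul1mx mulmx1; have /lhomP/(_ g) := h;
     rewrite mul1mx mulmx1.
by apply/lhomP => g; rewrite /= mul1mx mulmx1 map_block_mx !raddf0.
Qed.

End Extension.

(* Lovasz: the numbers [nhom Z M] for all [Z] determine the numbers of
   injections, hence the isomorphism class of [M]. *)
Lemma liso_nhom (F : finFieldType) (M N : lmod G F) :
  (forall Z, nhom Z M = nhom Z N) -> liso M N.
Proof.
move=> h.
have hi Z : ninj Z M = ninj Z N.
  have [k] := ubnP (ldim Z); elim: k Z => // k IH Z lek.
  have := h Z; rewrite !nhom_ker.
  have s0 : submod (M := Z) 0.
    by rewrite /submod genmx0 eqxx; apply/forallP => g; rewrite mul0mx sub0mx.
  have i0 : liso (quol (M := Z) 0) Z.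
    apply: (@liso_quol _ _ _ _ _ 1%:M) => //; first exact: lhom1.
      by rewrite row_full_unit unitmx1.
    by apply: eqmx_sub => m x; rewrite sub_kermx mulmx1 submx0.
  (* The kernel [0] contributes the injections of [Z] itself; the other kernels give proper
     quotients, settled by induction. *)
  rewrite (bigD1 _ s0) [RHS](bigD1 _ s0) /= !(ninj_iso i0 (liso_refl _)).
  rewrite (eq_bigr (fun W => ninj (quol W) N)) => [/addIn //|W /andP[sW W0]].
  apply: IH; rewrite /= mxrank_coker -ltnS; apply: leq_trans lek.
  have r0 : (0 < \rank W)%N by rewrite lt0n mxrank_eq0.
  by rewrite ltnS ltn_subrL r0 (leq_trans r0 (rank_leq_row W)).
have p : (0 < ninj M N)%N by rewrite -hi naut_gt0.
have p' : (0 < ninj N M)%N by rewrite hi naut_gt0.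
have d : ldim M = ldim N.
  have r (A B : lmod G F) : (0 < ninj A B)%N -> (ldim A <= ldim B)%N.
    by case/card_gt0P => f; rewrite inE => /andP[_ /eqP <-]; apply: rank_leq_col.
  by apply/eqP; rewrite eqn_leq !r.
by rewrite liso_ninj_gt0.
Qed.

(** Noether-Deuring: an isomorphism over [E] gives equal powers of [#|E|], hence equal [dhom Z M]
    and [dhom Z N] for all [Z] over [K], and hom counts over [K] determine the module. *)
Lemma liso_descent (K E : finFieldType) (iota : {rmorphism K -> E}) (M N : lmod G K) :
  liso (lext iota M) (lext iota N) = liso M N.
Proof.
apply/idP/idP; last exact: liso_ext.
move=> i; apply: liso_nhom => Z.
have := nhom_iso (liso_refl (lext iota Z)) i; rewrite !nhom_ext !nhomE.
by move/eqP; rewrite eqn_exp2l ?finNzRing_gt1 // => /eqP ->.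
Qed.

End HomCount.

(** * Rational functions of the cardinality of a field *)

Lemma int_poly_bound (p : {poly int}) s : (size p <= s.+1)%N ->
  exists c : nat, forall q : nat, (0 < q)%N -> `|p.[q%:R]| <= c%:R * q%:R ^+ s.
Proof.
move=> sp; exists (\sum_(i < size p) absz (p`_i)%R)%N => q q0.
rewrite horner_coef (le_trans (ler_norm_sum _ _ _)) // natr_sum mulr_suml.
apply: ler_sum => i _; rewrite normrM [X in _ <= X * _]natz abszE ler_wpM2l ?normr_ge0 //.
rewrite ger0_norm ?exprn_ge0 ?ler0n // ler_weXn2l ?ler1n //.
by rewrite -ltnS (leq_trans (ltn_ord i)).
Qed.

(** Integrality enters through the leading coefficient of [A], whose absolute value is at least
    one. *)
Lemma int_poly_dom (A B : {poly int}) : (size B < size A)%N ->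
  exists N : nat, forall q : nat, (N <= q)%N -> `|B.[q%:R]| < `|A.[q%:R]|.
Proof.
move=> sBA; have A0 : A != 0 by rewrite -size_poly_gt0 (leq_trans _ sBA).
have lA : lead_coef A != 0 by rewrite lead_coef_eq0.
case eA: (size A) => [|[|s]]; first by rewrite eA in sBA.
  exists 0%N => q _; move: sBA; rewrite eA ltnS leqn0 size_poly_eq0 => /eqP ->.
  rewrite horner0 normr0 normr_gt0.
  have := size1_polyC (eq_leq eA) => e.
  by rewrite e hornerC; move: lA; rewrite lead_coefE eA.
have [c hc] := @int_poly_bound B s (leq_trans sBA (eq_leq eA)).
pose A' := A - lead_coef A *: 'X^(s.+1).
have sA' : (size A' <= s.+1)%N.
  apply/leq_sizeP => j; rewrite leq_eqVlt => /predU1P[<-|lj].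
    by rewrite !coefE lead_coefE eA eqxx mulr1 subrr.
  by rewrite !coefE nth_default ?eA // gtn_eqF // mulr0 subr0.
have [c' hc'] := @int_poly_bound A' s sA'.
(* [A] is at least [q ^ s.+1 - c' * q ^ s] in absolute value and [B] at most [c * q ^ s]. *)
exists (c + c').+1 => q hq; have q0 : (0 < q)%N by apply: leq_ltn_trans hq.
have -> : A.[q%:R] = A'.[q%:R] + lead_coef A * q%:R ^+ s.+1.
  by rewrite /A' hornerD hornerN hornerZ hornerXn subrK.
have := hc q q0; have := hc' q q0.
set x := A'.[_]; set y := B.[_]; rewrite exprSr.
set Q := _ ^+ s; have Q0 : 0 < Q by rewrite exprn_gt0 // ltr0n.
move=> hx hy; apply: le_lt_trans hy _.
have h1 : `|lead_coef A * (Q * q%:R)| <= `|x + lead_coef A * (Q * q%:R)| + `|x|.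
  by rewrite -[X in `|X| <= _](addKr x) addrC -[X in _ <= _ + X]normrN; apply: ler_normD.
have h2 : Q * q%:R <= `|lead_coef A * (Q * q%:R)|.
  rewrite normrM [`|Q * _|]ger0_norm ?mulr_ge0 ?ler0n ?(ltW Q0) //.
  rewrite ler_peMl ?mulr_ge0 ?ler0n ?(ltW Q0) //.
  by rewrite -gtz0_ge1 normr_gt0.
have h3 : (c%:R + c'%:R) * Q < Q * q%:R.
  by rewrite mulrC ltr_pM2l // -natrD ltr_nat.
move: h3; rewrite mulrDl => h3.
rewrite -(ltrD2r (c'%:R * Q)); apply: lt_le_trans h3 _; apply: (le_trans h2).
by apply: (le_trans h1); rewrite lerD2l.
Qed.

Record extn (K : finFieldType) := Extn {
  efield : finFieldType;
  emap : {rmorphism K -> efield} }.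

(** The splitting field of ['X^N - 'X] with [N] a power of the characteristic contains its [N]
    roots, distinct because the derivative is -1. Large fields are what the asymptotic arguments
    test on. *)
Lemma extn_large (K : finFieldType) m : exists x : extn K, (m <= #|efield x|)%N.
Proof.
have [p pr_p charp] := finPcharP K.
pose N := (p ^ m.+1)%N.
have lN : (m < N)%N by rewrite (leq_trans (ltn_expl m (prime_gt1 pr_p))) // leq_exp2l ?prime_gt1.
have N1 : (1 < N)%N by rewrite -{1}(expn0 p) ltn_exp2l ?prime_gt1.
pose P : {poly K} := 'X^N - 'X.
have sP : size P = N.+1.
  by rewrite size_polyDl ?size_polyXn // size_polyN size_polyX ltnS.
have P0 : P != 0 by rewrite -size_poly_gt0 sP.
have [L [rs eP _]] := FinSplittingFieldFor P0.
exists (Extn (in_alg (FinFieldExtType L) : {rmorphism K -> FinFieldExtType L})).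
have eL : map_poly (in_alg L) P = 'X^N - 'X.
  by rewrite rmorphB rmorphXn /= map_polyX.
have sep : separable_poly (map_poly (in_alg L) P).
  rewrite eL separable_poly.unlock derivB derivXn derivX.
  have -> : 'X^(N.-1) *+ N = 0 :> {poly L}.
    rewrite -mulr_natr -polyC_natr natrX.
    have -> : p%:R = 0 :> L by apply: pcharf0; rewrite pchar_lalg.
    by rewrite expr0n /= polyC0 mulr0.
  by rewrite sub0r -(scaleN1r 1) coprimepZr ?oppr_eq0 ?oner_eq0 // coprimep1.
have urs : uniq rs.
  by rewrite -separable_prod_XsubC -(eqp_separable eP).
have srs : size rs = N.
  by have := eqp_size eP; rewrite size_prod_XsubC size_map_poly sP => -[->].
apply: (@leq_trans N); first exact: ltnW.
rewrite -srs cardE; apply: (@uniq_leq_size (FinFieldExtType L)) => // z _.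
exact: mem_enum.
Qed.

Section RationalFunctions.
Variable K : finFieldType.
Implicit Types (f g : extn K -> rat) (P D : {poly int}) (x : extn K).

Definition qcard x : nat := #|efield x|.
Definition pev P x : rat := (P.[(qcard x)%:R])%:~R.

(* [f] is a rational function of the cardinality with monic denominator; in
   [runit] the numerator is monic as well. *)
Definition ratl f := exists P D,
  [/\ D \is monic, forall x, pev D x != 0 & forall x, f x * pev D x = pev P x].
Definition runit f := exists P D,
  [/\ P \is monic, D \is monic, forall x, pev P x != 0, forall x, pev D x != 0
    & forall x, f x * pev D x = pev P x].

Lemma pevM P D x : pev (P * D) x = pev P x * pev D x.
Proof. by rewrite /pev hornerM rmorphM. Qed.
Lemma pevD P D x : pev (P + D) x = pev P x + pev D x.
Proof. by rewrite /pev hornerD rmorphD. Qed.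
Lemma pevN P x : pev (- P) x = - pev P x.
Proof. by rewrite /pev hornerN rmorphN. Qed.
Lemma pev1 x : pev 1 x = 1.
Proof. by rewrite /pev hornerC. Qed.

Lemma qcard_gt0 x : (0 < qcard x)%N.
Proof. exact: ltnW (finNzRing_gt1 _). Qed.

Lemma qcard_neq0 x k : (qcard x ^ k)%:R != 0 :> rat.
Proof. by rewrite pnatr_eq0 -lt0n expn_gt0 qcard_gt0. Qed.

Lemma ratl_ext f g : f =1 g -> ratl f -> ratl g.
Proof. by move=> e [P [D [mD nD h]]]; exists P, D; split=> // x; rewrite -e. Qed.

Lemma ratl_poly P : ratl (pev P).
Proof.
by exists P, 1; split=> [|x|x]; rewrite ?monic1 ?pev1 ?oner_eq0 ?mulr1.
Qed.

Lemma ratl_int (c : int) : ratl (fun=> c%:~R).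
Proof. by apply: ratl_ext (ratl_poly c%:P) => x; rewrite /pev hornerC. Qed.

Lemma ratl_nat (c : nat) : ratl (fun=> c%:R).
Proof. exact: ratl_ext (ratl_int c). Qed.

Lemma ratl_add f g : ratl f -> ratl g -> ratl (fun x => f x + g x).
Proof.
move=> [P [D [mD nD h]]] [P' [D' [mD' nD' h']]].
exists (P * D' + P' * D), (D * D'); split=> [|x|x].
- exact: rpredM.
- by rewrite pevM mulf_neq0.
by rewrite pevD !pevM -h -h'; ring.
Qed.

Lemma ratl_mul f g : ratl f -> ratl g -> ratl (fun x => f x * g x).
Proof.
move=> [P [D [mD nD h]]] [P' [D' [mD' nD' h']]].
exists (P * P'), (D * D'); split=> [|x|x].
- exact: rpredM.
- by rewrite pevM mulf_neq0.
by rewrite !pevM -h -h'; ring.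
Qed.

Lemma ratl_opp f : ratl f -> ratl (fun x => - f x).
Proof.
move=> [P [D [mD nD h]]]; exists (- P), D; split=> // x.
by rewrite pevN -h mulNr.
Qed.

Lemma ratl_sub f g : ratl f -> ratl g -> ratl (fun x => f x - g x).
Proof. by move=> hf hg; apply: ratl_add hf (ratl_opp hg). Qed.

Lemma ratl_sum (I : Type) (r : seq I) (Q : pred I) (f : I -> extn K -> rat) :
  (forall i, Q i -> ratl (f i)) -> ratl (fun x => \sum_(i <- r | Q i) f i x).
Proof.
move=> h; elim: r => [|i r IH].
  by apply: ratl_ext (ratl_nat 0) => x; rewrite big_nil.
have [Qi|nQi] := boolP (Q i).
  by apply: ratl_ext (ratl_add (h i Qi) IH) => x; rewrite big_cons Qi.
by apply: ratl_ext IH => x; rewrite big_cons (negPf nQi).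
Qed.

Lemma ratl_div f g : runit f -> ratl (fun x => f x * g x) -> ratl g.
Proof.
move=> [P [D [mP mD nP nD h]]] [R [S [mS nS h']]].
exists (R * D), (S * P); split=> [|x|x].
- exact: rpredM.
- by rewrite pevM mulf_neq0.
by rewrite !pevM -h -h'; ring.
Qed.

Lemma runit_ratl f : runit f -> ratl f.
Proof. by move=> [P [D [_ ? _ ? ?]]]; exists P, D. Qed.

Lemma runit_mul f g : runit f -> runit g -> runit (fun x => f x * g x).
Proof.
move=> [P [D [mP mD nP nD h]]] [P' [D' [mP' mD' nP' nD' h']]].
exists (P * P'), (D * D'); split=> [||x|x|x]; try exact: rpredM.
- by rewrite pevM mulf_neq0.
- by rewrite pevM mulf_neq0.
by rewrite !pevM -h -h'; ring.
Qed.

Lemma runit_quot c f g : runit f -> runit g -> (forall x, c x * f x = g x) -> runit c.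
Proof.
move=> [P [D [mP mD nP nD h]]] [P' [D' [mP' mD' nP' nD' h']]] e.
exists (P' * D), (D' * P); split=> [||x|x|x]; try exact: rpredM.
- by rewrite pevM mulf_neq0.
- by rewrite pevM mulf_neq0.
by rewrite !pevM -h -h' -e; ring.
Qed.

Lemma pevXn k x : pev 'X^k x = (qcard x ^ k)%:R.
Proof. by rewrite /pev hornerXn natrX rmorphXn /= rmorph_nat. Qed.

Lemma runit_qcard k : runit (fun x => (qcard x ^ k)%:R).
Proof.
exists 'X^k, 1; split=> [||x|x|x]; rewrite ?monicXn ?monic1 ?pevXn ?pev1 ?mulr1 //.
by rewrite qcard_neq0.
Qed.

Lemma ratl_qcard k : ratl (fun x => (qcard x ^ k)%:R).
Proof. exact: runit_ratl (runit_qcard k). Qed.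

(** If [f] is [q ^ h] up to a relative error of order 1/q, numerator and ['X^h * D] share their
    leading term, so the numerator is monic. *)
Lemma runit_asymptotic f (h m : nat) :
  ratl f -> (forall x, f x != 0) ->
  (forall x, (qcard x)%:R * `|f x - (qcard x ^ h)%:R| <= (m * qcard x ^ h)%:R) ->
  runit f.
Proof.
move=> [P [D [mD nD e]]] f0 bd; exists P, D; split=> // [|x]; last first.
  by rewrite -e mulf_neq0.
pose R := P - 'X^h * D.
have sXD : size ('X^h * D) = (h + size D)%N.
  by rewrite mulrC size_mulXn ?monic_neq0.
have sR : (size R < h + size D)%N.
  rewrite ltnNge; apply/negP => sR.
  have D0 : D != 0 by apply: monic_neq0.
  have R0 : R != 0 by rewrite -size_poly_gt0 (leq_trans _ sR) // addn_gt0 size_poly_gt0 D0 orbT.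
  (* Otherwise ['X * R] outgrows the multiple of ['X^h * D] that bounds it by hypothesis. *)
  have dom : (size (m%:R *: ('X^h * D))%R < size ('X * R)%R)%N.
    rewrite ['X * R]mulrC size_mulX // ltnS; apply: leq_trans sR.
    by rewrite -sXD; apply: size_scale_leq.
  have [N hN] := int_poly_dom dom; have [x lx] := extn_large K N.
  have := hN _ lx; apply/negP; rewrite -leNgt.
  rewrite -(ler_int rat) !intr_norm -!/(pev _ x) -mul_polyC !pevM.
  have -> : pev 'X x = (qcard x)%:R by rewrite /pev hornerX rmorph_nat.
  have -> : pev m%:R%:P x = m%:R by rewrite /pev hornerC rmorph_nat.
  rewrite pevD pevN pevM pevXn -e -mulrBl !normrM [`|(qcard x)%:R|]ger0_norm //.
  rewrite mulrA [X in _ <= X]mulrA; apply: ler_wpM2r; first exact: normr_ge0.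
  by apply: le_trans (bd x) _; rewrite natrM !ger0_norm.
have -> : P = R + 'X^h * D by rewrite subrK.
by rewrite monicE lead_coefDr ?sXD // mulrC lead_coefM lead_coefXn mulr1.
Qed.

(** The monic denominator allows division over the integers. The remainder over [D] is an integer at
    every field and has absolute value below one at large fields, so it vanishes there. *)
Lemma ratl_int_poly f : ratl f -> (forall x, f x \is a Num.int) ->
  exists P, forall x, f x = pev P x.
Proof.
move=> [P [D [mD nD e]]] fi.
pose A := Pdiv.Ring.rdivp P D; pose R := Pdiv.Ring.rmodp P D.
have eP : P = A * D + R := Pdiv.RingMonic.rdivp_eq mD P.
have sR : (size R < size D)%N by rewrite Pdiv.Ring.ltn_rmodp monic_neq0.
exists A => x; suff R0 : R = 0.
  by apply: (mulIf (nD x)); rewrite e eP R0 addr0 pevM.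
apply/eqP; apply: contraT => R0.
have [N hN] := int_poly_dom sR.
(* Beyond [N'] the nonzero polynomial [R] has no roots. *)
have [N' hN'] : exists N : nat, forall q : nat, (N <= q)%N -> `|0.[q%:R]| < `|R.[q%:R]|.
  by apply: int_poly_dom; rewrite size_poly0 size_poly_gt0.
have [y ly] := extn_large K (maxn N N').
have eR : (f y - pev A y) * pev D y = pev R y.
  by rewrite mulrBl e eP pevD pevM; ring.
have /hN lt1 : (N <= qcard y)%N by apply: leq_trans ly; rewrite leq_maxl.
have /hN' lt2 : (N' <= qcard y)%N by apply: leq_trans ly; rewrite leq_maxr.
have /intrP[z ez] : f y - pev A y \is a Num.int.
  by rewrite rpredB // /pev intr_int.
move: eR; rewrite ez => eR.
have {}eR : z * D.[(qcard y)%:R] = R.[(qcard y)%:R].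
  by apply: (@intr_inj rat); rewrite rmorphM /= eR.
move: lt1 lt2; rewrite horner0 normr0 -eR normrM => lt1 lt2.
have z0 : z != 0 by apply: contraTneq lt2 => ->; rewrite normr0 mul0r ltxx.
have d0 : 0 < `|D.[(qcard y)%:R]|.
  by rewrite normr_gt0; apply: contraTneq lt2 => ->; rewrite normr0 mulr0 ltxx.
by move: lt1; rewrite gtr_pMl // ltNge -gtz0_ge1 normr_gt0 z0.
Qed.

End RationalFunctions.

(** * Modules over the bound quiver *)

Section Relations.
Variable G : finType.
(* A relation [(p, q)] states that the sum of the words in [p] equals the sum
   of the words in [q]. *)
Variable rels : seq (seq (seq G) * seq (seq G)).

Section OneField.
Variable F : finFieldType.
Implicit Types (M N X Y Z A B C : lmod G F).

Definition wact M (w : seq G) : 'M[F]_(ldim M) :=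
  foldr (fun g (a : 'M_(ldim M)) => lop M g *m a) 1%:M w.

Definition sact M (p : seq (seq G)) : 'M[F]_(ldim M) := \sum_(w <- p) wact M w.

Definition sat M : bool := all (fun r => sact M r.1 == sact M r.2) rels.

(** Words commute with homomorphisms; this is why relations pass to submodules and quotients. *)
Lemma sact_hom M N (f : 'M_(ldim M, ldim N)) p :
  lhom f -> sact M p *m f = f *m sact N p.
Proof.
move=> /lhomP hf; rewrite mulmx_suml mulmx_sumr; apply: eq_bigr => w _.
elim: w => [|g w IH] /=; first by rewrite mulmx1 mul1mx.
by rewrite -mulmxA IH !mulmxA hf.
Qed.

Lemma sat_free M N (f : 'M_(ldim M, ldim N)) :
  lhom f -> row_free f -> sat N -> sat M.
Proof.
move=> hf fr /allP sN; apply/allP => r /sN /eqP e.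
by apply/eqP; apply: (row_free_inj fr); rewrite !(sact_hom _ hf) e.
Qed.

Lemma sat_full M N (f : 'M_(ldim M, ldim N)) :
  lhom f -> row_full f -> sat M -> sat N.
Proof.
move=> hf fu /allP sM; apply/allP => r /sM /eqP e.
by apply/eqP; apply: (row_full_inj fu); rewrite -!(sact_hom _ hf) e.
Qed.

Lemma sat_subl M (U : 'M_(ldim M)) : submod U -> sat M -> sat (subl U).
Proof. by move=> sU; apply: sat_free (incl_hom sU) (row_base_free U). Qed.

Lemma sat_quol M (U : 'M_(ldim M)) : submod U -> sat M -> sat (quol U).
Proof. by move=> sU; apply: sat_full (proj_hom sU) (proj_full U). Qed.

Lemma sat_iso M N : liso M N -> sat M = sat N.
Proof.
move=> /lisoP[f [f' [hf hf' e e']]]; apply/idP/idP.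
  by apply: sat_full hf (row_full_inv e').
by apply: sat_free hf (row_free_inv e).
Qed.

Lemma sact_dsuml M N p :
  sact (dsuml M N) p = block_mx (sact M p) 0 0 (sact N p).
Proof.
rewrite /sact; elim: p => [|w p IH].
  by rewrite !big_nil /= block_mx0.
rewrite !big_cons IH.
have -> : wact (dsuml M N) w = block_mx (wact M w) 0 0 (wact N w).
  elim: w => [|g w IHw] /=; first by rewrite -scalar_mx_block.
  by rewrite IHw mulmx_block !mulmx0 !mul0mx !addr0 !add0r.
by rewrite add_block_mx !addr0.
Qed.

Lemma sat_dsuml M N : sat (dsuml M N) = sat M && sat N.
Proof.
rewrite -all_predI; apply: eq_all => r /=; rewrite !sact_dsuml.
by apply/eqP/andP => [/eq_block_mx[-> _ _ ->]|[/eqP-> /eqP->]].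
Qed.

End OneField.

Lemma sat_ext (K E : finFieldType) (iota : {rmorphism K -> E}) (M : lmod G K) :
  sat (lext iota M) = sat M.
Proof.
apply: eq_all => r.
have h p : sact (lext iota M) p = map_mx iota (sact M p).
  rewrite /sact (raddf_sum (map_mx iota)); apply: eq_bigr => w _.
  by elim: w => [|g w IH] /=; rewrite ?map_mx1 // map_mxM IH.
by rewrite !h; apply/eqP/eqP => [/map_mx_inj|->].
Qed.

End Relations.

(** * A presentation of the algebra, its paths, and string modules *)

Section LoopModules.
Variable N : nat.

(** [inl i] is the idempotent of the vertex [i], [inr c] an arrow and [inr None] the loop. There are
    [N.+1] vertices, so [N] is both n-1 and the number of the last vertex. *)
Definition lgen : finType := ('I_N.+1 + option 'I_N)%type.
Definition lsrc (c : option 'I_N) : 'I_N.+1 :=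
  if c is Some i then widen_ord (leqnSn N) i else ord_max.
Definition ltgt (c : option 'I_N) : 'I_N.+1 :=
  if c is Some i then lift ord0 i else ord_max.

(** A presentation of the bound quiver algebra: orthogonal idempotents, their sum, source and target
    of each arrow, and the loop squared. *)
Definition lrels : seq (seq (seq lgen) * seq (seq lgen)) :=
  [seq ([:: [:: inl i; inl j]], if i == j then [:: [:: inl i]] else [::])
     | i <- enum 'I_N.+1, j <- enum 'I_N.+1]
  ++ ([seq [:: inl i] | i <- enum 'I_N.+1], [:: [::]])
  :: [seq ([:: [:: inl (lsrc c); inr c]], [:: [:: inr c]]) | c <- enum {: option 'I_N}]
  ++ [seq ([:: [:: inr c; inl (ltgt c)]], [:: [:: inr c]]) | c <- enum {: option 'I_N}]
  ++ [:: ([:: [:: inr None; inr None]], [::])].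

Definition lsat (F : finFieldType) (M : lmod lgen F) := sat lrels M.

Lemma lsatP (F : finFieldType) (M : lmod lgen F) :
  reflect [/\ forall i j, lop M (inl i) *m lop M (inl j) = if i == j then lop M (inl i) else 0,
     \sum_i lop M (inl i) = 1%:M,
     forall c, lop M (inl (lsrc c)) *m lop M (inr c) = lop M (inr c),
     forall c, lop M (inr c) *m lop M (inl (ltgt c)) = lop M (inr c)
   & lop M (inr None) *m lop M (inr None) = 0] (lsat M).
Proof.
have me (c : option 'I_N) : c \in Finite.enum (option 'I_N) by rewrite -enumT mem_enum.
have s0 : sact M [::] = 0 by rewrite /sact big_nil.
have s1 w : sact M [:: w] = wact M w by rewrite /sact big_seq1.
have sN : sact M [:: [::]] = 1%:M by rewrite s1.
have sE : sact M [seq [:: inl i] | i <- enum 'I_N.+1] = \sum_i lop M (inl i).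
  by rewrite /sact big_map big_enum; apply: eq_bigr => i _; rewrite /= mulmx1.
rewrite /lsat /sat /lrels all_cat /= all_cat all_cat !all_map /=.
rewrite sE sN s0 !s1 /= andbT mulmx1.
apply: (iffP and5P) => [[/all_allpairsP h1 /eqP h2 /allP h3 /allP h4 /eqP h5]|[h1 h2 h3 h4 h5]].
  split=> // [i j|c|c].
  - have := h1 i j (mem_enum _ i) (mem_enum _ j).
    by rewrite s1 /= mulmx1; case: (i == j) => /eqP ->; rewrite ?s0 ?s1 //= mulmx1.
  - by have := h3 c (me c); rewrite /= !s1 /= !mulmx1 => /eqP.
  - by have := h4 c (me c); rewrite /= !s1 /= !mulmx1 => /eqP.
split; rewrite ?h2 ?h5 //.
- apply/all_allpairsP => i j _ _; rewrite s1 /= mulmx1 h1.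
  by case: (i == j); rewrite ?s0 ?s1 //= mulmx1.
- by apply/allP => c _; rewrite /= !s1 /= !mulmx1 h3.
- by apply/allP => c _; rewrite /= !s1 /= !mulmx1 h4.
Qed.

Section Facts.
Variables (F : finFieldType) (X : lmod lgen F).

(** Vertices become natural numbers with value zero out of range, so that a path leaving the quiver
    is zero without side conditions. *)
Definition en (k : nat) : 'M[F]_(ldim X) :=
  if insub k is Some i then lop X (inl i) else 0.
(** With all straight arrows added up, [en X k *m pw X m] is the path of length [m] from [k]. *)
Definition at_ : 'M[F]_(ldim X) := \sum_k lop X (inr (Some k)).
Definition al : 'M[F]_(ldim X) := lop X (inr None).
Definition pw m : 'M[F]_(ldim X) := iter m (mulmx at_) 1%:M.

Lemma enE (i : 'I_N.+1) : en i = lop X (inl i).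
Proof. by rewrite /en valK. Qed.

Lemma en_out k : (N < k)%N -> en k = 0.
Proof. by move=> h; rewrite /en insubF // ltnS leqNgt h. Qed.

Lemma pwS m : pw m.+1 = at_ *m pw m. Proof. by []. Qed.

Lemma pwD m k : pw (m + k) = pw m *m pw k.
Proof. by elim: m => [|m IH]; [rewrite mul1mx | rewrite addSn !pwS IH mulmxA]. Qed.

Lemma pwSr m : pw m.+1 = pw m *m at_.
Proof. by rewrite -addn1 pwD /pw /= mulmx1. Qed.

Hypothesis satX : lsat X.

Lemma en_mul k l : en k *m en l = if k == l then en k else 0.
Proof.
rewrite {1 2}/en; case: insubP => [i _ <-|]; last first.
  by rewrite mul0mx -ltnNge ltnS => /en_out->; case: ifP.
case: insubP => [j _ <-|]; last first.
  rewrite mulmx0 -leqNgt => h; rewrite (ltn_eqF (leq_trans (ltn_ord i) h)) //.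
by have /lsatP[-> _ _ _ _] := satX; rewrite -enE (inj_eq val_inj).
Qed.

Lemma en_id k : en k *m en k = en k. Proof. by rewrite en_mul eqxx. Qed.

Lemma sum_en : \sum_(k < N.+1) en k = 1%:M.
Proof. by have /lsatP[_ <- _ _ _] := satX; apply: eq_bigr => i _; rewrite enE. Qed.

Lemma arrE (k : 'I_N) : lop X (inr (Some k)) = en k *m at_.
Proof.
have /lsatP[_ _ h _ _] := satX.
rewrite mulmx_sumr (bigD1 k) //= big1 ?addr0 => [|j jk].
  by rewrite -[in LHS]h -enE /=.
by rewrite -h -enE /= mulmxA en_mul eq_sym (inj_eq val_inj) (negPf jk) mul0mx.
Qed.

Lemma en_at k : en k *m at_ = at_ *m en k.+1.
Proof.
have /lsatP[_ _ hs ht _] := satX.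
have e (j : 'I_N) : lop X (inr (Some j)) = lop X (inr (Some j)) *m en j.+1.
  by rewrite -{1}ht -enE lift0.
case: (ltnP k N) => hk.
  rewrite -[k]/(val (Ordinal hk)) -arrE mulmx_suml (bigD1 (Ordinal hk)) //= big1.
    by rewrite addr0 -e.
  move=> j jk; rewrite e -mulmxA en_mul eqSS.
  by rewrite (_ : (_ == _) = false) ?mulmx0 //; apply: negbTE.
rewrite [en k.+1]en_out ?ltnS // mulmx0 mulmx_sumr big1 // => j _.
rewrite -hs -enE mulmxA en_mul /= gtn_eqF ?mul0mx //.
exact: leq_trans (ltn_ord j) hk.
Qed.

Lemma en_pw k m : en k *m pw m = pw m *m en (k + m).
Proof.
elim: m k => [|m IH] k; first by rewrite addn0 mulmx1 mul1mx.
by rewrite pwS mulmxA en_at -mulmxA IH mulmxA addSnnS.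
Qed.

Lemma en_pw_out k m : (N < k + m)%N -> en k *m pw m = 0.
Proof. by move=> h; rewrite en_pw en_out // mulmx0. Qed.

Lemma en_al : en N *m al = al.
Proof. by have /lsatP[_ _ h _ _] := satX; rewrite -[RHS](h None) -enE. Qed.

Lemma al_en : al *m en N = al.
Proof. by have /lsatP[_ _ _ h _] := satX; rewrite -[RHS](h None) -enE. Qed.

Lemma al_al : al *m al = 0.
Proof. by have /lsatP[]:= satX. Qed.

Lemma al_en_neq k : k != N -> al *m en k = 0.
Proof. by move=> h; rewrite -al_en -mulmxA en_mul eq_sym (negPf h) mulmx0. Qed.

Lemma vec_pw_en p (w : 'M_(p, ldim X)) k m j : w *m en k = w ->
  w *m pw m *m en j = if j == (k + m)%N then w *m pw m else 0.
Proof.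
move=> e; rewrite -e -!mulmxA (mulmxA (en k)) en_pw -mulmxA en_mul.
by rewrite eq_sym; case: eqP; rewrite ?mulmx0.
Qed.

Lemma vec_pw_arr p (w : 'M_(p, ldim X)) k m (j : 'I_N) : w *m en k = w ->
  w *m pw m *m lop X (inr (Some j)) = if val j == (k + m)%N then w *m pw m.+1 else 0.
Proof.
move=> e; rewrite arrE mulmxA (vec_pw_en _ _ e).
by case: eqP; rewrite ?mul0mx // pwSr mulmxA.
Qed.

End Facts.

(* [(b, l)] is a basis vector at the vertex [l]; the arrows preserve [b], and the
   loop sends [(true, ord_max)] to [(false, ord_max)]. *)
Definition bas := (bool * 'I_N.+1)%type.

Definition step (g : lgen) (s : bas) : option bas :=
  match g with
  | inl i => if s.2 == i then Some s else None
  | inr (Some k) => if s.2 == lsrc (Some k) then Some (s.1, ltgt (Some k)) else None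
  | inr None => if s == (true, ord_max) then Some (false, ord_max) else None
  end.

(** The partial inverse of [step], describing the action on the dual basis; it is needed for maps
    into string modules. *)
Definition pre (g : lgen) (s : bas) : option bas :=
  match g with
  | inl i => if s.2 == i then Some s else None
  | inr (Some k) => if s.2 == ltgt (Some k) then Some (s.1, lsrc (Some k)) else None
  | inr None => if s == (false, ord_max) then Some (true, ord_max) else None
  end.

Lemma step_pre g s t : (step g s == Some t) = (pre g t == Some s).
Proof.
have E (u v : bas) b : ((if b then Some u else None) == Some v) = b && (u == v).
  by case: b.
case: g => [i|[k|]]; rewrite /= !E.
- by case: (eqVneq s t) => [->|_]; rewrite ?eqxx ?andbF.
- case: s t => [b i] [b' j]; rewrite !xpair_eqE /=.
  rewrite (eq_sym b') (eq_sym j) (eq_sym _ i).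
  by case: (b == b'); case: (i == _); case: (_ == j).
by rewrite andbC (eq_sym s) (eq_sym t).
Qed.

Section Strings.
Variable F : finFieldType.
Implicit Types (X : lmod lgen F) (A : {set bas}).

(** Basis vectors outside [A] are set to zero. The relations hold for an arbitrary set [A]; only
    intervals and pairs of legs matter later. *)
Definition strl A : lmod lgen F :=
  Lmod #|A| (fun g => \matrix_(p, q) (step g (enum_val p) == Some (enum_val q))%:R).

Lemma strl_from X A (b : bas -> 'rV[F]_(ldim X)) :
  (forall s g, s \in A -> b s *m lop X g =
     if step g s is Some t then (if t \in A then b t else 0) else 0) ->
  lhom (M := strl A) (N := X) (\matrix_p b (enum_val p)).
Proof.
move=> h; apply/lhomP => g; apply/row_matrixP => p.
rewrite !row_mul rowK h ?enum_valP // mulmx_sum_row.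
case es: step => [t|]; last first.
  by rewrite big1 // => q _; rewrite !mxE es scale0r.
case: ifP => tA.
  rewrite (bigD1 (enum_rank_in tA t)) //= big1 => [|q qt].
    by rewrite !mxE rowK es enum_rankK_in // eqxx scale1r addr0.
  rewrite !mxE es (_ : (_ == _) = false) ?scale0r //.
  by apply: contraNF qt => /eqP[et]; apply/eqP/enum_val_inj; rewrite enum_rankK_in.
rewrite big1 // => q _; rewrite !mxE es (_ : (_ == _) = false) ?scale0r //.
by apply: contraFF tA => /eqP[->]; apply: enum_valP.
Qed.

(** A map into a string module is a family of coordinate functionals, the columns [c t], which the
    generators permute backwards along [pre]. *)
Lemma strl_to X A (c : bas -> 'cV[F]_(ldim X)) :
  (forall t g, t \in A -> lop X g *m c t =
     if pre g t is Some s then (if s \in A then c s else 0) else 0) ->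
  lhom (M := X) (N := strl A) (\matrix_(i, p) c (enum_val p) i 0).
Proof.
move=> h; apply/lhomP => g.
have ec q : col q (\matrix_(i, p) c (enum_val (A := A) p) i 0) = c (enum_val q).
  by apply/colP => i; rewrite !mxE.
apply/matrixP => i q.
transitivity ((lop X g *m c (enum_val q)) i 0).
  by rewrite -ec !mxE; apply: eq_bigr => j _; rewrite !mxE.
rewrite h ?enum_valP // !mxE.
case es: pre => [s|]; last first.
  by rewrite mxE big1 // => p _; rewrite !mxE step_pre es mulr0.
case: ifP => sA.
  rewrite (bigD1 (enum_rank_in sA s)) //= big1 => [|p ps].
    by rewrite !mxE step_pre es enum_rankK_in // eqxx mulr1 addr0.
  rewrite !mxE step_pre es (_ : (_ == _) = false) ?mulr0 //.
  by apply: contraNF ps => /eqP[et]; apply/eqP/enum_val_inj; rewrite enum_rankK_in.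
rewrite mxE big1 // => p _; rewrite !mxE step_pre es (_ : (_ == _) = false) ?mulr0 //.
by apply: contraFF sA => /eqP[->]; apply: enum_valP.
Qed.

Lemma strl_dual X A (b : bas -> 'rV[F]_(ldim X)) (c : bas -> 'cV[F]_(ldim X)) :
  (forall s t, s \in A -> t \in A -> b s *m c t = (s == t)%:R%:M) ->
  (\matrix_p b (enum_val p)) *m (\matrix_(i, p) c (enum_val p) i 0) =
  1%:M :> 'M_(ldim (strl A)).
Proof.
move=> h; apply/matrixP => p q.
transitivity ((b (enum_val p) *m c (enum_val q)) 0 0).
  by rewrite !mxE; apply: eq_bigr => j _; rewrite !mxE.
by rewrite h ?enum_valP // !mxE (inj_eq enum_val_inj) eqxx mulr1n.
Qed.

End Strings.

Lemma strl_ext (K E : finFieldType) (iota : {rmorphism K -> E}) (A : {set bas}) :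
  liso (lext iota (strl K A)) (strl E A).
Proof.
have e g : lop (lext iota (strl K A)) g = lop (strl E A) g.
  by apply/matrixP => p q; rewrite !mxE rmorph_nat.
apply/lisoP; exists 1%:M, 1%:M; rewrite mulmx1; split=> //; apply/lhomP => g.
  by rewrite mulmx1 mul1mx e.
by rewrite mulmx1 mul1mx -e.
Qed.

Lemma exists_functional (F : fieldType) m p (w : 'rV[F]_m) (B : 'M[F]_(p, m)) :
  ~~ (w <= B)%MS -> exists c : 'cV_m, w *m c = 1%:M /\ B *m c = 0.
Proof.
have H (z : 'rV[F]_m) j : z 0 j != 0 -> (z 0 j)^-1 *: (z *m delta_mx j 0) = 1%:M.
  by move=> nz; rewrite -colE; apply/matrixP => a a'; rewrite !ord1 !mxE mulVf.
rewrite submxE => h.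
have [j nz] : exists j, (w *m cokermx B) 0 j != 0.
  apply/existsP; apply: contraNT h; rewrite negb_exists => /forallP h.
  by apply/eqP/rowP => j; have := h j; rewrite negbK => /eqP ->; rewrite mxE.
exists (((w *m cokermx B) 0 j)^-1 *: (cokermx B *m delta_mx j 0)); split.
  by rewrite -scalemxAr [w *m (_ *m delta_mx _ _)]mulmxA H.
by rewrite -scalemxAr [B *m (_ *m delta_mx _ _)]mulmxA mulmx_coker mul0mx scaler0.
Qed.

End LoopModules.

(** * Every nonzero module has a string summand *)

Section Split.
Variable N : nat.
Local Notation bas := (bas N).
Local Notation lmodN := (lmod (lgen N)).

Lemma strl_sat (F : finFieldType) (A : {set bas}) : lsat (strl F A).
Proof.
(* The basis vector of [o], with value zero for [None] and outside [A]; each relation becomes a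
   computation with [step]. *)
pose dl (o : option bas) : 'rV[F]_#|A| := \row_q (o == Some (enum_val q))%:R.
have dlN : dl None = 0 by apply/rowP => q; rewrite !mxE.
have dl_out t : t \notin A -> dl (Some t) = 0.
  move=> tA; apply/rowP => q; rewrite !mxE (_ : (_ == _) = false) //.
  by apply: contraNF tA => /eqP[->]; apply: enum_valP.
have [L eL] : exists L : lgen N -> 'M[F]_#|A|, forall g, lop (strl F A) g = L g by exists (lop (strl F A)).
have dlM t g : t \in A -> dl (Some t) *m L g = dl (step g t).
  move=> tA; rewrite -eL mulmx_sum_row (bigD1 (enum_rank_in tA t)) //= big1.
    by rewrite !mxE enum_rankK_in // eqxx scale1r addr0; apply/rowP => q; rewrite !mxE enum_rankK_in.
  move=> q qt; rewrite !mxE (_ : (_ == _) = false) ?scale0r //.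
  by apply: contraNF qt => /eqP[et]; apply/eqP/enum_val_inj; rewrite enum_rankK_in.
have rw p g : row p (L g) = dl (step g (enum_val p)).
  by rewrite -eL; apply/rowP => q; rewrite !mxE.
have r1 p : row p 1%:M = dl (Some (enum_val p)).
  by apply/rowP => q; rewrite !mxE (inj_eq (inj_comp Some_inj enum_val_inj)).
apply/lsatP; split=> [i j||c|c|]; try rewrite !eL; try under eq_bigr do rewrite eL.
- apply/row_matrixP => p; rewrite row_mul rw /=.
  case: (eqVneq i j) => [<-|ij].
    rewrite rw /=; case: ifP => [e|_]; last by rewrite dlN mul0mx.
    by rewrite dlM ?enum_valP //= e.
  case: ifP => [/eqP e|_]; last by rewrite dlN mul0mx row0.
  by rewrite dlM ?enum_valP //= e (negPf ij) dlN row0.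
- apply/row_matrixP => p; rewrite r1 linear_sum /=.
  rewrite (bigD1 (enum_val p).2) //= big1 => [|i ip].
    by rewrite rw /= eqxx addr0.
  by rewrite rw /= eq_sym (negPf ip) dlN.
- apply/row_matrixP => p; rewrite row_mul !rw [step (inl _) _]/=.
  case: ifP => [_|ne]; first by rewrite dlM ?enum_valP.
  rewrite dlN mul0mx; case: c ne => [k|] /= ne; first by rewrite ne.
  by case: (eqVneq (enum_val p) _) ne => [->|]; rewrite ?eqxx //= dlN.
- apply/row_matrixP => p; rewrite row_mul !rw.
  case es: (step _ _) => [t|]; last by rewrite dlN mul0mx.
  have [tA|tA] := boolP (t \in A); last by rewrite dl_out // mul0mx.
  rewrite dlM //= (_ : t.2 = ltgt c) ?eqxx //.
  by case: c es => [k|] /=; case: ifP => // _ [<-].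
- apply/row_matrixP => p; rewrite row_mul !rw row0 /=.
  case: ifP => _; last by rewrite dlN mul0mx.
  have [tA|tA] := boolP ((false, ord_max) \in A); last by rewrite dl_out // mul0mx.
  by rewrite dlM //= dlN.
Qed.

(** The uniserial module on the vertices [k] to [i], with zero loop. *)
Definition ivl (k i : nat) : {set bas} := [set s : bas | ~~ s.1 && (k <= s.2 <= i)%N].
(** The string module M(i, j): the [true] leg starts at [i], the [false] leg at [j], and the loop
    sends the end of the first to the end of the second. *)
Definition legs (i j : nat) : {set bas} :=
  [set s : bas | if s.1 then (i <= s.2)%N else (j <= s.2)%N].

Definition indec (A : {set bas}) : Prop :=
  (exists k i, (k <= i <= N)%N /\ A = ivl k i) \/
  (exists i j, [/\ (i <= N)%N, (j <= N)%N & A = legs i j]).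

Section OneField.
Variable F : finFieldType.
Variable X : lmodN F.
Hypothesis satX : lsat X.

Lemma retract_strl (A : {set bas}) (b : bas -> 'rV[F]_(ldim X)) (c : bas -> 'cV[F]_(ldim X)) :
  (forall s g, s \in A -> b s *m lop X g =
     if step g s is Some t then (if t \in A then b t else 0) else 0) ->
  (forall t g, t \in A -> lop X g *m c t =
     if pre g t is Some s then (if s \in A then c s else 0) else 0) ->
  (forall s t, s \in A -> t \in A -> b s *m c t = (s == t)%:R%:M) ->
  exists W, lsat W /\ liso X (dsuml (strl F A) W).
Proof.
move=> /strl_from hb /strl_to hc /strl_dual h.
have [sW i] := dsuml_retract hb hc h.
by eexists; split; last exact: i; apply: sat_subl.
Qed.

Lemma step_arr m e (l : 'I_N.+1) :
  step (inr (Some m)) (e, l) = if val m == l then Some (e, lift ord0 m) else None.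
Proof. by rewrite /= eq_sym -(inj_eq val_inj). Qed.

Lemma pre_arr m e (l : 'I_N.+1) :
  pre (inr (Some m)) (e, l) =
    if m.+1 == l then Some (e, widen_ord (leqnSn N) m) else None.
Proof. by rewrite /= eq_sym -(inj_eq val_inj). Qed.

Lemma step_idem j (s : bas) : step (inl j) s = if val j == s.2 then Some s else None.
Proof. by rewrite /= eq_sym -(inj_eq val_inj). Qed.

Lemma pre_idem j (s : bas) : pre (inl j) s = if val j == s.2 then Some s else None.
Proof. by rewrite /= eq_sym -(inj_eq val_inj). Qed.

Lemma path_b p (w : 'M_(p, ldim X)) k l (m : 'I_N) : w *m en X k = w -> (k <= l)%N ->
  w *m pw X (l - k) *m lop X (inr (Some m)) =
    if val m == l then w *m pw X (l.+1 - k) else 0.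
Proof. by move=> we kl; rewrite (vec_pw_arr satX _ _ we) subnKC // subSn. Qed.

Lemma path_c p (D : 'M_(ldim X, p)) l i (m : 'I_N) : (l <= i)%N ->
  lop X (inr (Some m)) *m (en X l *m pw X (i - l) *m D) =
    if m.+1 == l then en X m *m pw X (i - m) *m D else 0.
Proof.
move=> li; rewrite arrE // en_at // -!mulmxA (mulmxA (en X m.+1)) en_mul //.
case: eqP => [e|_]; last by rewrite mul0mx mulmx0.
rewrite (mulmxA (at_ X)) -en_at // -mulmxA (mulmxA (at_ X)) -pwS.
by rewrite (_ : (i - l).+1 = i - m)%N //; lia.
Qed.

Lemma en_c p (D : 'M_(ldim X, p)) j l :
  en X j *m (en X l *m D) = if j == l then en X l *m D else 0.
Proof. by rewrite mulmxA en_mul //; case: eqP => [->|]; rewrite ?mul0mx. Qed.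

(** Take the lowest vertex [k] where [X] is nonzero and a nonzero vector there that dies as early as
    possible, after [i]. Its path splits off, as nothing reaches it from below [k]. *)
Lemma split_ivl : al X = 0 -> (0 < ldim X)%N ->
  exists A, indec A /\ exists W, lsat W /\ liso X (dsuml (strl F A) W).
Proof.
move=> al0 X0.
pose P k i := [exists w : 'rV[F]_(ldim X), [&& w *m en X k == w, w != 0
   & w *m pw X (i.+1 - k) == 0]].
pose Q k := [exists i : 'I_N.+1, (k <= i)%N && P k i].
have exQ : exists k, (k <= N)%N && Q k.
  have [k ek] : exists k : 'I_N.+1, en X k != 0.
    apply/existsP; apply: contraT; rewrite negb_exists => /forallP h.
    have := sum_en satX; rewrite big1 => [e|k _]; last by apply/eqP; have := h k; rewrite negbK.
    have : \rank (1%:M : 'M[F]_(ldim X)) = 0%N by rewrite -e mxrank0.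
    by rewrite mxrank1 => d; rewrite d in X0.
  have /rowV0Pn[w /submxP[D ->] w0] : en X k != 0 := ek.
  exists k; rewrite -ltnS ltn_ord /=; apply/existsP; exists ord_max.
  rewrite -ltnS ltn_ord /=; apply/existsP; exists (D *m en X k).
  rewrite w0 -!mulmxA en_id // eqxx /= en_pw_out // ?mulmx0 //.
  by rewrite subnKC // ltnW.
case: (ex_minnP exQ) => k /andP[kN /existsP[i0 hi0]] kmin.
have exP : exists i, [&& (k <= i)%N, (i <= N)%N & P k i].
  by exists i0; move: hi0 => /andP[-> ->]; rewrite -ltnS ltn_ord.
case: (ex_minnP exP) => i /and3P[ki iN /existsP[w /and3P[/eqP we w0 /eqP wi]]] imin.
pose wv l := w *m pw X (l - k).
have wi0 : wv i != 0.
  rewrite /wv; case: (ltngtP k i) ki => // [ki _|-> _]; last first.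
    by rewrite subnn /pw /= mulmx1.
  apply/negP => h; have : (i <= i.-1)%N.
    apply: imin; apply/and3P; split; [lia | lia | apply/existsP; exists w].
    by rewrite we eqxx w0 (_ : i.-1.+1 - k = i - k)%N //; lia.
  lia.
(* What arrives at [i] from the vertex before [k]. The functional [c0] must vanish on it, for
   otherwise [c] would not commute with the arrow into [k]. *)
pose B := if k is k'.+1 then en X k' *m pw X (i - k') else 0.
have nB : ~~ (wv i <= B)%MS.
  rewrite /B; case ek: k => [|k']; first by rewrite submx0.
  apply/negP => /submxP[u]; rewrite mulmxA => eu.
  have : (k <= k')%N.
    apply: kmin; rewrite (leq_trans _ kN) ?ek //=; apply/existsP.
    exists (Ordinal (iN : (i < N.+1)%N)); rewrite /= (leq_trans _ ki) ?ek //=.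
    apply/existsP; exists (u *m en X k').
    rewrite -mulmxA en_id // eqxx /=; apply/andP; split.
      by apply: contraNneq wi0; rewrite eu => ->; rewrite mul0mx.
    rewrite subSn; last by rewrite ltnW // -ek.
    by rewrite pwSr mulmxA -eu /wv -mulmxA -pwSr -subSn // wi.
  by rewrite ek ltnn.
have [c0 [wc Bc]] := exists_functional nB.
pose A := ivl k i.
pose b (s : bas) := w *m pw X (s.2 - k).
pose c (s : bas) := en X s.2 *m pw X (i - s.2) *m c0.
exists A; split; first by left; exists k, i; rewrite ki iN.
apply: (@retract_strl A b c).
- move=> [e l] g; rewrite inE /b => /= /andP[ne /andP[kl li]].
  case: g => [j|[m|]]; last first.
  + rewrite [lop _ _]al0 mulmx0 /=; case: ifP => // /eqP[e1].
    by rewrite e1 in ne.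
  + rewrite path_b // step_arr; case: eqP => //= em.
    rewrite inE /= ne /bump leq0n add1n em; case: ltnP => li'; first by rewrite leqW.
    by rewrite andbF (_ : l.+1 = i.+1) // (_ : nat_of_ord l = i) //; lia.
  rewrite -enE (vec_pw_en satX _ _ we) // subnKC // step_idem; case: eqP => //=.
  by rewrite inE /= ne kl li.
- move=> [e l] g; rewrite inE /c => /= /andP[ne /andP[kl li]].
  case: g => [j|[m|]]; last first.
  + rewrite [lop _ _]al0 mul0mx /=; case: ifP => // _.
    by rewrite inE.
  + rewrite path_c // pre_arr; case: eqP => //= em.
    rewrite inE /= ne (leq_trans (leqnSn m)) ?em // andbT.
    case: leqP => // mk.
    have ek : k = m.+1 by lia.
    by move: Bc; rewrite /B ek.
  rewrite -enE -mulmxA en_c pre_idem; case: eqP => //= _.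
  by rewrite inE /= ne kl li mulmxA.
move=> [e l] [e' l']; rewrite !inE /b /c => /= /andP[ne /andP[kl li]] /andP[ne' /andP[kl' li']].
rewrite !mulmxA (vec_pw_en satX _ _ we) // subnKC // xpair_eqE (negbTE ne) (negbTE ne') /=.
rewrite eq_sym (inj_eq val_inj); case: eqP => [->|_]; last by rewrite !mul0mx raddf0.
rewrite -[w *m _ *m _]mulmxA -pwD (_ : l' - k + (i - l') = i - k)%N //; lia.
Qed.

(** Both legs are chosen as long as possible: [i] is the least start of a path on which the loop is
    nonzero afterwards, and [j] the least start of a path to such a loop image. *)
Lemma split_legs : al X != 0 ->
  exists A, indec A /\ exists W, lsat W /\ liso X (dsuml (strl F A) W).
Proof.
move=> al0; pose pN k := pw X (N - k).
pose R i := [exists x : 'rV[F]_(ldim X), (x *m en X i == x) && (x *m pN i *m al X != 0)].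
have exR : exists i, (i <= N)%N && R i.
  exists N; rewrite leqnn; have /rowV0Pn[w /submxP[D ->] w0] := al0.
  apply/existsP; exists (D *m en X N).
  by rewrite -!mulmxA en_id // eqxx /pN subnn mul1mx en_al.
case: (ex_minnP exR) => i /andP[iN Ri] imin.
pose S j := [exists x : 'rV[F]_(ldim X), [exists y : 'rV[F]_(ldim X),
  [&& x *m en X i == x, y *m en X j == y, x *m pN i *m al X == y *m pN j & y *m pN j != 0]]].
have exS : exists j, (j <= N)%N && S j.
  exists N; rewrite leqnn; have /existsP[x /andP[/eqP xe x0]] := Ri.
  apply/existsP; exists x; apply/existsP; exists (x *m pN i *m al X).
  by rewrite xe -[_ *m al X *m en X N]mulmxA al_en // /pN subnn mulmx1 x0 !eqxx.
case: (ex_minnP exS) => j /andP[jN /existsP[x /existsP[y]]].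
case/and4P=> /eqP xe /eqP ye /eqP exy y0 jmin.
have yal : y *m pN j *m al X = 0.
  by rewrite -exy -[_ *m al X *m al X]mulmxA al_al // mulmx0.
set xN := x *m pN i in exy *; set yN := y *m pN j in exy y0 yal *.
(* What reaches the last vertex from just before [j]. The functional [c0] has to be 1 on [yN] and to
   vanish on [xN] and on [B]. *)
pose B := if j is j'.+1 then en X j' *m pN j' else 0.
have alB : (B *m al X != 0) -> (i < j)%N.
  rewrite /B; case ej: j => [|j']; first by rewrite mul0mx eqxx.
  move=> /rowV0Pn[w /submxP[D ->] w0]; rewrite ltnS; apply: imin.
  apply/andP; split; first by rewrite -ltnS -ej ltnW.
  apply/existsP; exists (D *m en X j'); rewrite -[_ *m en X j' *m en X j']mulmxA en_id // eqxx /=.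
  by move: w0; rewrite !mulmxA.
have nB : ~~ (yN <= xN + B)%MS.
  apply/negP => /sub_addsmxP[[u v] /= eu].
  (* The loop is applied to a relation [yN = u *m xN + v *m B]. If it kills [B], then [u] is zero;
     if not, [i < j] by minimality of [i], and [xN] too comes from the vertex before [j]. In both
     cases [yN] starts earlier than [j], against minimality. *)
  have eu' : u *m (yN) + v *m (B *m al X) = 0.
    by have := congr1 (mulmx^~ (al X)) eu; rewrite yal mulmxDl -(mulmxA u) -(mulmxA v) exy.
  have yS w j' : (j' < j)%N -> w *m en X j' = w -> yN = w *m pN j' -> False.
    move=> jj we ew; have : (j <= j')%N; last by rewrite leqNgt jj.
    apply: jmin; rewrite (leq_trans (ltnW jj)) //=.
    apply/existsP; exists x; apply/existsP; exists w.
    by rewrite xe we -ew exy y0 !eqxx.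
  have u0 : (u == 0) || (i < j)%N.
    have [//|/alB ->] := eqVneq (B *m al X) 0; last by rewrite orbT.
    move=> e; move: eu'; rewrite e mulmx0 addr0 [u]mx11_scalar mul_scalar_mx.
    move=> /eqP; rewrite scaler_eq0 (negPf y0) orbF => /eqP ->.
    by rewrite raddf0 eqxx.
  case ej: j => [|j'].
    move: u0 eu; rewrite ej ltn0 orbF => /eqP ->; rewrite /B ej mul0mx mulmx0 addr0.
    by move=> e; rewrite -/yN e eqxx in y0.
  case/orP: u0 => [/eqP u0|ij].
    apply: (@yS (v *m en X j') j'); rewrite ?ej -?mulmxA ?en_id //.
    by rewrite eu u0 mul0mx add0r /B ej.
  have ij' : (i <= j')%N by rewrite -ltnS -ej.
  apply: (@yS (u *m (x *m pw X (j' - i)) + v *m en X j') j'); rewrite ?ej //.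
    by rewrite mulmxDl -!mulmxA en_id // (mulmxA x) (vec_pw_en satX _ _ xe) subnKC // eqxx.
  rewrite eu mulmxDl /B ej -!mulmxA -pwD; congr (_ *m (x *m pw X _) + _).
  by rewrite /pN; lia.
have [c0 [yc]] := exists_functional nB.
move=> /eqP; rewrite -submx0 addsmxMr addsmx_sub !submx0 => /andP[/eqP xc /eqP Bc].
pose A := legs i j.
pose b (s : bas) := if s.1 then x *m pw X (s.2 - i) else y *m pw X (s.2 - j).
(* Coordinates on the [true] leg are read after moving to the last vertex and applying the loop,
   because [x] becomes visible to [c0] only as [yN]. *)
pose c (s : bas) := en X s.2 *m pw X (N - s.2) *m (if s.1 then al X *m c0 else c0).
have lN (l : 'I_N.+1) : (l <= N)%N by rewrite -ltnS.
have we p (w : 'rV[F]_(ldim X)) (l : 'I_N.+1) : w *m en X p = w -> (p <= l)%N ->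
    w *m pw X (l - p) *m al X = if l == ord_max then w *m pN p *m al X else 0.
  move=> e pl; rewrite -[in LHS]en_al // mulmxA (vec_pw_en satX _ _ e) subnKC //.
  rewrite -[l == _](inj_eq val_inj) /= eq_sym.
  by case: eqP => [->|_]; rewrite ?mul0mx.
exists A; split; first by right; exists i, j.
apply: (@retract_strl A b c).
- move=> [e l] g; rewrite inE /b => /= hl.
  case: g => [v|[m|]].
  + have -> : (if e then x *m pw X (l - i) else y *m pw X (l - j)) *m lop X (inl v) =
      if val v == l then (if e then x *m pw X (l - i) else y *m pw X (l - j)) else 0.
      rewrite -enE; case: e hl => hl.
        by rewrite (vec_pw_en satX _ _ xe) subnKC.
      by rewrite (vec_pw_en satX _ _ ye) subnKC.
    rewrite step_idem; case: eqP => //= _.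
    by rewrite inE /= hl.
  + rewrite step_arr; have -> : (if e then x *m pw X (l - i) else y *m pw X (l - j)) *m
       lop X (inr (Some m)) = if val m == l then
       (if e then x *m pw X (l.+1 - i) else y *m pw X (l.+1 - j)) else 0.
      by case: e hl => hl; rewrite path_b.
    case: eqP => //= em; rewrite inE /= /bump leq0n add1n em.
    by case: e hl => hl; rewrite leqW.
  + rewrite /= xpair_eqE -[lop X _]/(al X); case: e hl => hl; rewrite we //=.
      by case: eqP => // el; rewrite inE /= jN exy.
    by case: eqP => // _; rewrite yal.
- move=> [e l] g; rewrite inE /c => /= hl.
  case: g => [v|[m|]].
  + rewrite -enE -mulmxA en_c pre_idem; case: eqP => //= _.
    by rewrite inE /= hl mulmxA.
  + rewrite path_c // pre_arr; case: eqP => //= em.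
    rewrite inE /=; case: e hl => hl; case: ifP => // hm.
      have him : (m < i)%N by rewrite ltnNge hm.
      apply/eqP; apply: contraFT hm => h; apply: imin; rewrite (leq_trans (ltnW him)) //=.
      have /rowV0Pn[w /submxP[D ->] w0] : en X m *m pN m *m al X != 0.
        by apply: contraNneq h => h; rewrite mulmxA h mul0mx.
      apply/existsP; exists (D *m en X m); rewrite -[_ *m en X m *m en X m]mulmxA en_id // eqxx /=.
      by move: w0; rewrite !mulmxA.
    have ej : j = m.+1 by move: hl hm; lia.
    by move: Bc; rewrite /B ej.
  + rewrite -[lop X _]/(al X) /= xpair_eqE; case: e hl => hl /=.
      have [->|nl] := eqVneq l ord_max.
        by rewrite /= subnn mulmx1 (mulmxA (al X)) al_en // mulmxA al_al ?mul0mx.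
      by rewrite !mulmxA al_en_neq ?mul0mx // -[N]/(val (@ord_max N)) (inj_eq val_inj).
    have [->|nl] := eqVneq l ord_max; last first.
      by rewrite !mulmxA al_en_neq ?mul0mx // -[N]/(val (@ord_max N)) (inj_eq val_inj).
    by rewrite /= subnn !mulmx1 (mulmxA (al X)) al_en // inE /= iN mulmxA en_al.
move=> [e l] [e' l']; rewrite !inE /b /c => /= hl hl'.
have dual p (w : 'rV[F]_(ldim X)) (D : 'cV[F]_(ldim X)) : w *m en X p = w -> (p <= l)%N ->
    w *m pw X (l - p) *m (en X l' *m pw X (N - l') *m D) =
    if l == l' then w *m pN p *m D else 0.
  move=> ew pl; rewrite !mulmxA (vec_pw_en satX _ _ ew) subnKC // eq_sym (inj_eq val_inj).
  case: eqP => [<-|_]; last by rewrite !mul0mx.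
  by rewrite -[w *m _ *m _]mulmxA -pwD /pN (_ : l - p + (N - l) = N - p)%N //; have := lN l; lia.
rewrite xpair_eqE; case: e hl => hl; rewrite dual //; case: eqP => _; rewrite ?andbF ?andbT ?raddf0 //.
  case: e' hl' => hl' /=; last by rewrite xc raddf0.
  by rewrite mulmxA exy yc.
case: e' hl' => hl' /=; last by rewrite yc.
by rewrite mulmxA yal mul0mx raddf0.
Qed.

Lemma split_string : (0 < ldim X)%N ->
  exists A, indec A /\ exists W, lsat W /\ liso X (dsuml (strl F A) W).
Proof.
by move=> X0; have [/split_ivl/(_ X0)|/split_legs] := eqVneq (al X) 0.
Qed.

End OneField.

Lemma indec_neq0 A : indec A -> A != set0.
Proof.
case=> [[k [i [/andP[ki iN] ->]]]|[i [j [iN jN ->]]]]; apply/set0Pn.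
  have lk : (k < N.+1)%N by rewrite ltnS (leq_trans ki).
  by exists (false, Ordinal lk); rewrite inE /= leqnn.
by exists (true, ord_max); rewrite inE.
Qed.

(** Splitting off strings repeatedly leaves a direct sum of string modules, each defined over
    [K]. *)
Lemma string_descent (K : finFieldType) (x : extn K) (X : lmodN (efield x)) : lsat X ->
  exists M : lmodN K, lsat M /\ liso X (lext (emap x) M).
Proof.
have [k] := ubnP (ldim X); elim: k X => // k IH X lk satX.
have [X0|X0] := posnP (ldim X).
  exists (strl K set0); split; first exact: strl_sat.
  apply: liso_trans (_ : liso X (strl (efield x) set0)) _; last by rewrite liso_sym strl_ext.
  have d : ldim X = ldim (strl (efield x) (set0 : {set bas})) by rewrite /= cards0.
  apply: (@liso_free _ _ _ _ 0); rewrite ?lhom0 //.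
  by rewrite /row_free mxrank0 X0.
have [A [iA [W [satW i]]]] := split_string satX X0.
have lW : (ldim W < k)%N.
  have := liso_dim i; rewrite /= => e; move: lk; rewrite e ltnS.
  by apply: leq_trans; rewrite -add1n leq_add2r card_gt0 indec_neq0.
have [M [satM iM]] := IH _ lW satW.
exists (dsuml (strl K A) M); split; first by rewrite /lsat sat_dsuml; apply/andP; split; [exact: strl_sat|].
apply: liso_trans i _; rewrite liso_sym; apply: liso_trans (lext_dsuml _ _ _) _.
by apply: dsuml_iso; [exact: strl_ext | rewrite liso_sym].
Qed.

End Split.

(** * Automorphisms and split exact sequences *)

Section SingularEndomorphisms.
Variables (G : finType) (F : finFieldType).
Implicit Types (M N A B C : lmod G F).

(* For an endomorphism [f], the map [f + a] is singular for at most [ldim M]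
   scalars [a]. *)
Lemma naut_bound M : (#|F| * (nhom M M - naut M) <= ldim M * nhom M M)%N.
Proof.
pose H := [set f : 'M[F]_(ldim M, ldim M) | lhom (M := M) (N := M) f].
pose Z := [set f : 'M[F]_(ldim M, ldim M) | lhom (M := M) (N := M) f && ~~ row_free f].
have -> : (nhom M M - naut M)%N = #|Z|.
  rewrite /nhom /naut /ninj -/H -(cardsID [set f : 'M[F]_(ldim M) | row_free f] H).
  rewrite (_ : H :&: _ = [set f | lhom f && row_free f]).
    rewrite addKn; apply: eq_card => f; by rewrite !inE andbC.
  by apply/setP => f; rewrite !inE.
(* Translation by [a] permutes the endomorphisms, so pairs [(f, a)] with [f + a] singular number
   [#|F| * #|Z|]. Counted by [f], they are bounded through the roots of a characteristic
   polynomial. *)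
have e (a : F) : #|[set f in H | ~~ row_free (f + a%:M)]| = #|Z|.
  rewrite -(card_imset _ (addIr (a%:M : 'M[F]_(ldim M)))).
  apply: eq_card => f; rewrite inE; apply/imsetP/andP => [[k]|[hf nf]].
    rewrite !inE => /andP[hk nk] ->; split=> //; apply: lhomD => //.
    by rewrite -scalemx1; apply: lhomZ (lhom1 M).
  exists (f - a%:M); last by rewrite subrK.
  rewrite !inE subrK nf andbT; apply: lhomB => //.
  by rewrite -scalemx1; apply: lhomZ (lhom1 M).
have -> : (#|F| * #|Z|)%N = (\sum_(a : F) #|[set f in H | ~~ row_free (f + a%:M)]|)%N.
  by rewrite (eq_bigr (fun=> #|Z|)) // sum_nat_const.
rewrite (eq_bigr (fun a : F => \sum_(f in H) (~~ row_free (f + a%:M) : nat)))%N; last first.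
  move=> a _; rewrite -sum1dep_card big_mkcondr; apply: eq_bigr => f _.
  by case: (~~ _).
rewrite exchange_big /= mulnC -sum_nat_const; apply: leq_sum => f _.
pose p := char_poly (- f).
have sp : size p = (ldim M).+1 := size_char_poly _.
have p0 : p != 0 by rewrite -size_poly_gt0 sp.
have rp a : ~~ row_free (f + a%:M) -> root p a.
  rewrite row_free_unit unitmxE unitfE negbK => /eqP d; rewrite /root /p.
  rewrite /char_poly -horner_evalE -det_map_mx /=.
  rewrite (_ : map_mx _ _ = f + a%:M) ?d //.
  apply/matrixP => i j; rewrite !mxE /= horner_evalE.
  rewrite hornerD hornerN hornerC opprK addrC; congr (_ + _).
  by case: eqP => _; rewrite ?mulr1n ?hornerX ?mulr0n ?hornerC.
pose S := [set a : F | ~~ row_free (f + a%:M)].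
rewrite (_ : (\sum_(a : F) _)%N = size (enum S)); last first.
  rewrite -cardE -sum1dep_card [RHS]big_mkcond; apply: eq_bigr => a _.
  by case: (~~ _).
rewrite -ltnS -sp; apply: max_poly_roots p0 _ (enum_uniq _).
by apply/allP => a; rewrite mem_enum inE; apply: rp.
Qed.

End SingularEndomorphisms.

Section ExactSequences.
Variables (G : finType) (F : finFieldType).
Variables (A B N : lmod G F).
Variables (g : 'M[F]_(ldim B, ldim N)) (h : 'M[F]_(ldim N, ldim A)).
Hypotheses (hg : lhom g) (fg : row_free g) (hh : lhom h) (fh : row_full h).
Hypothesis (gh : (kermx h :=: g)%MS).

Lemma exact_comp : g *m h = 0.
Proof. by apply/eqP; rewrite -sub_kermx gh. Qed.

Lemma exact_dim : ldim N = (ldim A + ldim B)%N.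
Proof.
have := mxrank_ker h; rewrite gh (eqP fg) (eqP fh) => ->.
by rewrite subnKC // -[X in (X <= _)%N](eqP fh) rank_leq_row.
Qed.

(** Two extensions of [e] along [g] differ by a map that kills [B], that is, one factoring through
    [h]. *)
Lemma exact_fiber C (e : 'M_(ldim B, ldim C)) (r0 : 'M_(ldim N, ldim C)) :
  lhom r0 -> g *m r0 = e ->
  #|[set r : 'M_(ldim N, ldim C) | lhom r && (g *m r == e)]| = nhom A C.
Proof.
move=> hr0 e0.
have inj : injective (fun t : 'M[F]_(ldim A, ldim C) => r0 + h *m t).
  by move=> s t /addrI; apply: row_full_inj.
rewrite /nhom -(card_imset _ inj); apply: eq_card => r; rewrite inE.
apply/andP/imsetP => [[hr /eqP er]|[t]]; last first.
  rewrite inE => ht ->; split; first exact: lhomD hr0 (lhom_comp hh ht).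
  by rewrite mulmxDr mulmxA exact_comp mul0mx addr0 e0.
have ke : kermx h *m (r - r0) = 0.
  apply/eqP; rewrite -sub_kermx gh sub_kermx.
  by rewrite mulmxBr er e0 subrr.
have [hc ec] := lhom_factor_epi hh fh (lhomB hr hr0) ke.
by exists (pinvmx h *m (r - r0)); rewrite ?inE // ec addrC subrK.
Qed.

Lemma exact_fiber_le C (e : 'M_(ldim B, ldim C)) :
  (#|[set r : 'M_(ldim N, ldim C) | lhom r && (g *m r == e)]| <= nhom A C)%N.
Proof.
set R := [set _ | _]; have [->|/set0Pn[r0]] := eqVneq R set0; first by rewrite cards0.
by rewrite inE => /andP[hr0 /eqP e0]; rewrite /R (exact_fiber hr0 e0).
Qed.

Lemma nhom_exactl C : (nhom N C <= nhom A C * nhom B C)%N.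
Proof.
rewrite {1}/nhom (card_fibers (Q := @lhom _ _ B C) (h := mulmx g)); last first.
  by move=> r hr; apply: lhom_comp hg hr.
rewrite mulnC /nhom -[X in (_ <= X * _)%N]sum1dep_card big_distrl /=.
by apply: leq_sum => e _; rewrite mul1n; apply: exact_fiber_le.
Qed.

Lemma nhom_gt0 (C D : lmod G F) : (0 < nhom C D)%N.
Proof. by apply/card_gt0P; exists 0; rewrite inE lhom0. Qed.

(** Without a retraction the fibre over the identity of [B] is empty, which makes the bound of left
    exactness strict. *)
Lemma nhom_exactl_lt :
  ~~ [exists r : 'M_(ldim N, ldim B), lhom r && (g *m r == 1%:M)] ->
  (nhom N B < nhom A B * nhom B B)%N.
Proof.
move=> nr.
rewrite {1}/nhom (card_fibers (Q := @lhom _ _ B B) (h := mulmx g)); last first.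
  by move=> r hr; apply: lhom_comp hg hr.
rewrite mulnC /nhom -[X in (_ < X * _)%N]sum1dep_card big_distrl /=.
rewrite (bigD1 1%:M) ?lhom1 //= [X in (_ < X)%N](bigD1 1%:M) ?lhom1 //=.
rewrite (_ : [set _ | _] = set0).
  rewrite cards0 add0n mul1n -addn1 addnC leq_add //.
    by apply/card_gt0P; exists 0; rewrite inE lhom0.
  by apply: leq_sum => e _; rewrite ?mul1n; apply: exact_fiber_le.
apply/setP => r; rewrite !inE; apply: contraNF nr => hr.
by apply/existsP; exists r.
Qed.

Lemma nhom_exactr C : (nhom C N <= nhom C A * nhom C B)%N.
Proof.
rewrite {1}/nhom (card_fibers (Q := @lhom _ _ C A) (h := mulmx^~ h)); last first.
  by move=> r hr; apply: lhom_comp hr hh.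
rewrite /nhom -[X in (_ <= X * _)%N]sum1dep_card big_distrl /=.
apply: leq_sum => e _; rewrite mul1n.
set R := [set _ | _]; have [->|/set0Pn[r0]] := eqVneq R set0; first by rewrite cards0.
rewrite inE => /andP[hr0 /eqP e0].
have inj : injective (fun t : 'M[F]_(ldim C, ldim B) => r0 + t *m g).
  by move=> s t /addrI; apply: row_free_inj.
rewrite -(card_imset _ inj); apply/subset_leq_card/subsetP => r.
rewrite inE => /andP[hr /eqP er].
have le : (r - r0 <= g)%MS by rewrite -gh sub_kermx mulmxBl er e0 subrr.
have [hc ec] := lhom_factor_inj (lhomB hr hr0) hg fg le.
by apply/imsetP; exists ((r - r0) *m pinvmx g); rewrite ?inE // ec addrC subrK.
Qed.

Lemma exact_split_free (r : 'M_(ldim N, ldim B)) :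
  row_free (row_mx r h) = row_free (g *m r).
Proof.
apply/idP/idP => fr; rewrite -kermx_eq0 -submx0; apply/row_subP => i;
  set u := row i _.
  have u0 : u *m (g *m r) = 0 by rewrite /u -row_mul mulmx_ker row0.
  rewrite submx0 -(mulmx_free_eq0 _ fg) -(mulmx_free_eq0 _ fr).
  by rewrite mul_mx_row -!mulmxA u0 exact_comp mulmx0 row_mx0.
have : u *m row_mx r h = 0 by rewrite /u -row_mul mulmx_ker row0.
rewrite mul_mx_row => e.
have := congr1 lsubmx e; have := congr1 rsubmx e.
rewrite row_mxKl row_mxKr !linear0 => uh ur.
have : (u <= g)%MS by rewrite -gh sub_kermx uh.
case/submxP => D eD; rewrite eD -mulmxA in ur.
have D0 : D = 0 by apply/eqP; rewrite -(mulmx_free_eq0 _ fr) ur.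
by rewrite eD D0 mul0mx sub0mx.
Qed.

Lemma exact_split_iso (r : 'M_(ldim N, ldim B)) :
  lhom r -> row_free (g *m r) -> liso N (dsuml B A).
Proof.
move=> hr; rewrite -exact_split_free => fr.
apply: (@liso_free _ _ N (dsuml B A) (row_mx r h)) => //; first by rewrite lhom_row hr.
by rewrite /= exact_dim addnC.
Qed.

(** Left exactness in each variable bounds End [N] by the four hom spaces between the end terms, and
    Hom(N, B) loses strictly because the sequence does not split. *)
Lemma nhom_exact_lt : ~~ liso N (dsuml A B) ->
  (nhom N N < nhom (dsuml A B) (dsuml A B))%N.
Proof.
move=> ni; apply: leq_ltn_trans (nhom_exactr N) _.
have nr : ~~ [exists r : 'M_(ldim N, ldim B), lhom r && (g *m r == 1%:M)].
  apply: contra ni => /existsP[r /andP[hr /eqP e]].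
  apply: liso_trans (dsumlC B A); apply: (exact_split_iso hr).
  by rewrite e row_free_unit unitmx1.
rewrite nhom_dsumr !nhom_dsuml.
apply: (@leq_ltn_trans ((nhom A A * nhom B A) * nhom N B)%N).
  by rewrite leq_mul2r nhom_exactl orbT.
by rewrite ltn_mul2l nhom_exactl_lt // muln_gt0 !nhom_gt0.
Qed.

(** Miyata's theorem by counting: for a middle term isomorphic to the sum, Hom(N, B) is too large
    for the sequence not to split. *)
Lemma exact_splits : liso N (dsuml A B) ->
  exists2 r : 'M_(ldim N, ldim B), lhom r & g *m r = 1%:M.
Proof.
move=> i.
have [/existsP[r /andP[hr /eqP e]]|/nhom_exactl_lt] := boolP
  [exists r : 'M_(ldim N, ldim B), lhom r && (g *m r == 1%:M)]; first by exists r.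
by rewrite (nhom_iso i (liso_refl B)) nhom_dsuml ltnn.
Qed.

(** The map [row_mx r h] is injective exactly when [g *m r] is an automorphism of [B]; given that
    automorphism, the choices of [r] form a coset of Hom(A, B). *)
Lemma card_retractions : liso N (dsuml A B) ->
  #|[set r : 'M_(ldim N, ldim B) | lhom r && row_free (row_mx r h)]| =
  (naut B * nhom A B)%N.
Proof.
case/exact_splits => r0 hr0 e0.
rewrite (card_fibers (Q := fun e : 'M_(ldim B) => lhom (M := B) (N := B) e && row_free e)
  (h := mulmx g)); last first.
  by move=> r /andP[hr]; rewrite exact_split_free => ->; rewrite (lhom_comp hg hr).
rewrite /naut /ninj -sum1dep_card big_distrl /=.
apply: eq_bigr => e /andP[he fe]; rewrite mul1n.
rewrite -(@exact_fiber _ e (r0 *m e)) ?(lhom_comp hr0 he) //; last first.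
  by rewrite mulmxA e0 mul1mx.
apply: eq_card => r; rewrite !inE exact_split_free.
by case: eqP => [->|]; rewrite ?fe ?andbT ?andbF.
Qed.

End ExactSequences.

Section SplitCount.
Variables (G : finType) (F : finFieldType).
Implicit Types (X A B : lmod G F).

(* A Hall number with split middle term counts, up to automorphisms of the end
   terms and a choice of retraction, the automorphisms of the middle term. *)
Lemma hall_split A B X : liso X (dsuml A B) ->
  (#|[set U : 'M_(ldim X) | [&& submod U, liso (subl U) B & liso (quol U) A]]|
    * (naut A * naut B * nhom A B))%N = naut X.
Proof.
move=> iX; have iX' : liso X (dsuml B A) by apply: liso_trans iX (dsumlC A B).
have dX : ldim X = (ldim B + ldim A)%N := liso_dim iX'.
pose Q (k : 'M_(ldim X, ldim A)) := lhom (M := X) (N := A) k && row_full k.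
pose P (f : 'M_(ldim X, ldim (dsuml B A))) := lhom f && row_free f.
pose c (U : 'M_(ldim X)) := (liso (subl U) B * (naut B * nhom A B))%N.
have PQ f : P f -> Q (rsubmx (f : 'M_(ldim X, ldim B + ldim A))).
  case/andP => hf ff; apply/andP; split.
    by move: hf; rewrite -{1}[f]hsubmxK lhom_row => /andP[].
  have : row_full f by rewrite /row_full (eqP ff); apply/eqP.
  case/row_fullP => k; move: f {hf ff} k => /= f k ek.
  apply/row_fullP; exists (dsubmx k).
  have ekf : k *m f = block_mx (usubmx k *m lsubmx f) (usubmx k *m rsubmx f)
                               (dsubmx k *m lsubmx f) (dsubmx k *m rsubmx f).
    by rewrite -mul_col_row vsubmxK hsubmxK.
  move: ek; rewrite ekf [RHS]scalar_mx_block => /(congr1 drsubmx).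
  by rewrite !block_mxKdr.
(* An isomorphism to the sum is a pair [(r, k)]. For a fixed surjection [k] onto [A], completions
   exist only if its kernel is isomorphic to [B], and they are then counted as retractions. *)
have inner k : Q k -> #|[set f | P f && (rsubmx (f : 'M_(ldim X, ldim B + ldim A)) == k)]| =
    c <<kermx k>>%MS.
  case/andP => hk fk; set U := <<kermx k>>%MS.
  have sU : submod U by apply: submod_ker hk.
  have -> : #|[set f | P f && (rsubmx (f : 'M_(ldim X, ldim B + ldim A)) == k)]| =
     #|[set r : 'M_(ldim X, ldim B) | lhom (M := X) (N := B) r && row_free (row_mx r k)]|.
    have inj : injective (fun r : 'M[F]_(ldim X, ldim B) => row_mx r k).
      by move=> r r' /eq_row_mx[].
    rewrite -[RHS](card_imset _ inj); apply: eq_card => f; rewrite inE; apply/andP/imsetP.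
      case=> /andP[hf ff] /eqP ek; exists (lsubmx (f : 'M_(ldim X, ldim B + ldim A))).
        rewrite inE -ek hsubmxK; apply/andP; split=> //.
        by move: hf; rewrite -{1}[f]hsubmxK lhom_row => /andP[].
      by rewrite -ek hsubmxK.
    case=> r; rewrite inE => /andP[hr fr] ->; split; last by rewrite row_mxKr.
    by apply/andP; split=> //; rewrite lhom_row hr hk.
  have rU : \rank U = ldim B.
    by rewrite genmxE mxrank_ker (eqP fk) dX addnK.
  rewrite /c; case: (boolP (liso (subl U) B)) => [iU|nU].
    rewrite mul1n; move: iU; rewrite liso_sym => /lisoP[t [t' [ht ht' e e']]].
    apply: (@card_retractions _ _ A B X (t *m row_base U) k) => //.
    - exact: lhom_comp ht (incl_hom sU).
    - by rewrite /row_free mxrankMfree ?row_base_free //; exact: row_free_inv e.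
    - apply: eqmx_sym; apply: eqmx_trans (eqmxMfull _ (row_full_inv e')) _.
      by apply: eqmx_trans (eq_row_base _) (genmxE _).
  apply/eqP; rewrite mul0n cards_eq0; apply/eqP/setP => r; rewrite !inE.
  apply: contraNF nU => /andP[hr fr].
  have bk : row_base U *m k = 0.
    by apply/eqP; rewrite -sub_kermx eq_row_base genmxE.
  apply: (@liso_free _ _ (subl U) B (row_base U *m r)) => //.
    exact: lhom_comp (incl_hom sU) hr.
  rewrite -kermx_eq0; have := mulmx_ker (row_base U *m r).
  set v := kermx _ => ev.
  rewrite -(mulmx_free_eq0 _ (row_base_free U)) -(mulmx_free_eq0 _ fr).
  by rewrite mul_mx_row -[v *m _ *m r]mulmxA ev -[v *m _ *m k]mulmxA bk mulmx0 row_mx0.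
rewrite /naut (ninj_iso (liso_refl X) iX') [RHS](card_fibers (P := P) (Q := Q) PQ).
rewrite (eq_bigr _ inner).
rewrite (partition_big (fun k => <<kermx k>>%MS) (@submod G F X)) /=; last first.
  by move=> k /andP[hk _]; apply: submod_ker hk.
rewrite -sum1dep_card big_distrl /= (eq_bigl (fun U => submod U && (liso (subl U) B && liso (quol U) A))) //.
rewrite big_mkcondr; apply: eq_bigr => U sU.
rewrite (eq_bigr (fun=> c U)) => [|k /andP[_ /eqP-> //]].
rewrite sum_nat_const -[X in _ = (X * _)%N]cardsE (nepi_ker A sU) /c.
by case: liso => /=; rewrite ?mul0n ?muln0 //; case: liso; rewrite ?mul0n //= !mul1n mulnA.
Qed.

End SplitCount.

(** * Isomorphism classes, uniformly in the field, and rational counts *)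

Section Classes.
Variables (G : finType) (rels : seq (seq (seq G) * seq (seq G))) (K : finFieldType).
Local Notation ok M := (sat rels M).

Fixpoint niso (s : seq (lmod G K)) : seq (lmod G K) :=
  if s is M :: s' then (if has (liso M) (niso s') then niso s' else M :: niso s') else [::].

Definition allmods k : seq (lmod G K) :=
  [seq Lmod k (fun_of_fin op) | op <- enum {: {ffun G -> 'M[K]_k}}].

(** One representative per class over [K]; the list is finite because [K] is. *)
Definition classes k : seq (lmod G K) := niso (filter (fun M => ok M) (allmods k)).

Lemma niso_has M s : has (liso M) (niso s) = has (liso M) s.
Proof.
elim: s => //= N s IH; case: ifP => [h|_] /=; last by rewrite IH.
rewrite IH; case: (boolP (liso M N)) => //= i.
by rewrite -IH (eq_has (liso_ltrans i)) h.
Qed.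

Lemma niso_count M s : (count (liso M) (niso s) <= 1)%N.
Proof.
elim: s => //= N s IH; case: ifP => //= h.
case: (boolP (liso M N)) => [i|_] //.
by rewrite add1n ltnS leqn0 -leqn0 leqNgt -has_count (eq_has (liso_ltrans i)) h.
Qed.

Lemma niso_all (P : pred (lmod G K)) s : all P s -> all P (niso s).
Proof. by elim: s => //= N s IH /andP[PN Ps]; case: ifP => /= _; rewrite ?PN IH. Qed.

Lemma classes_all k : all (fun N => ok N && (ldim N == k)) (classes k).
Proof.
apply: niso_all; rewrite all_filter /allmods all_map; apply/allP => op _ /=.
by apply/implyP => ->; rewrite eqxx.
Qed.

Lemma classes_count (M : lmod G K) : ok M ->
  count (liso M) (classes (ldim M)) = 1%N.
Proof.
move=> sM; apply/eqP; rewrite eqn_leq niso_count -has_count niso_has.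
pose M' := Lmod (ldim M) (fun_of_fin (finfun (lop M))).
have i : liso M M'.
  apply/lisoP; exists 1%:M, 1%:M; rewrite mulmx1; split=> //; apply/lhomP => g /=.
    by rewrite mulmx1 mul1mx ffunE.
  by rewrite mulmx1 mul1mx ffunE.
have sM' : ok M' by rewrite -(sat_iso rels i).
rewrite /allmods filter_map has_map; apply/hasP.
by exists (finfun (lop M)); rewrite // mem_filter mem_enum andbT.
Qed.

Section Extension.
(** This makes the classes over [K] a complete list over every extension; string decompositions
    supply it for the bound quiver. *)
Hypothesis descent : forall (x : extn K) (X : lmod G (efield x)), ok X ->
  exists M : lmod G K, ok M /\ liso X (lext (emap x) M).
Implicit Type x : extn K.

Notation "M ^@ x" := (lext (emap x) M) (at level 8, x at level 7, format "M ^@ x").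

Lemma classes_ext x (W : lmod G (efield x)) : ok W ->
  count (fun N => liso W N^@x) (classes (ldim W)) = 1%N.
Proof.
move=> sW; have [M [sM i]] := descent sW.
have d : ldim W = ldim M by rewrite (liso_dim i).
rewrite d -(classes_count sM); apply: eq_count => N.
by rewrite (liso_ltrans i) liso_descent.
Qed.

Lemma sum_classes x (m : nat) (W : lmod G (efield x)) : ok W ->
  (ldim W < m)%N ->
  \sum_(k < m) \sum_(N <- classes k) (liso W N^@x)%:R = 1 :> rat.
Proof.
move=> sW lm; rewrite (bigD1 (Ordinal lm)) //= [X in _ + X]big1 ?addr0 => [|k kW].
  transitivity ((count (fun N => liso W N^@x) (classes (ldim W)))%:R : rat).
    rewrite -sum1_count natr_sum [RHS]big_mkcond /=; apply: eq_bigr => N _.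
    by case: liso.
  by rewrite classes_ext.
have := classes_all k; elim: (classes k) => [|N s IH]; first by rewrite big_nil.
rewrite big_cons /= => /andP[/andP[_ /eqP dN] /IH ->]; rewrite addr0.
case: (boolP (liso _ _)) => // /liso_dim /= e.
by case/eqP: kW; apply: val_inj; rewrite /= -dN -e.
Qed.

(** A partition of unity by isomorphism type. The two outer sums on the right have index sets
    independent of [x], so rationality can be proved term by term. *)
Lemma sum_over_classes x (I : finType) (P : pred I) (m : nat)
    (W : I -> lmod G (efield x)) (f : I -> rat) :
  (forall i, P i -> ok (W i)) -> (forall i, P i -> (ldim (W i) < m)%N) ->
  \sum_(i | P i) f i =
  \sum_(k < m) \sum_(N <- classes k) \sum_(i | P i) (liso (W i) N^@x)%:R * f i.
Proof.
move=> sW lW.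
rewrite (eq_bigr (fun i => \sum_(k < m) \sum_(N <- classes k) (liso (W i) N^@x)%:R * f i)).
  rewrite exchange_big; apply: eq_bigr => k _; exact: exchange_big.
move=> i Pi; rewrite -[LHS]mul1r -[X in X * _ = _](sum_classes (sW i Pi) (lW i Pi)) mulr_suml.
by apply: eq_bigr => k _; rewrite mulr_suml.
Qed.

Lemma submod0 (F : finFieldType) (M : lmod G F) : submod (M := M) 0.
Proof.
by rewrite /submod genmx0 eqxx; apply/forallP => g; rewrite mul0mx sub0mx.
Qed.

Lemma submod1 (F : finFieldType) (M : lmod G F) : submod (M := M) 1%:M.
Proof.
by rewrite /submod genmx1 eqxx; apply/forallP => g; rewrite submx1.
Qed.

Lemma quol0 (F : finFieldType) (M : lmod G F) : liso (quol (M := M) 0) M.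
Proof.
apply: (@liso_quol _ _ _ _ _ 1%:M) => //; [exact: submod0 | exact: lhom1 | |].
  by rewrite row_full_unit unitmx1.
by apply: eqmx_sub => m x; rewrite sub_kermx mulmx1 submx0.
Qed.

Lemma subl1 (F : finFieldType) (M : lmod G F) : liso M (subl (M := M) 1%:M).
Proof.
by apply: (@liso_subl _ _ _ _ _ 1%:M) => //; rewrite ?submod1 ?lhom1 ?row_free_unit ?unitmx1.
Qed.

(** The quotient by zero is separated off, so that what remains involves smaller modules and can
    feed an induction on dimension. *)
Lemma sum_quol (x : extn K) (M : lmod G (efield x)) (f : lmod G (efield x) -> rat) :
  ok M -> (forall A B, liso A B -> f A = f B) ->
  \sum_(W : 'M_(ldim M) | submod W) f (quol W) =
  f M + \sum_(k < ldim M) \sum_(N <- classes k) (nquo N^@x M)%:R * f N^@x.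
Proof.
move=> sM hf; rewrite (bigD1 0) ?submod0 //= (hf _ _ (quol0 M)); congr (_ + _).
pose P (W : 'M_(ldim M)) := submod W && (W != 0).
have lP W : P W -> (ldim (quol W) < ldim M)%N.
  case/andP => _ W0; rewrite /= mxrank_coker.
  have r0 : (0 < \rank W)%N by rewrite lt0n mxrank_eq0.
  by rewrite ltn_subrL r0 (leq_trans r0 (rank_leq_row W)).
rewrite (@sum_over_classes x _ P (ldim M) (fun W => quol W)) //; last first.
  by move=> W /andP[sW _]; apply: sat_quol.
apply: eq_bigr => k _; have := classes_all k.
elim: (classes k) => [|N s IH]; first by rewrite !big_nil.
rewrite !big_cons /= => /andP[/andP[_ /eqP dN] /IH ->]; congr (_ + _).
rewrite nquoE natr_sum mulr_suml [RHS](bigD1 0) ?submod0 //= (_ : liso _ _ = false).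
  rewrite mul0r add0r; apply: eq_bigr => W _.
  by case: (boolP (liso _ _)) => [/hf ->|]; rewrite ?mul0r.
apply: contraTF (ltn_ord k) => /liso_dim /=; rewrite mxrank_coker mxrank0 subn0 dN => <-.
by rewrite ltnn.
Qed.

Lemma sum_subl (x : extn K) (M : lmod G (efield x)) (f : lmod G (efield x) -> rat) :
  ok M -> (forall A B, liso A B -> f A = f B) ->
  \sum_(W : 'M_(ldim M) | submod W) f (subl W) =
  f M + \sum_(k < ldim M) \sum_(N <- classes k) (nsub N^@x M)%:R * f N^@x.
Proof.
move=> sM hf; rewrite (bigD1 1%:M) ?submod1 //= -(hf _ _ (subl1 M)); congr (_ + _).
pose P (W : 'M_(ldim M)) := submod W && (W != 1%:M).
have lP W : P W -> (ldim (subl W) < ldim M)%N.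
  case/andP => sW W1; rewrite /= ltn_neqAle rank_leq_row andbT.
  apply: contraNneq W1 => /eqP fW; rewrite -(submodE sW).
  apply/eqP; rewrite -[RHS]genmx1; apply/eq_genmx/eqmxP.
  by rewrite submx1 sub1mx.
rewrite (@sum_over_classes x _ P (ldim M) (fun W => subl W)) //; last first.
  by move=> W /andP[sW _]; apply: sat_subl.
apply: eq_bigr => k _; have := classes_all k.
elim: (classes k) => [|N s IH]; first by rewrite !big_nil.
rewrite !big_cons /= => /andP[/andP[_ /eqP dN] /IH ->]; congr (_ + _).
rewrite nsubE natr_sum mulr_suml [RHS](bigD1 1%:M) ?submod1 //= (_ : liso _ _ = false).
  rewrite mul0r add0r; apply: eq_bigr => W _.
  by case: (boolP (liso _ _)) => [/hf ->|]; rewrite ?mul0r.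
apply: contraTF (ltn_ord k) => /liso_dim /=; rewrite mxrank1 dN => <-.
by rewrite ltnn.
Qed.

Lemma ok_ext x (M : lmod G K) : ok M^@x = ok M.
Proof. exact: sat_ext. Qed.

Lemma ratl_nhom (A B : lmod G K) : ratl (fun x => (nhom A^@x B^@x)%:R).
Proof.
apply: ratl_ext (ratl_qcard K (dhom A B)) => x.
by rewrite nhom_ext.
Qed.

Lemma ratl_class_sum (m : nat) (f : lmod G K -> extn K -> rat) :
  (forall k N, (k < m)%N -> ok N -> ldim N = k -> ratl (f N)) ->
  ratl (fun x => \sum_(k < m) \sum_(N <- classes k) f N x).
Proof.
move=> h; apply: ratl_sum => k _.
have := classes_all k; elim: (classes k) => [|N s IH] /=.
  by move=> _; apply: ratl_ext (ratl_nat K 0) => x; rewrite big_nil.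
case/andP => /andP[sN /eqP dN] /IH rs.
by apply: ratl_ext (ratl_add (h _ _ (ltn_ord k) sN dN) rs) => x; rewrite big_cons.
Qed.

(** Simultaneous induction on the dimension. Homs are injections plus maps through proper quotients,
    or surjections plus maps onto proper submodules; numbers of quotients or submodules of smaller
    type are surjection or injection counts divided by a smaller automorphism group. *)
Lemma counts_ratl (R : lmod G K) : ok R ->
  [/\ runit (fun x => (naut R^@x)%:R),
      forall M, ok M -> ratl (fun x => (ninj R^@x M^@x)%:R)
    & forall M, ok M -> ratl (fun x => (nepi M^@x R^@x)%:R)].
Proof.
have [m] := ubnP (ldim R); elim: m R => // m IH R lR sR.
have IHr k N : (k < ldim R)%N -> ok N -> ldim N = k ->
  [/\ runit (fun x => (naut N^@x)%:R),
      forall M, ok M -> ratl (fun x => (ninj N^@x M^@x)%:R)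
    & forall M, ok M -> ratl (fun x => (nepi M^@x N^@x)%:R)].
  by move=> lk sN dN; apply: IH => //; rewrite dN; apply: leq_trans lk _; rewrite -ltnS.
have hinj M : ok M -> ratl (fun x => (ninj R^@x M^@x)%:R).
  move=> sM.
  have h2 : ratl (fun x => \sum_(k < ldim R) \sum_(N <- classes k)
       (nquo N^@x R^@x)%:R * (ninj N^@x M^@x)%:R).
    apply: ratl_class_sum => k N lk sN dN; have [u i e] := IHr k N lk sN dN.
    apply: ratl_mul (i M sM); apply: (ratl_div u); apply: ratl_ext (e R sR) => x.
    by rewrite nepiE natrM mulrC.
  apply: ratl_ext (ratl_sub (ratl_nhom R M) h2) => x.
  apply/eqP; rewrite subr_eq nhom_ker natr_sum.
  rewrite (@sum_quol x R^@x (fun A => (ninj A M^@x)%:R)) ?ok_ext //.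
  by move=> A B i; rewrite (ninj_iso i (liso_refl _)).
have hepi M : ok M -> ratl (fun x => (nepi M^@x R^@x)%:R).
  move=> sM.
  have h2 : ratl (fun x => \sum_(k < ldim R) \sum_(N <- classes k)
       (nsub N^@x R^@x)%:R * (nepi M^@x N^@x)%:R).
    apply: ratl_class_sum => k N lk sN dN; have [u i e] := IHr k N lk sN dN.
    apply: ratl_mul (e M sM); apply: (ratl_div u); apply: ratl_ext (i R sR) => x.
    by rewrite ninjE natrM mulrC.
  apply: ratl_ext (ratl_sub (ratl_nhom M R) h2) => x.
  apply/eqP; rewrite subr_eq nhom_im natr_sum.
  rewrite (@sum_subl x R^@x (fun A => (nepi M^@x A)%:R)) ?ok_ext //.
  by move=> A B i; rewrite (nepi_iso (liso_refl _) i).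
(* The constants come from [naut_bound]: |End| is [q ^ dhom R R], and a fraction of at most
   [ldim R / q] of it is singular. *)
split=> //; apply: (@runit_asymptotic _ _ (dhom R R) (ldim R)).
- exact: hinj R sR.
- by move=> x; rewrite pnatr_eq0 -lt0n naut_gt0.
move=> x; have := naut_bound R^@x; rewrite nhom_ext -/(qcard x) /=.
have le : (naut R^@x <= qcard x ^ dhom R R)%N.
  rewrite -(nhom_ext (emap x)); apply/subset_leq_card/subsetP => f.
  by rewrite !inE => /andP[].
rewrite distrC ger0_norm ?subr_ge0 ?ler_nat // -natrB // -natrM ler_nat.
by rewrite -/(efield x).
Qed.

Lemma ratl_nsub (Y M : lmod G K) : ok Y -> ok M -> ratl (fun x => (nsub Y^@x M^@x)%:R).
Proof.
move=> sY sM; have [u i _] := counts_ratl sY.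
by apply: (ratl_div u); apply: ratl_ext (i M sM) => x; rewrite ninjE natrM mulrC.
Qed.

End Extension.
End Classes.

(** * Good functions *)

Section HallFunctions.
Variables (G : finType) (rels : seq (seq (seq G) * seq (seq G))) (K : finFieldType).
Local Notation ok M := (sat rels M).
Local Notation classes := (classes rels K).
Hypothesis descent : forall (x : extn K) (X : lmod G (efield x)), ok X ->
  exists M : lmod G K, ok M /\ liso X (lext (emap x) M).
Implicit Type x : extn K.

Notation "M ^@ x" := (lext (emap x) M) (at level 8, x at level 7, format "M ^@ x").

Lemma natr_count (T : Type) (s : seq T) (p : pred T) :
  (count p s)%:R = \sum_(i <- s) (p i)%:R :> rat.
Proof.
by rewrite -sum1_count natr_sum big_mkcond; apply: eq_bigr => i _; case: (p i).
Qed.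

Definition cfun := forall x, lmod G (efield x) -> rat.
Implicit Types (phi psi : cfun).

Definition cinv phi := forall x (A B : lmod G (efield x)), liso A B -> phi x A = phi x B.

Definition hsum phi (Y M : lmod G K) x : rat :=
  \sum_(U : 'M_(ldim M^@x) | submod U) (liso (subl U) Y^@x)%:R * phi x (quol U).

Definition good phi :=
  cinv phi /\ forall Y M, ok Y -> ok M -> ratl (hsum phi Y M).

(** The Hall product of two functions, the first evaluated at the quotient. *)
Definition conv phi psi : cfun := fun x X =>
  \sum_(U : 'M_(ldim X) | submod U) phi x (quol U) * psi x (subl U).

Arguments conv : clear implicits.

Lemma cinv_conv phi psi : cinv phi -> cinv psi -> cinv (conv phi psi).
Proof.
move=> iphi ipsi x A B iAB.
apply: (@sum_submod_iso _ _ _ (fun A B => phi x B * psi x A)) => //.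
by move=> C C' D D' iC iD; rewrite (iphi _ _ _ iD) (ipsi _ _ _ iC).
Qed.

(** Chains [U <= W] with [U] isomorphic to [Y] are counted in both orders. The sum over [U] depends
    only on the class [N] of [W], so [hsum] behaves like a matrix product. *)
Lemma hsum_conv phi psi Y M x : cinv phi -> cinv psi -> ok Y -> ok M ->
  hsum (conv phi psi) Y M x =
  \sum_(k < (ldim M).+1) \sum_(N <- classes k) hsum phi N M x * hsum psi Y N x.
Proof.
move=> iphi ipsi sY sM.
have sMx : ok M^@x by rewrite ok_ext.
pose H (Z : lmod G (efield x)) :=
  \sum_(U : 'M_(ldim Z) | submod U) (liso (subl U) Y^@x)%:R * psi x (quol U).
have invH (A B : lmod G (efield x)) : liso A B -> H A = H B.
  move=> iAB; apply: (@sum_submod_iso _ _ _ (fun A B => (liso A Y^@x)%:R * psi x B)) => //.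
  by move=> C C' D D' iC iD; rewrite (liso_ltrans iC) (ipsi _ _ _ iD).
transitivity (\sum_(W : 'M_(ldim M^@x) | submod W) phi x (quol W) * H (subl W)).
  rewrite /hsum /conv.
  transitivity (\sum_(U : 'M_(ldim M^@x) | submod U) \sum_(W : 'M_(ldim M^@x) | submod W && (U <= W)%MS)
     (liso (subl U) Y^@x)%:R * (phi x (quol W) * psi x (quol (M := subl W) (relmx U W)))).
    apply: eq_bigr => U sU; rewrite -big_distrr /=; congr (_ * _).
    rewrite (@chain_quol _ _ rat (fun A B => phi x B * psi x A) M^@x U) //.
    by move=> C C' D D' iC iD; rewrite (iphi _ _ _ iD) (ipsi _ _ _ iC).
  transitivity (\sum_(W : 'M_(ldim M^@x) | submod W) \sum_(U : 'M_(ldim M^@x) | submod U && (U <= W)%MS)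
     phi x (quol W) * ((liso (subl U) Y^@x)%:R * psi x (quol (M := subl W) (relmx U W)))).
    rewrite (exchange_big_dep (fun W => submod W)) /=; last by move=> U W _ /andP[].
    apply: eq_bigr => W sW; apply: eq_big => [U|U _]; first by rewrite sW.
    by rewrite mulrCA.
  apply: eq_bigr => W sW; rewrite -big_distrr /=; congr (_ * _); apply/esym.
  rewrite /H (@chain_subl _ _ rat (fun A B => (liso A Y^@x)%:R * psi x B) M^@x W) //.
  by move=> C C' D D' iC iD; rewrite (liso_ltrans iC) (ipsi _ _ _ iD).
rewrite (@sum_over_classes _ rels _ descent x _ _ (ldim M).+1 (fun W : 'M_(ldim M^@x) => subl W)); first last.
- by move=> W _; rewrite ltnS /= rank_leq_row.
- by move=> W sW; apply: sat_subl.
apply: eq_bigr => k _; apply: eq_bigr => N _.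
rewrite /hsum big_distrl /=; apply: eq_bigr => W sW.
case: (boolP (liso (subl _) _)) => [i|_]; last by rewrite !mul0r.
by rewrite !mul1r (invH _ _ i).
Qed.

Lemma good_conv phi psi : good phi -> good psi -> good (conv phi psi).
Proof.
move=> [iphi rphi] [ipsi rpsi]; split; first exact: cinv_conv.
move=> Y M sY sM; apply: (@ratl_ext _ (fun x => \sum_(k < (ldim M).+1)
    \sum_(N <- classes k) hsum phi N M x * hsum psi Y N x)).
  by move=> x; rewrite hsum_conv.
apply: ratl_class_sum => k N _ sN _.
exact: ratl_mul (rphi _ _ sN sM) (rpsi _ _ sY sN).
Qed.

Lemma good_ext phi psi : cinv psi ->
  (forall x X, ok X -> phi x X = psi x X) -> good phi -> good psi.
Proof.
move=> ipsi e [_ rphi]; split=> // Y M sY sM; apply: ratl_ext (rphi Y M sY sM) => x.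
by apply: eq_bigr => U sU; rewrite e // sat_quol ?ok_ext.
Qed.

Lemma good_add phi psi : good phi -> good psi -> good (fun x X => phi x X + psi x X).
Proof.
move=> [iphi rphi] [ipsi rpsi]; split.
  by move=> x A B i; rewrite (iphi _ _ _ i) (ipsi _ _ _ i).
move=> Y M sY sM; apply: ratl_ext (ratl_add (rphi Y M sY sM) (rpsi Y M sY sM)) => x.
by rewrite /hsum -big_split; apply: eq_bigr => U _; rewrite mulrDr.
Qed.

Lemma good_scale (c : extn K -> rat) phi : ratl c -> good phi -> good (fun x X => c x * phi x X).
Proof.
move=> rc [iphi rphi]; split; first by move=> x A B i; rewrite (iphi _ _ _ i).
move=> Y M sY sM; apply: ratl_ext (ratl_mul rc (rphi Y M sY sM)) => x.
by rewrite /hsum big_distrr; apply: eq_bigr => U _; rewrite mulrCA.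
Qed.

Lemma good_sub phi psi : good phi -> good psi -> good (fun x X => phi x X - psi x X).
Proof.
move=> gphi gpsi; have r := ratl_int K (- 1).
have := good_add gphi (good_scale r gpsi); apply: good_ext.
  move=> x A B i; have [iphi _] := gphi; have [ipsi _] := gpsi.
  by rewrite (iphi _ _ _ i) (ipsi _ _ _ i).
by move=> x X _; rewrite mulN1r.
Qed.

Lemma good_div (c : extn K -> rat) phi : runit c -> cinv phi ->
  good (fun x X => c x * phi x X) -> good phi.
Proof.
move=> uc iphi [_ r]; split=> // Y M sY sM; apply: (ratl_div uc).
apply: ratl_ext (r Y M sY sM) => x.
by rewrite /hsum big_distrr; apply: eq_bigr => U _; rewrite mulrCA.
Qed.

Lemma hsum_one Y M x : hsum (fun x X => 1) Y M x = (nsub Y^@x M^@x)%:R.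
Proof. by rewrite nsubE natr_sum; apply: eq_bigr => U _; rewrite mulr1. Qed.

Lemma good_one : good (fun x X => 1).
Proof.
split=> // Y M sY sM; apply: ratl_ext (ratl_nsub descent sY sM) => x.
by rewrite hsum_one.
Qed.

(* [chi (M / U)] is determined by [M] and the isomorphism class of [U]; this is
   how functions of the dimension vector enter. *)
Definition dimdet (chi : forall x, lmod G (efield x) -> bool) :=
  forall Y M, ok M -> exists b : bool, forall x (U : 'M_(ldim M^@x)),
    submod U -> liso (subl U) Y^@x -> chi x (quol U) = b.

Lemma good_dimdet chi phi : (forall x A B, liso A B -> chi x A = chi x B) ->
  dimdet chi -> good phi -> good (fun x X => (chi x X)%:R * phi x X).
Proof.
move=> ichi dchi [iphi rphi]; split.
  by move=> x A B i; rewrite (ichi _ _ _ i) (iphi _ _ _ i).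
move=> Y M sY sM; have [b hb] := dchi Y M sM.
apply: ratl_ext (ratl_mul (ratl_nat K b) (rphi Y M sY sM)) => x.
rewrite /hsum big_distrr; apply: eq_bigr => U sU /=.
case: (boolP (liso _ _)) => [i|_]; last by rewrite !mul0r mulr0.
by rewrite (hb x U sU i) !mul1r.
Qed.

Definition ind (X : lmod G K) : cfun := fun x Z => (liso Z X^@x)%:R.

Arguments ind : clear implicits.

Lemma cinv_ind X : cinv (ind X).
Proof. by move=> x A B i; rewrite /ind (liso_ltrans i). Qed.

Definition hallF (A B N : lmod G K) x : rat := conv (ind A) (ind B) x N^@x.

Lemma hallF_hsum A B N x : hallF A B N x = hsum (ind A) B N x.
Proof. by apply: eq_bigr => U _; rewrite mulrC. Qed.

(** The product in the Hall algebra, expanded in classes with Hall numbers as structure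
    constants. *)
Lemma conv_ind A B x (Z : lmod G (efield x)) : ok A -> ok B -> ok Z ->
  conv (ind A) (ind B) x Z =
  \sum_(N <- classes (ldim A + ldim B)) hallF A B N x * ind N x Z.
Proof.
move=> sA sB sZ.
have iAB : cinv (conv (ind A) (ind B)) by apply: cinv_conv; apply: cinv_ind.
have [d|d] := eqVneq (ldim Z) (ldim A + ldim B)%N; last first.
  rewrite [LHS]big1.
    have := classes_all rels K (ldim A + ldim B).
    elim: (classes _) => [|N s IH]; first by rewrite big_nil.
    rewrite big_cons /= => /andP[/andP[_ /eqP dN] /IH <-]; rewrite addr0 /ind.
    case: (boolP (liso _ _)) => [/liso_dim /= e|]; last by rewrite mulr0.
    by rewrite e dN eqxx in d.
  move=> U sU; rewrite /ind.
  case: (boolP (liso _ _)) => [/liso_dim /= d1|]; last by rewrite mul0r.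
  case: (boolP (liso _ _)) => [/liso_dim /= d2|]; last by rewrite mulr0.
  by case/eqP: d; rewrite -d1 -d2 mxrank_coker subnK // rank_leq_row.
have := classes_ext descent sZ; rewrite d => c1.
transitivity (\sum_(N <- classes (ldim A + ldim B)) conv (ind A) (ind B) x Z * ind N x Z).
  rewrite -big_distrr /= /ind -[LHS]mulr1; congr (_ * _).
  rewrite -(natr_count _ (fun N => liso Z N^@x)).
  by rewrite c1.
apply: eq_bigr => N _; rewrite /ind.
case: (boolP (liso _ _)) => [i|_]; last by rewrite !mulr0.
by rewrite !mulr1 (iAB _ _ _ i).
Qed.

Lemma hallF_card A B N x : hallF A B N x =
  (nhall A^@x B^@x N^@x)%:R.
Proof.
rewrite /nhall -sum1dep_card big_mkcondr natr_sum /hallF /conv; apply: eq_bigr => U _ /=.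
by rewrite /ind andbC; case: liso; case: liso; rewrite /= ?mulr0 ?mul0r ?mulr1.
Qed.

Lemma hallF_iso A B N N' x : liso N N' -> hallF A B N x = hallF A B N' x.
Proof.
move=> i; have iAB : cinv (conv (ind A) (ind B)) by apply: cinv_conv; apply: cinv_ind.
exact: iAB _ _ _ (liso_ext _ i).
Qed.

Lemma hallF_exact A B N x : hallF A B N x != 0 ->
  exists (g : 'M[efield x]_(ldim B^@x, ldim N^@x)) (h : 'M_(ldim N^@x, ldim A^@x)),
    [/\ lhom g, row_free g, lhom h, row_full h & (kermx h :=: g)%MS].
Proof.
rewrite hallF_card pnatr_eq0 -lt0n => /card_gt0P[U]; rewrite inE => /and3P[sU iB iA].
move: iB; rewrite liso_sym => /lisoP[t [t' [ht ht' e e']]].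
case/lisoP: iA => [s [s' [hs hs' a a']]].
exists (t *m row_base U), (proj U *m s); split.
- exact: lhom_comp ht (incl_hom sU).
- by rewrite /row_free mxrankMfree ?row_base_free //; exact: row_free_inv e.
- exact: lhom_comp (proj_hom sU) hs.
- by apply: row_full_mul; [exact: (proj_full (M := N^@x)) | exact: row_full_inv a'].
apply: eqmx_sub => m y; rewrite sub_kermx_comp sub_kermx (mulmx_free_eq0 _ (row_free_inv a)).
rewrite (proj_ker (M := N^@x)) (eqmxMfull _ (row_full_inv e')).
by rewrite (eq_row_base U).
Qed.

(* Non-split extensions of [A] by [B] are less degenerate than [A + B]. *)
Lemma hallF_lt A B N x : hallF A B N x != 0 -> ~~ liso N (dsuml A B) ->
  (dhom N N < dhom (dsuml A B) (dsuml A B))%N.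
Proof.
move=> /hallF_exact[g [h [hg fg hh fh gh]]] ni.
have ni' : ~~ liso N^@x (dsuml A^@x B^@x).
  by rewrite -(liso_rtrans _ (lext_dsuml (emap x) A B)) liso_descent.
have := nhom_exact_lt hg fg hh fh gh ni'.
rewrite -(nhom_iso (lext_dsuml (emap x) A B) (lext_dsuml (emap x) A B)) !nhom_ext.
by rewrite ltn_exp2l // finNzRing_gt1.
Qed.

Lemma runit_split A B : ok A -> ok B -> runit (hallF A B (dsuml A B)).
Proof.
move=> sA sB.
have [uA _ _] := counts_ratl descent sA; have [uB _ _] := counts_ratl descent sB.
have sAB : ok (dsuml A B) by rewrite sat_dsuml sA sB.
have [uAB _ _] := counts_ratl descent sAB.
apply: (@runit_quot _ _ (fun x => (naut A^@x)%:R * (naut B^@x)%:R * (qcard x ^ dhom A B)%:R)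
  (fun x => (naut (dsuml A B)^@x)%:R)) => //.
  by apply: runit_mul (runit_qcard _ _); apply: runit_mul.
move=> x; rewrite hallF_card -(nhom_ext (emap x)) -!natrM; congr (_ %:R).
by apply: hall_split; apply: lext_dsuml.
Qed.

(** The product of the two indicators contains that of the direct sum with a coefficient that may be
    divided by; all its other terms have a smaller endomorphism ring. *)
Lemma good_dsuml A B : ok A -> ok B -> good (ind A) -> good (ind B) ->
  (forall N, ok N -> ldim N = (ldim A + ldim B)%N ->
     (dhom N N < dhom (dsuml A B) (dsuml A B))%N -> good (ind N)) ->
  good (ind (dsuml A B)).
Proof.
move=> sA sB gA gB gN; set X := dsuml A B.
have sX : ok X by rewrite sat_dsuml sA sB.
apply: (good_div (runit_split sA sB)); first exact: cinv_ind.
pose S := classes (ldim A + ldim B).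
pose phi : cfun := fun x Z => \sum_(N <- S | (dhom N N < dhom X X)%N) hallF A B N x * ind N x Z.
have gphi : good phi.
  rewrite /phi /S; have := classes_all rels K (ldim A + ldim B).
  elim: (classes _) => [|N s IH] /=.
    move=> _; apply: good_ext (good_scale (ratl_nat K 0) good_one) => //.
      by move=> x C D _; rewrite !big_nil.
    by move=> x C _; rewrite big_nil mul0r.
  case/andP => /andP[sN /eqP dN] /IH gs.
  have [lt|nlt] := boolP (dhom N N < dhom X X)%N; last first.
    apply: good_ext gs; last by move=> x C _; rewrite big_cons (negPf nlt).
    move=> x C D i; apply: eq_bigr => L _; by rewrite (cinv_ind _ i).
  have rN : ratl (hallF A B N).
    by case: gA => _ /(_ B N sB sN); apply: ratl_ext => x; rewrite hallF_hsum.
  apply: good_ext (good_add (good_scale rN (gN N sN dN lt)) gs).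
    move=> x C D i; apply: eq_bigr => L _; by rewrite (cinv_ind _ i).
  by move=> x C _; rewrite big_cons lt.
apply: good_ext (good_sub (good_conv gA gB) gphi).
  by move=> x C D i; rewrite (cinv_ind _ i).
move=> x Z sZ; rewrite conv_ind // /phi -/S.
(* After the subtraction only terms without smaller [dhom] remain; by [hallF_lt] only the class of
   the direct sum can contribute. *)
rewrite [X in X - _](bigID (fun N => dhom N N < dhom X X)%N) /= addrAC subrr add0r.
transitivity (\sum_(N <- S) hallF A B X x * ((liso X N)%:R * ind X x Z)).
  rewrite [LHS]big_mkcond; apply: eq_bigr => N _.
  have [i|ni] := boolP (liso X N).
    rewrite (_ : (dhom N N < _)%N = false) /=; last first.
      apply/negbTE; rewrite -leqNgt.
      have := nhom_iso i i; rewrite !nhomE => /eqP.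
      by rewrite eqn_exp2l ?finNzRing_gt1 // => /eqP ->.
    rewrite mul1r (hallF_iso A B x i); congr (_ * _).
    by rewrite /ind (liso_rtrans _ (liso_ext (emap x) i)).
  rewrite mul0r mulr0; case: ifP => // nlt.
  have [->|h] := eqVneq (hallF A B N x) 0; first by rewrite mul0r.
  by case/negP: nlt; apply: hallF_lt h _; rewrite liso_sym.
rewrite -big_distrr -big_distrl /=; congr (_ * _).
rewrite -[RHS]mul1r; congr (_ * _).
have := classes_count sX; rewrite -/S => c1.
by rewrite -(natr_count _ (liso X)) c1.
Qed.

(* Guo-Peng: it is enough to treat quotients [X] in a class through which
   every module splits. *)
Lemma good_all (P : lmod G K -> Prop) :
  (forall Z, P Z -> [/\ ok Z, (0 < ldim Z)%N & good (ind Z)]) ->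
  (forall X, ok X -> (0 < ldim X)%N ->
     exists Z W, [/\ P Z, ok W & liso X (dsuml Z W)]) ->
  forall X, ok X -> good (ind X).
Proof.
move=> gP splitP X.
have ind_iso A B : liso A B -> good (ind A) -> good (ind B).
  move=> i; apply: good_ext; first exact: cinv_ind.
  by move=> x C _; rewrite /ind (liso_rtrans _ (liso_ext (emap x) i)).
(* The outer induction on dimension handles the complement [W], the inner one on [dhom X X] the
   nonsplit extensions of the same dimension. *)
have [m] := ubnP (ldim X); elim: m X => // m IH X.
have [d] := ubnP (dhom X X); elim: d X => // d IHd X ld lX sX.
have [X0|X0] := posnP (ldim X).
  have gd : dimdet (fun x Z => ldim Z == 0).
    move=> Y M sM; exists (ldim M == ldim Y) => x U sU /liso_dim /= <-.
    by rewrite mxrank_coker subn_eq0 eqn_leq rank_leq_row andbT.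
  apply: good_ext (good_dimdet _ gd good_one).
  - exact: cinv_ind.
  - move=> x Z sZ; rewrite mulr1 /ind; congr ((nat_of_bool _)%:R).
    apply/eqP/idP => [Z0|/liso_dim /= -> //].
    apply: (@liso_free _ _ _ _ 0); rewrite ?lhom0 //=; last by rewrite X0 Z0.
    by rewrite /row_free mxrank0 Z0.
  - by move=> x A B i; rewrite (liso_dim i).
have [Z [W [PZ sW i]]] := splitP X sX X0; have [sZ Z0 gZ] := gP Z PZ.
have dX : ldim X = (ldim Z + ldim W)%N := liso_dim i.
have [W0|W0] := posnP (ldim W).
  apply: ind_iso gZ; rewrite liso_sym; apply: liso_trans i _.
  rewrite liso_sym; apply: (@liso_free _ _ Z (dsuml Z W) (row_mx 1%:M 0)).
  - by rewrite lhom_row lhom1 lhom0.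
  - by apply/row_freeP; exists (col_mx 1%:M 0); rewrite mul_row_col mulmx1 mul0mx addr0.
  - by rewrite /= W0 addn0.
apply: (ind_iso (dsuml Z W)); first by rewrite liso_sym.
apply: good_dsuml => //.
  apply: IH => //; rewrite -ltnS; apply: leq_trans lX.
  by rewrite dX ltnS -add1n leq_add2r.
move=> N sN dN lt; apply: IHd => //; last by rewrite dN -dX.
apply: leq_trans lt _; rewrite -ltnS; apply: leq_trans ld.
have := nhom_iso i i; rewrite !nhomE => /eqP.
by rewrite eqn_exp2l ?finNzRing_gt1 // => /eqP ->.
Qed.

End HallFunctions.
Arguments conv {G K} phi psi x X.
Arguments ind {G K} X x Z.

(** * Dimension vectors and torsion pairs *)

Section DimensionVectors.
Variable N : nat.
Local Notation lmodN := (lmod (lgen N)).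

Definition vdim (F : finFieldType) (X : lmodN F) (l : 'I_N.+1) := \rank (lop X (inl l)).

(* The torsion pair of the modules supported on the vertices below [i]. *)
Definition tor (i : nat) (F : finFieldType) (X : lmodN F) :=
  [forall l : 'I_N.+1, (i <= l)%N ==> (vdim X l == 0)].
Definition tf (i : nat) (F : finFieldType) (X : lmodN F) :=
  [forall U : 'M_(ldim X), submod U && tor i (subl U) ==> (U == 0)].

Section OneField.
Variable F : finFieldType.
Implicit Types (X A B : lmodN F).

Lemma vdim_subl X (U : 'M_(ldim X)) l : submod U ->
  vdim (subl U) l = \rank (U *m lop X (inl l)).
Proof.
move=> sU; transitivity (\rank (row_base U *m lop X (inl l))); last first.
  by rewrite (eqmxMr _ (eq_row_base U)).
have /= <- := lhomP _ (incl_hom sU) (inl l).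
by rewrite mxrankMfree // row_base_free.
Qed.

Lemma vdim_quol X (U : 'M_(ldim X)) l : submod U ->
  vdim (quol U) l = \rank (lop X (inl l) *m proj U).
Proof.
move=> sU; rewrite (lhomP _ (proj_hom sU) (inl l)) /vdim.
by rewrite (eqmxMfull _ (proj_full U)).
Qed.

Lemma lsat_idem X l : lsat X -> lop X (inl l) *m lop X (inl l) = lop X (inl l).
Proof. by case/lsatP => -> _ _ _ _; rewrite eqxx. Qed.

Lemma vdim_exact X (U : 'M_(ldim X)) l : lsat X -> submod U ->
  vdim X l = (vdim (subl U) l + vdim (quol U) l)%N.
Proof.
move=> sX sU; rewrite vdim_subl // vdim_quol // addnC /vdim.
rewrite -(mxrank_mul_ker (lop X (inl l)) (proj U)); congr (_ + _)%N.
have e := lsat_idem l sX; apply: eqmx_rank; apply/andP; split.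
  apply: (@submx_trans _ _ _ _ _ _ ((lop X (inl l) :&: kermx (proj U)) *m lop X (inl l))%MS).
    have /submxP[D eD] : (lop X (inl l) :&: kermx (proj U) <= lop X (inl l))%MS := capmxSl _ _.
    by rewrite {2}eD -mulmxA e -eD.
  by rewrite submxMr // -(kermx_proj U) capmxSr.
by rewrite sub_capmx submxMl (kermx_proj U) submodP.
Qed.

Lemma vdim_iso A B l : liso A B -> vdim A l = vdim B l.
Proof.
case/lisoP => f [f' [/lhomP hf _ e e']].
transitivity (\rank (lop A (inl l) *m f)).
  by rewrite mxrankMfree //; exact: row_free_inv e.
by rewrite hf (eqmxMfull _ (row_full_inv e')).
Qed.

Lemma vdim_dsuml A B l : vdim (dsuml A B) l = (vdim A l + vdim B l)%N.
Proof. exact: rank_diag_block_mx. Qed.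

Lemma tor_iso i A B : liso A B -> tor i A = tor i B.
Proof.
by move=> h; apply: eq_forallb => l; rewrite (vdim_iso _ h).
Qed.

Lemma tor_sublP i X (U : 'M_(ldim X)) : submod U ->
  reflect (forall l : 'I_N.+1, (i <= l)%N -> U *m lop X (inl l) = 0) (tor i (subl U)).
Proof.
move=> sU; apply: (iffP forallP) => h l.
  move=> il; have := h l; rewrite il /= vdim_subl // mxrank_eq0 => /eqP //.
by apply/implyP => il; rewrite vdim_subl // h // mxrank0.
Qed.

Lemma tfP i X : reflect (forall U : 'M_(ldim X), submod U -> tor i (subl U) -> U = 0) (tf i X).
Proof.
apply: (iffP forallP) => h U; last by apply/implyP => /andP[sU tU]; rewrite (h U) // eqxx.
by move=> sU tU; have := h U; rewrite sU tU => /eqP.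
Qed.

Lemma tf_free i A B (f : 'M_(ldim A, ldim B)) :
  lhom f -> row_free f -> tf i B -> tf i A.
Proof.
move=> hf ff /tfP tB; apply/tfP => U sU tU.
have [s iU] := subl_mono sU hf ff.
have := tB _ s; rewrite -(tor_iso i iU) => /(_ tU) /eqP.
by rewrite -submx0 genmxE submx0 mulmx_free_eq0 // => /eqP.
Qed.

Lemma tf_iso i A B : liso A B -> tf i A = tf i B.
Proof.
move=> /lisoP[f [f' [hf hf' e e']]]; apply/idP/idP.
  exact: tf_free hf' (row_free_inv e').
exact: tf_free hf (row_free_inv e).
Qed.

Lemma tf_neq0 i X : tf i X -> (0 < ldim X)%N ->
  exists2 l : 'I_N.+1, (i <= l)%N & (0 < vdim X l)%N.
Proof.
move=> /tfP tX X0.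
have [/existsP[l /andP[il lX]]|] := boolP [exists l : 'I_N.+1, (i <= l)%N && (0 < vdim X l)%N].
  by exists l.
rewrite negb_exists => /forallP h.
have /tX : submod (M := X) 1%:M := submod1 X.
rewrite -(tor_iso i (subl1 X)) => h1.
have : (1%:M : 'M[F]_(ldim X)) = 0.
  apply: h1; apply/forallP => l; apply/implyP => il.
  by have := h l; rewrite il /= -eqn0Ngt.
by move/(congr1 mxrank); rewrite mxrank1 mxrank0 => e; rewrite e in X0.
Qed.

Lemma submod_adds X (U W : 'M_(ldim X)) : submod U -> submod W ->
  submod (M := X) <<(U + W)%MS>>%MS.
Proof.
move=> sU sW; apply: submod_gen => g; rewrite (addsmxMr U W (lop X g)).
by apply: addsmxS; apply: submodP.
Qed.

(* Every module has exactly one torsion submodule with torsion-free quotient. *)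
Lemma torsion_sum i X : lsat X ->
  \sum_(U : 'M_(ldim X) | submod U) (tf i (quol U))%:R * (tor i (subl U))%:R = 1 :> rat.
Proof.
move=> sX.
pose P (U : 'M_(ldim X)) := submod U && tor i (subl U).
have P0 : P 0.
  rewrite /P submod0; apply/tor_sublP => [|l _]; first exact: submod0.
  by rewrite mul0mx.
(* Sums of torsion submodules are torsion, so one of maximal rank contains them all. *)
case: (arg_maxnP (fun U : 'M_(ldim X) => \rank U) P0) => T /andP[sT tT] maxT.
have leT U : submod U -> tor i (subl U) -> (U <= T)%MS.
  move=> sU tU; have sS := submod_adds sT sU.
  have tS : tor i (subl (M := X) <<(T + U)%MS>>%MS).
    apply/tor_sublP => // l il; apply/eqP; rewrite -submx0 (eqmxMr _ (genmxE _)).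
    rewrite addsmxMr addsmx_sub !submx0.
    by rewrite (elimT (tor_sublP i sT) tT) // (elimT (tor_sublP i sU) tU) // eqxx.
  have := maxT <<(T + U)%MS>>%MS; rewrite /P sS tS genmxE => /(_ isT) le.
  apply: submx_trans (addsmxSr T U) _.
  by move: le; rewrite /geq /= (geq_leqif (mxrank_leqif_sup (addsmxSl T U))).
have tfT : tf i (quol T).
  apply/tfP => W sW tW.
  (* The preimage of a torsion submodule of the quotient is an extension of torsion modules, hence
     torsion and inside [T]. *)
  pose V : 'M_(ldim X) := <<kermx (proj T *m proj (M := quol T) W)>>%MS.
  have sV : submod V := submod_ker (lhom_comp (proj_hom sT) (proj_hom sW)).
  have VE m (y : 'M_(m, ldim X)) : (y <= V)%MS = (y *m proj T <= W)%MS.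
    by rewrite genmxE sub_kermx_comp (kermx_proj (M := quol T)).
  have tV : tor i (subl V).
    apply/tor_sublP => // l il.
    have h : (V *m lop X (inl l) <= T)%MS.
      rewrite -proj_ker -mulmxA; have /= -> := lhomP _ (proj_hom sT) (inl l).
      rewrite mulmxA -submx0.
      have tWl := elimT (tor_sublP i sW) tW.
      apply: (@submx_trans _ _ _ _ _ _ (W *m lop (quol T) (inl l))%R).
        by apply: submxMr; rewrite -VE.
      by rewrite (tWl l il).
    rewrite -(lsat_idem l sX) mulmxA; apply/eqP; rewrite -submx0.
    apply: submx_trans (submxMr _ h) _.
    by rewrite (elimT (tor_sublP i sT) tT).
  have VT : (V <= T)%MS := leT V sV tV.
  apply/eqP; rewrite -submx0 -[X in (X <= _)%MS]mulmx1 -(mulVpmx (proj_full T)) mulmxA.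
  rewrite submx0 (proj_ker (M := X)); apply: submx_trans VT.
  by rewrite VE -mulmxA (mulVpmx (proj_full T)) mulmx1.
rewrite (bigD1 T) //= tfT tT mulr1 big1 ?addr0 // => U /andP[sU UT].
case: (boolP (tor i (subl U))) => [tU|]; last by rewrite mulr0.
case: (boolP (tf i (quol U))) => [tfU|]; last by rewrite mul0r.
case/eqP: UT; apply: submod_eq => //; apply/eqmxP; rewrite leT //=.
(* Uniqueness: the image of [T] modulo [U] is torsion in a torsion-free module, so [T] lies in
   [U]. *)
have hf := lhom_comp (incl_hom sT) (proj_hom sU).
have sW := submod_im hf.
have : <<row_base T *m proj U>>%MS = 0.
  apply: (elimT (tfP i (quol U)) tfU) => //; apply/tor_sublP => // l il.
  apply/eqP; rewrite -submx0 (eqmxMr _ (genmxE _)) submx0.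
  rewrite -mulmxA; have /= <- := lhomP _ (proj_hom sU) (inl l).
  have h : row_base T *m lop X (inl l) = 0.
    apply/eqP; rewrite -submx0 (eqmxMr _ (eq_row_base T)) submx0.
    by rewrite (elimT (tor_sublP i sT) tT).
  by rewrite (mulmxA (row_base T)) h mul0mx.
move/eqP; rewrite -submx0 genmxE submx0 (proj_ker (M := X)).
by rewrite eq_row_base.
Qed.

End OneField.

Section Good.
Variable K : finFieldType.
Implicit Type x : extn K.
Local Notation "M ^@ x" := (lext (emap x) M) (at level 8, x at level 7, format "M ^@ x").
Local Notation rels := (lrels N).
Local Notation good := (@good _ rels K).

Lemma vdim_ext x (M : lmodN K) l : vdim M^@x l = vdim M l.
Proof. exact: mxrank_map. Qed.

Lemma dimdet_vdim (p : {ffun 'I_N.+1 -> nat} -> bool) :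
  dimdet rels (fun x (X : lmodN (efield x)) => p [ffun l => vdim X l]).
Proof.
move=> Y M sM; exists (p [ffun l => (vdim M l - vdim Y l)%N]) => x U sU iU.
congr (p _); apply/ffunP => l; rewrite !ffunE.
have sMx : lsat M^@x by rewrite /lsat sat_ext.
have := vdim_exact l sMx sU; rewrite vdim_ext (vdim_iso l iU) vdim_ext => ->.
by rewrite addKn.
Qed.

Lemma good_vdim (p : {ffun 'I_N.+1 -> nat} -> bool) (phi : cfun (lgen N) K) :
  good phi -> good (fun x (X : lmodN (efield x)) => (p [ffun l => vdim X l])%:R * phi x X).
Proof.
apply: good_dimdet; last exact: dimdet_vdim.
move=> x A B i; congr (p _); apply/ffunP => l; rewrite !ffunE; exact: vdim_iso.
Qed.

Definition torI i : cfun (lgen N) K := fun x X => (tor i X)%:R.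

Lemma good_torI i : good (torI i).
Proof.
pose p (v : {ffun 'I_N.+1 -> nat}) := [forall l : 'I_N.+1, (i <= l)%N ==> (v l == 0%N)].
have := good_vdim p (good_one (@string_descent N K)); apply: good_ext.
  by move=> x A B h; rewrite /torI (tor_iso i h).
move=> x X _; rewrite mulr1 /torI /tor /p; congr ((nat_of_bool _)%:R).
by apply: eq_forallb => l; rewrite ffunE.
Qed.

Lemma hsum_small (phi : cfun (lgen N) K) (Y M : lmodN K) x : (ldim M < ldim Y)%N ->
  hsum phi Y M x = 0.
Proof.
move=> lt; apply: big1 => U sU.
case: (boolP (liso _ _)) => [/liso_dim /= e|_]; last by rewrite mul0r.
by move: lt; rewrite -e ltnNge rank_leq_row.
Qed.

Lemma hsum_torI_top i (Y M : lmodN K) x : ldim M = ldim Y ->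
  hsum (torI i) Y M x = (liso M Y)%:R.
Proof.
move=> d; rewrite /hsum (bigD1 1%:M) ?submod1 //= big1 ?addr0 => [|U /andP[sU U1]].
  rewrite -(liso_ltrans (subl1 M^@x)) liso_descent.
  rewrite /torI (_ : tor i _ = true) ?mulr1 //.
  apply/forallP => l; apply/implyP => _; rewrite -leqn0.
  by apply: leq_trans (rank_leq_row _) _; rewrite /= mxrank_coker mxrank1 subnn.
case: (boolP (liso _ _)) => [/liso_dim /= e|_]; last by rewrite mul0r.
case/eqP: U1; rewrite -(submodE sU) -[RHS]genmx1; apply/eq_genmx/eqmxP.
by rewrite submx1 sub1mx /row_full e -d eqxx.
Qed.

Definition tfI i (chi : cfun (lgen N) K) : cfun (lgen N) K :=
  fun x X => (tf i X)%:R * chi x X.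

(** As each module has a unique torsion part and [chi] ignores it, [chi] is the convolution of
    [tfI i chi] with [torI i]. On the level of [hsum] this is a system triangular in the dimension
    with diagonal 1, solved by descending induction on [ldim Y]. *)
Lemma good_tfI i (chi : cfun (lgen N) K) : good chi ->
  (forall x (X : lmodN (efield x)) (U : 'M_(ldim X)), lsat X -> submod U ->
     tor i (subl U) -> chi x X = chi x (quol U)) ->
  good (tfI i chi).
Proof.
move=> gchi hchi; have [ichi rchi] := gchi.
have itf : cinv (tfI i chi).
  by move=> x A B h; rewrite /tfI (tf_iso i h) (ichi _ _ _ h).
have [itor rtor] := good_torI i.
have econv x (X : lmodN (efield x)) : lsat X -> chi x X = conv (tfI i chi) (torI i) x X.
  move=> sX; rewrite /conv -[LHS]mul1r -(torsion_sum i sX) big_distrl /=.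
  apply: eq_bigr => U sU; rewrite /tfI /torI.
  case: (boolP (tor i (subl U))) => [tU|_]; last by rewrite !mulr0 mul0r.
  by rewrite !mulr1 (hchi x X U).
split=> // Y M; have [m] := ubnP (ldim M - ldim Y); elim: m Y => // m IH Y lY sY sM.
have [ltM|leM] := ltnP (ldim M) (ldim Y).
  by apply: ratl_ext (ratl_nat K 0) => x; rewrite hsum_small.
(* The part above the diagonal. Terms with [ldim L] below [ldim Y] vanish, and in equal dimension
   only the class of [Y] contributes. *)
pose R x := \sum_(k < (ldim M).+1) \sum_(L <- classes rels K k)
  (if (ldim Y < ldim L)%N then hsum (tfI i chi) L M x * hsum (torI i) Y L x else 0).
have rR : ratl R.
  apply: ratl_class_sum => k L lk sL dL.
  have [lt|_] := ltnP (ldim Y) (ldim L); last exact: ratl_nat K 0.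
  apply: ratl_mul (rtor _ _ sY sL); apply: IH => //.
  by move: lt lY lk; rewrite dL; lia.
apply: ratl_ext (ratl_sub (rchi Y M sY sM) rR) => x.
have -> : hsum chi Y M x = hsum (conv (tfI i chi) (torI i)) Y M x.
  apply: eq_bigr => U sU; congr (_ * _); apply: econv.
  by apply: sat_quol => //; rewrite sat_ext.
rewrite (hsum_conv (@string_descent N K)) // /R -sumrB.
have lt : (ldim Y < (ldim M).+1)%N by [].
rewrite (bigD1 (Ordinal lt)) //= [X in _ + X]big1 ?addr0 => [|k kY].
  rewrite -sumrB.
  transitivity (\sum_(L <- classes rels K (ldim Y)) hsum (tfI i chi) Y M x * (liso Y L)%:R).
    have := classes_all rels K (ldim Y); elim: (classes _ _ _) => [|L s IHs].
      by rewrite !big_nil.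
    rewrite !big_cons /= => /andP[/andP[_ /eqP dL] /IHs <-]; congr (_ + _).
    rewrite dL ltnn subr0 hsum_torI_top // liso_sym.
    case: (boolP (liso _ _)) => [h|_]; last by rewrite !mulr0.
    rewrite !mulr1; apply: eq_bigr => U _; congr (_ * _); congr ((nat_of_bool _)%:R).
    by apply: liso_rtrans; apply: liso_ext; rewrite liso_sym.
  by rewrite -big_distrr /= -natr_count classes_count // mulr1.
rewrite -sumrB; have := classes_all rels K k; elim: (classes _ _ _) => [|L s IHs].
  by rewrite big_nil.
rewrite big_cons /= => /andP[/andP[_ /eqP dL] /IHs ->]; rewrite addr0.
case: (ltnP (ldim Y)) => [_|le]; first by rewrite subrr.
rewrite dL in le; rewrite subr0 [X in _ * X]hsum_small ?mulr0 // dL ltn_neqAle le andbT.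
by apply: contraNneq kY => e; apply/eqP/val_inj; rewrite /= e.
Qed.

End Good.
End DimensionVectors.

(** * Indicator functions of the indecomposable modules *)

Section StringModules.
Variable N : nat.
Local Notation lmodN := (lmod (lgen N)).
Local Notation bas := (bas N).

Section OneField.
Variable F : finFieldType.
Implicit Types (X A B : lmodN F) (S : {set bas}).

Definition dlt S (t : bas) : 'rV[F]_#|S| := \row_q (t == enum_val q)%:R.

Lemma dlt_lop S t g : t \in S ->
  dlt S t *m lop (strl F S) g =
  if step g t is Some u then (if u \in S then dlt S u else 0) else 0.
Proof.
move=> tA; apply/rowP => q; rewrite mxE (bigD1 (enum_rank_in tA t)) //= big1.
  rewrite !mxE enum_rankK_in // eqxx mul1r addr0.
  case: (step g t) => [u|]; last by rewrite mxE.
  have [uA|uA] := boolP (u \in S); first by rewrite mxE.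
  rewrite mxE (_ : (_ == _) = false) //; apply: contraNF uA => /eqP[->].
  exact: enum_valP.
move=> p pt; rewrite !mxE (_ : (t == _) = false) ?mul0r //.
by apply: contraNF pt => /eqP et; apply/eqP/enum_val_inj; rewrite enum_rankK_in.
Qed.

Lemma dlt_neq0 S t : t \in S -> dlt S t != 0.
Proof.
move=> tA; apply/eqP => /rowP /(_ (enum_rank_in tA t)).
by rewrite !mxE enum_rankK_in // eqxx; apply/eqP; rewrite oner_eq0.
Qed.

Lemma vdim_strl S l :
  vdim (strl F S) l = (((true, l) \in S) + ((false, l) \in S))%N.
Proof.
pose B := [set s in S | s.2 == l].
have -> : (((true, l) \in S) + ((false, l) \in S))%N = #|B|.
  have -> : #|B| = (\sum_(s : bas) (if (s.1, s.2) \in B then 1 else 0))%N.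
    by rewrite -sum1_card big_mkcond; apply: eq_bigr => -[b k] _.
  rewrite -(pair_bigA _ (fun b k => if (b, k) \in B then 1%N else 0%N)) /=.
  have h b : (\sum_k (if (b, k) \in B then 1%N else 0%N))%N = ((b, l) \in S : nat).
    rewrite (bigD1 l) //= big1 ?addn0 => [|k kl]; first by rewrite inE eqxx andbT; case: (_ \in S).
    by rewrite inE /= (negPf kl) andbF.
  by rewrite big_bool /= !h.
(* The inclusion of the basis vectors at [l]: the idempotent is [C *m C^T] with [C^T *m C = 1%:M],
   so its rank is [#|B|]. *)
pose C : 'M[F]_(#|S|, #|B|) := \matrix_(p, k) (enum_val p == enum_val k)%:R.
have BS s : s \in B -> s \in S by rewrite inE => /andP[].
have e1 : lop (strl F S) (inl l) = C *m C^T.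
  apply/matrixP => p q; rewrite !mxE /=.
  have [e|ne] := eqVneq (enum_val p).2 l; last first.
    rewrite big1 // => k _; rewrite !mxE (_ : (_ == _) = false) ?mul0r //.
    apply: contraNF ne => /eqP ->; have := enum_valP k.
    by rewrite inE => /andP[].
  have pB : enum_val p \in B by rewrite inE enum_valP e eqxx.
  rewrite (bigD1 (enum_rank_in pB (enum_val p))) //= big1 => [|k kp].
    by rewrite !mxE enum_rankK_in // eqxx mul1r addr0 eq_sym.
  rewrite !mxE (_ : (_ == _) = false) ?mul0r //.
  by apply: contraNF kp => /eqP ep; apply/eqP/enum_val_inj; rewrite enum_rankK_in.
have e2 : C^T *m C = 1%:M.
  apply/matrixP => k k'; rewrite !mxE.
  have kS := BS _ (enum_valP k).
  rewrite (bigD1 (enum_rank_in kS (enum_val k))) //= big1 => [|p pk].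
    by rewrite !mxE enum_rankK_in // eqxx mul1r addr0 (inj_eq enum_val_inj).
  rewrite !mxE (_ : (_ == enum_val k) = false) ?mul0r //.
  by apply: contraNF pk => /eqP ep; apply/eqP/enum_val_inj; rewrite enum_rankK_in.
rewrite /vdim e1; apply/eqP; rewrite eqn_leq mulmx_max_rank /=.
have := mxrankM_maxl (C^T *m (C *m C^T)) C; rewrite -!mulmxA e2 mulmx1 e2 mxrank1.
by move/leq_trans; apply; apply: mxrankM_maxr.
Qed.

Lemma vdim_ivl k i l : vdim (strl F (ivl N k i)) l = (k <= l <= i)%N.
Proof. by rewrite vdim_strl !inE. Qed.

Lemma vdim_legs i j l : vdim (strl F (legs N i j)) l = ((i <= l) + (j <= l))%N.
Proof. by rewrite vdim_strl !inE. Qed.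

Definition rkal X := \rank (lop X (inr None)).

Lemma rkal_iso A B : liso A B -> rkal A = rkal B.
Proof.
case/lisoP => f [f' [/lhomP hf _ e e']].
transitivity (\rank (lop A (inr None) *m f)).
  by rewrite mxrankMfree //; exact: row_free_inv e.
by rewrite hf (eqmxMfull _ (row_full_inv e')).
Qed.

Lemma rkal_dsuml A B : rkal (dsuml A B) = (rkal A + rkal B)%N.
Proof. exact: rank_diag_block_mx. Qed.

Lemma rkal_ivl k i : rkal (strl F (ivl N k i)) = 0%N.
Proof.
apply/eqP; rewrite mxrank_eq0; apply/eqP/matrixP => p q; rewrite !mxE /=.
by have := enum_valP p; rewrite inE; case: (enum_val p =P _) => // ->.
Qed.

Lemma rkal_legs i j : (i <= N)%N -> (j <= N)%N -> (0 < rkal (strl F (legs N i j)))%N.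
Proof.
move=> iN jN; rewrite lt0n mxrank_eq0; apply/eqP => e.
have tA : (true, ord_max) \in legs N i j by rewrite inE.
have fA : (false, ord_max) \in legs N i j by rewrite inE.
have := dlt_lop (inr None) tA; rewrite e mulmx0 /= eqxx fA => /esym /eqP.
by rewrite (negPf (dlt_neq0 fA)).
Qed.

(** [Q] makes each arrow before [i] injective on its source, so a submodule that vanishes from [i]
    on also vanishes at every earlier vertex, going backwards. *)
Lemma tf_arr i X : lsat X -> (i <= N)%N ->
  (forall l : 'I_N, (l < i)%N -> exists Q, lop X (inr (Some l)) *m Q = lop X (inl (lsrc (Some l)))) ->
  tf i X.
Proof.
move=> sX iN hQ; apply/tfP => U sU /(elimT (tor_sublP i sU)) tU.
have h m l : (i <= l + m)%N -> (l <= i)%N -> U *m en X l = 0.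
  elim: m l => [|m IH] l il li.
    have e : l = i by lia.
    have lN : (l < N.+1)%N by lia.
    by rewrite -[l]/(val (Ordinal lN)) enE tU //= e.
  have [e|ne] := eqVneq l i.
    have lN : (l < N.+1)%N by lia.
    by rewrite -[l]/(val (Ordinal lN)) enE tU //= e.
  have lN : (l < N)%N by lia.
  have [Q eQ] := hQ (Ordinal lN) (ltac:(move=> /=; lia)).
  rewrite -[l]/(nat_of_ord (lsrc (Some (Ordinal lN)))) enE -eQ mulmxA.
  suff -> : U *m lop X (inr (Some (Ordinal lN))) = 0 by rewrite mul0mx.
  have /lsatP[_ _ _ ht _] := sX.
  rewrite -ht -enE mulmxA lift0; apply/eqP; rewrite -submx0.
  apply: (@submx_trans _ _ _ _ _ _ (U *m en X l.+1)); last by rewrite IH //; lia.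
  by apply: submxMr; apply: submodP.
rewrite -[U]mulmx1 -(sum_en sX) mulmx_sumr big1 // => l _.
case: (leqP i l) => il; first by rewrite enE tU.
by apply: (h i); lia.
Qed.

Lemma tf_strl i S : (i <= N)%N ->
  (forall b (l : 'I_N), (l < i)%N -> (b, lsrc (Some l)) \in S -> (b, ltgt (Some l)) \in S) ->
  tf i (strl F S).
Proof.
move=> iN h; apply: tf_arr (strl_sat _ _) iN _ => l li.
exists (lop (strl F S) (inr (Some l)))^T.
apply/matrixP => p q; rewrite !mxE.
have [e|ne] := eqVneq (enum_val p).2 (lsrc (Some l)); last first.
  rewrite [in RHS]/step (negPf ne) big1 // => r _.
  by rewrite !mxE /= -/(lsrc (Some l)) (negPf ne) mul0r.
have tS : ((enum_val p).1, ltgt (Some l)) \in S.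
  by apply: h li _; rewrite -e -surjective_pairing enum_valP.
rewrite (bigD1 (enum_rank_in tS ((enum_val p).1, ltgt (Some l)))) //= big1 => [|r rt].
  rewrite !mxE enum_rankK_in //= -/(lsrc (Some l)) e eqxx /= -/(ltgt (Some l)) eqxx mul1r addr0.
  have [eq|nq] := eqVneq (enum_val q).2 (lsrc (Some l)).
    congr (nat_of_bool _)%:R.
    rewrite !(inj_eq Some_inj) xpair_eqE eqxx andbT.
    apply/eqP/eqP => [eb|-> //].
    by rewrite (surjective_pairing (enum_val p)) (surjective_pairing (enum_val q)) e eq eb.
  rewrite /= (_ : (Some _ == Some _) = false) //; apply/negP => /eqP[epq].
  by rewrite -epq e eqxx in nq.
rewrite !mxE /= -/(lsrc (Some l)) e eqxx.
rewrite (_ : (Some _ == _) = false) ?mul0r //.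
apply: contraNF rt => /eqP[er]; apply/eqP/enum_val_inj; rewrite enum_rankK_in //.
Qed.

Lemma tf_ivl k i : (i <= N)%N -> tf i (strl F (ivl N k i)).
Proof.
move=> iN; apply: tf_strl => // b l li; rewrite !inE /= /bump leq0n add1n.
by case: b => //= /andP[kl _]; rewrite leqW.
Qed.

Lemma tf_legs i j : tf N (strl F (legs N i j)).
Proof.
apply: tf_strl => // b l li; rewrite !inE /= /bump leq0n add1n.
by case: b; apply: leqW.
Qed.

Lemma tf_hom0 i X B (U : 'M_(ldim X)) (f : 'M_(ldim X, ldim B)) :
  lhom f -> tf i B -> submod U -> tor i (subl U) -> U *m f = 0.
Proof.
move=> hf /tfP tB sU /(elimT (tor_sublP i sU)) tU.
have sV : submod (M := B) <<U *m f>>%MS.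
  apply: submod_gen => g; rewrite -mulmxA -(lhomP _ hf g) mulmxA.
  by apply: submxMr; apply: submodP.
suff h : <<U *m f>>%MS = 0 by apply/eqP; rewrite -submx0 -(genmxE (U *m f)) h.
apply: (tB _ sV); apply/tor_sublP => // l il; apply/eqP; rewrite -submx0 (eqmxMr _ (genmxE _)).
by rewrite -mulmxA -(lhomP _ hf) mulmxA tU // mul0mx sub0mx.
Qed.

Lemma tf_dsumP i A B : tf i (dsuml A B) -> tf i A /\ tf i B.
Proof.
move=> t; split.
  apply: (tf_free (f := row_mx 1%:M 0 : 'M_(ldim A, ldim (dsuml A B)))) t.
    by rewrite lhom_row lhom1 lhom0.
  by apply/row_freeP; exists (col_mx 1%:M 0); rewrite mul_row_col mulmx1 mul0mx addr0.
apply: (tf_free (f := row_mx 0 1%:M : 'M_(ldim B, ldim (dsuml A B)))) t.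
  by rewrite lhom_row lhom1 lhom0.
by apply/row_freeP; exists (col_mx 0 1%:M); rewrite mul_row_col mulmx1 mul0mx add0r.
Qed.

Lemma dsuml_zero A B : ldim B = 0%N -> liso (dsuml A B) A.
Proof.
move=> B0; rewrite liso_sym.
apply: (@liso_free _ _ A (dsuml A B) (row_mx 1%:M 0)).
- by rewrite lhom_row lhom1 lhom0.
- by apply/row_freeP; exists (col_mx 1%:M 0); rewrite mul_row_col mulmx1 mul0mx addr0.
- by rewrite /= B0 addn0.
Qed.

Lemma strl_gt0 S : indec S -> (0 < ldim (strl F S))%N.
Proof. by move/indec_neq0; rewrite card_gt0. Qed.

(** A torsion-free module with this dimension vector is indecomposable, since each nonzero summand
    would take up the single dimension at [i]; the dimension vector then identifies the string. *)
Lemma ivl_char k i X : (k <= i <= N)%N -> lsat X ->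
  liso X (strl F (ivl N k i)) =
  [forall l : 'I_N.+1, vdim X l == (k <= l <= i)%N] && tf i X.
Proof.
move=> /andP[ki iN] sX; apply/idP/andP => [h|[/forallP hv tX]].
  split; last by rewrite (tf_iso _ h) tf_ivl.
  by apply/forallP => l; rewrite (vdim_iso l h) vdim_ivl.
have li : (i < N.+1)%N by [].
have X0 : (0 < ldim X)%N.
  apply: leq_trans (rank_leq_row (lop X (inl (Ordinal li)))).
  have := hv (Ordinal li); rewrite /vdim => /eqP ->; by rewrite /= ki leqnn.
have [S [iS [W [sW h]]]] := split_string sX X0.
have [tS tW] : tf i (strl F S) /\ tf i W by apply: tf_dsumP; rewrite -(tf_iso _ h).
have hvS l : (vdim (strl F S) l + vdim W l = (k <= l <= i)%N)%N.
  by rewrite -vdim_dsuml -(vdim_iso l h); apply/eqP.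
(* Torsion-freeness gives a nonzero vertex from [i] on, and the bound leaves only [i] itself. *)
have at_i (Y : lmodN F) : tf i Y -> (0 < ldim Y)%N -> (forall l, vdim Y l <= (k <= l <= i)%N)%N ->
    (0 < vdim Y (Ordinal li))%N.
  move=> tY Y0 bY; have [l il lY] := tf_neq0 tY Y0.
  suff -> : Ordinal li = l by [].
  by apply: val_inj => /=; have := bY l; case: (leqP l i) lY il; lia.
have [W0|W0] := posnP (ldim W); last first.
  have := hvS (Ordinal li).
  have := at_i _ tS (strl_gt0 iS) (fun l => leq_trans (leq_addr _ _) (eq_leq (hvS l))).
  have := at_i _ tW W0 (fun l => leq_trans (leq_addl _ _) (eq_leq (hvS l))).
  by rewrite /= ki leqnn; lia.
apply: liso_trans h _; apply: liso_trans (dsuml_zero _ W0) _.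
have w0 l : vdim W l = 0%N.
  by apply/eqP; rewrite -leqn0 -[X in (_ <= X)%N]W0; apply: rank_leq_row.
have {}hvS l : vdim (strl F S) l = (k <= l <= i)%N by have := hvS l; rewrite w0 addn0.
suff -> : S = ivl N k i by apply: liso_refl.
case: iS => [[k' [i' [_ e]]]|[i' [j' [iN' jN' e]]]]; last first.
  by have := hvS ord_max; rewrite e vdim_legs /= iN' jN'; case: (_ <= _ <= _)%N.
rewrite e; apply/setP => -[b l]; rewrite !inE; congr (_ && _).
by have := hvS l; rewrite e vdim_ivl /=; do 2 case: (_ <= _ <= _)%N.
Qed.

End OneField.
End StringModules.

(** Each line contains [#|F| - 1] of the nonzero vectors; stated without division. *)
Lemma card_lines (F : finFieldType) n (L : 'M[F]_n) :
  (#|[set U : 'M_n | [&& <<U>>%MS == U, \rank U == 1%N & (U <= L)%MS]]| * (#|F| - 1) =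
   #|F| ^ \rank L - 1)%N.
Proof.
have nz (A : 'M[F]_n) :
    #|[set v : 'rV_n | (v <= A)%MS && (v != 0)]| = (#|F| ^ \rank A - 1)%N.
  rewrite -card_submx [in RHS](cardsD1 0) inE sub0mx addKn.
  by apply: eq_card => v; rewrite !inE andbC.
rewrite -nz (card_fibers (h := fun v : 'rV_n => <<v>>%MS)
  (Q := fun U : 'M_n => [&& <<U>>%MS == U, \rank U == 1%N & (U <= L)%MS])); last first.
  move=> v /andP[vL v0]; rewrite genmx_id eqxx !genmxE vL.
  by rewrite rank_rV v0.
rewrite -sum1dep_card big_distrl /=; apply: eq_bigr => U /and3P[/eqP gU /eqP rU UL].
have -> : (#|F| - 1 = #|F| ^ \rank U - 1)%N by rewrite rU expn1.
rewrite mul1n -nz; apply: eq_card => v; rewrite !inE.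
apply/andP/andP => [[vU v0]|[/andP[vL v0] /eqP <-]]; last first.
  by rewrite genmxE submx_refl.
split; first by rewrite (submx_trans vU UL).
apply/eqP; rewrite -gU; apply/eq_genmx/eqmxP; rewrite vU /=.
by rewrite -(geq_leqif (mxrank_leqif_sup vU)) rU rank_rV v0.
Qed.

(** * The rank of the loop through simple submodules *)

Section LoopRank.
Variable N : nat.
Local Notation lmodN := (lmod (lgen N)).
Local Notation bas := (bas N).
Local Notation top := (@ord_max N).

Section OneField.
Variable F : finFieldType.
Implicit Types (X A B : lmodN F) (S : {set bas}).

(** The socle of [X] at the last vertex. *)
Definition alker X := (lop X (inl top) :&: kermx (lop X (inr None)))%MS.

Lemma rank_alker X : lsat X -> (rkal X + \rank (alker X) = vdim X top)%N.
Proof.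
move=> sX; rewrite /rkal /alker /vdim -[RHS](mxrank_mul_ker _ (lop X (inr None))).
by case/lsatP: sX => _ _ h _ _; rewrite (h None).
Qed.

Lemma rkal_le X : lsat X -> (rkal X <= \rank (alker X))%N.
Proof.
case/lsatP => _ _ _ h a2; apply: mxrankS.
by rewrite sub_capmx -{1}(h None) submxMl sub_kermx a2 eqxx.
Qed.

Definition is_simple_top X := [forall l, vdim X l == (l == top)].

Lemma simple_top_line X (U : 'M_(ldim X)) : lsat X ->
  submod U && is_simple_top (subl U) =
  [&& <<U>>%MS == U, \rank U == 1%N & (U <= alker X)%MS].
Proof.
move=> sX; have [hee hs ha ht a2] := elimT (lsatP X) sX.
apply/andP/and3P => [[sU /forallP sT]|[gU /eqP rU]].
  have Ue l : l != top -> U *m lop X (inl l) = 0.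
    move=> lt; apply/eqP; rewrite -mxrank_eq0 -vdim_subl //.
    by rewrite (eqP (sT l)) (negPf lt).
  have UE : U *m lop X (inl top) = U.
    rewrite -[RHS]mulmx1 -hs mulmx_sumr (bigD1 top) //= big1 ?addr0 //.
  have rU : \rank U = 1%N.
    by rewrite -UE -vdim_subl // (eqP (sT top)) eqxx.
  split; [by rewrite submodE | by rewrite rU |].
  rewrite sub_capmx -{1}UE submxMl /= sub_kermx.
  (* If the loop did not kill the line [U], it would map [U] onto itself, contradicting that its
     square is zero. *)
  apply: contraT => Ua0.
  have le := submodP (inr None) sU.
  have : (U <= U *m lop X (inr None))%MS.
    by rewrite -(geq_leqif (mxrank_leqif_sup le)) rU lt0n mxrank_eq0.
  move=> /(submxMr (lop X (inr None))); rewrite -mulmxA a2 mulmx0 submx0.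
  by move=> e; rewrite e in Ua0.
rewrite sub_capmx sub_kermx => /andP[/submxP[D eD] /eqP Ua].
have UE : U *m lop X (inl top) = U by rewrite {1}eD -mulmxA hee eqxx -eD.
have Ue l : l != top -> U *m lop X (inl l) = 0.
  by move=> lt; rewrite eD -mulmxA hee eq_sym (negPf lt) mulmx0.
have sU : submod U.
  rewrite /submod gU; apply/forallP => -[l|[l|]].
  - by have [->|/Ue ->] := eqVneq l top; rewrite ?UE ?sub0mx.
  - rewrite -(ha (Some l)) mulmxA Ue ?mul0mx ?sub0mx //.
    by apply/negP => /eqP /(congr1 val) /= e; have := ltn_ord l; rewrite e ltnn.
  - by rewrite Ua sub0mx.
split=> //; apply/forallP => l; rewrite vdim_subl //.
by have [->|/Ue ->] := eqVneq l top; rewrite ?UE ?rU ?mxrank0.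
Qed.

(** With two dimensions at the last vertex the loop has rank 0 or 1, so its kernel there is a plane
    with [#|F| + 1] lines or a single line. *)
Lemma card_simple_top X : lsat X -> vdim X top = 2%N ->
  #|[set U : 'M_(ldim X) | submod U && is_simple_top (subl U)]| =
  (1 + #|F| * (rkal X == 0%N))%N.
Proof.
move=> sX v2; have q1 := finNzRing_gt1 F.
have -> : #|[set U : 'M_(ldim X) | submod U && is_simple_top (subl U)]| =
    #|[set U : 'M_(ldim X) | [&& <<U>>%MS == U, \rank U == 1%N & (U <= alker X)%MS]]|.
  by apply: eq_card => U; rewrite !in_set simple_top_line.
have := card_lines (alker X); have := rank_alker sX; have := rkal_le sX.
rewrite v2; move: #|[set U | _]| => n; move: (\rank _) => r.
case: (rkal X) => [|[|k]] /=; [|move=> _|lia].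
  rewrite add0n => _ ->; rewrite muln1 => e; apply/eqP.
  rewrite -(eqn_pmul2r (_ : 0 < #|F| - 1)%N) ?subn_gt0 // e.
  by apply/eqP; rewrite -[in LHS](exp1n 2%N) subn_sqr mulnC (addnC 1)%N.
rewrite add1n => -[->]; rewrite expn1 muln0 addn0 => e; apply/eqP.
by rewrite -(eqn_pmul2r (_ : 0 < #|F| - 1)%N) ?subn_gt0 // e mul1n.
Qed.

Lemma legs_comb a b i j : (a <= N)%N -> (b <= N)%N -> (i <= N)%N -> (j <= N)%N ->
  (forall l : 'I_N.+1, (a <= l) + (b <= l) = (i <= l) + (j <= l))%N ->
  (a = i /\ b = j) \/ (a = j /\ b = i).
Proof.
move=> aN bN iN jN h.
have h' l : (l <= N)%N -> ((a <= l) + (b <= l) = (i <= l) + (j <= l))%N.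
  by move=> lN; apply: (h (Ordinal (lN : (l < N.+1)%N))).
have := h' _ aN; have := h' _ bN; have := h' _ iN; have := h' _ jN.
rewrite !leqnn.
case: (leqP a i); case: (leqP a j); case: (leqP b i); case: (leqP b j);
case: (leqP a b); case: (leqP b a); case: (leqP i j); case: (leqP j i);
case: (leqP i a); case: (leqP j a); case: (leqP i b); case: (leqP j b); lia.
Qed.

Lemma tf_top X : tf N X -> (0 < ldim X)%N -> (0 < vdim X top)%N.
Proof.
move=> tX X0; have [l Nl lX] := tf_neq0 tX X0.
suff -> : top = l by [].
by apply: val_inj => /=; apply/eqP; rewrite eqn_leq Nl -ltnS ltn_ord.
Qed.

Lemma vdim_gt0 X l : (0 < vdim X l)%N -> (0 < ldim X)%N.
Proof. by move=> h; apply: leq_trans (rank_leq_row (lop X (inl l))). Qed.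

(** A proper decomposition would give both torsion-free summands dimension one at the last vertex,
    where a loop of square zero vanishes. So [X] is a string, and its dimension vector gives the two
    starts up to order. *)
Lemma legs_char i j X : (i <= N)%N -> (j <= N)%N -> lsat X -> tf N X ->
  (forall l : 'I_N.+1, vdim X l = (i <= l) + (j <= l))%N -> (0 < rkal X)%N ->
  liso X (strl F (legs N i j)) || liso X (strl F (legs N j i)).
Proof.
move=> iN jN sX tX hv ra.
have v2 : vdim X top = 2%N by rewrite hv /= iN jN.
have X0 : (0 < ldim X)%N by apply: (@vdim_gt0 _ top); rewrite v2.
have [S [iS [W [sW h]]]] := split_string sX X0.
have [tS tW] : tf N (strl F S) /\ tf N W by apply: tf_dsumP; rewrite -(tf_iso _ h).
have hvS l : (vdim (strl F S) l + vdim W l = (i <= l) + (j <= l))%N.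
  by rewrite -vdim_dsuml -(vdim_iso l h).
have [W0|W0] := posnP (ldim W); last first.
  have := tf_top tW W0; have := tf_top tS (strl_gt0 F iS).
  have := rank_alker sW; have := rkal_le sW.
  have sS : lsat (strl F S) := strl_sat F S.
  have := rank_alker sS; have := rkal_le sS.
  have := hvS top; rewrite /= iN jN.
  by move: ra; rewrite (rkal_iso h) rkal_dsuml; lia.
have hS : liso X (strl F S) := liso_trans h (dsuml_zero _ W0).
have {}hvS l : vdim (strl F S) l = ((i <= l) + (j <= l))%N.
  by rewrite -(vdim_iso l hS).
case: iS => [[k [m [km e]]]|[i' [j' [iN' jN' e]]]].
  by have := hvS top; rewrite e vdim_ivl /= iN jN; case: (_ && _).
case: (@legs_comb i' j' i j) => // [l|[ei ej]|[ei ej]].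
- by have := hvS l; rewrite e vdim_legs.
- by rewrite -ei -ej -e hS.
- by rewrite -ei -ej -e hS orbT.
Qed.

End OneField.
End LoopRank.

(** * Extensions of two uniserial modules *)

Section UniserialExtensions.
Variable N : nat.
Local Notation lmodN := (lmod (lgen N)).
Local Notation bas := (bas N).
Local Notation top := (@ord_max N).

Section OneField.
Variable F : finFieldType.
Implicit Types (X A B : lmodN F) (S : {set bas}).

Lemma tf_exact i X (U : 'M_(ldim X)) : submod U ->
  tf i (subl U) -> tf i (quol U) -> tf i X.
Proof.
move=> sU /tfP tS tQ; apply/tfP => W sW tW.
have le : (W <= U)%MS.
  by rewrite -(proj_ker (M := X)) (tf_hom0 (proj_hom sU) tQ sW tW).
have s := submod_relmx sW sU le.
have [_ h] := subl_mono s (incl_hom sU) (row_base_free U).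
have e : <<relmx W U *m row_base U>>%MS = W.
  by rewrite -[RHS](submodE sW); apply/eq_genmx/relmxE.
have z := tS _ s; rewrite (tor_iso i h) e in z.
by rewrite -e (z tW) mul0mx genmx0.
Qed.

(** With zero loop only intervals split off, and torsion-freeness forces them to end at [N]; two of
    them exhaust the dimension at the last vertex. *)
Lemma sum_ivl_char i j X : (i <= N)%N -> (j <= N)%N -> lsat X -> tf N X ->
  (forall l : 'I_N.+1, vdim X l = (i <= l) + (j <= l))%N -> rkal X = 0%N ->
  liso X (dsuml (strl F (ivl N i N)) (strl F (ivl N j N))).
Proof.
move=> iN jN.
have split1 Y : lsat Y -> tf N Y -> (0 < vdim Y top)%N -> rkal Y = 0%N ->
    exists k W, [/\ (k <= N)%N, lsat W, tf N W, rkal W = 0%N &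
      liso Y (dsuml (strl F (ivl N k N)) W)].
  move=> sY tY Y0 rY.
  have [S [iS [W [sW h]]]] := split_string sY (vdim_gt0 Y0).
  have [tS tW] : tf N (strl F S) /\ tf N W by apply: tf_dsumP; rewrite -(tf_iso _ h).
  have := rY; rewrite (rkal_iso h) rkal_dsuml => /eqP; rewrite addn_eq0 => /andP[/eqP rS /eqP rW].
  have := tf_top tS (strl_gt0 F iS).
  case: iS => [[k [m [/andP[km mN] e]]]|[i' [j' [iN' jN' e]]]]; last first.
    by have := rkal_legs F iN' jN'; rewrite -e rS.
  rewrite e vdim_ivl /=; have [kN|] := leqP k N => //= Nm; have em : m = N by lia.
  by exists k, W; split=> //; rewrite -[X in ivl _ k X]em -e.
move=> sX tX hv rX.
have v2 : vdim X top = 2%N by rewrite hv /= iN jN.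
have [k [W [kN sW tW rW h]]] : exists k W, [/\ (k <= N)%N, lsat W, tf N W, rkal W = 0%N &
      liso X (dsuml (strl F (ivl N k N)) W)] by apply: split1 => //; rewrite v2.
have hW (l : 'I_N.+1) : ((k <= l) + vdim W l = (i <= l) + (j <= l))%N.
  have lN : (l <= N)%N by rewrite -ltnS.
  by rewrite -hv (vdim_iso l h) vdim_dsuml vdim_ivl lN andbT.
have [m [Z [mN sZ tZ rZ g]]] : exists k Z, [/\ (k <= N)%N, lsat Z, tf N Z, rkal Z = 0%N &
      liso W (dsuml (strl F (ivl N k N)) Z)].
  by apply: split1 => //; have := hW top; rewrite /= kN iN jN; lia.
have Z0 : ldim Z = 0%N.
  apply/eqP; rewrite -leqn0 leqNgt; apply/negP => /(tf_top tZ).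
  have := hW top; rewrite (vdim_iso top g) vdim_dsuml vdim_ivl /= kN iN jN mN leqnn /=.
  by lia.
have {}g := liso_trans g (dsuml_zero _ Z0).
have {}h := liso_trans h (dsuml_iso (liso_refl _) g).
apply: liso_trans h _.
case: (@legs_comb N k m i j) => // [l|[-> ->]|[-> ->]].
- have := hW l; rewrite (vdim_iso l g) vdim_ivl.
  by have -> : (l <= N)%N; rewrite ?andbT // -ltnS.
- exact: liso_refl.
- exact: dsumlC.
Qed.

Definition nuniext i j X := nhall (strl F (ivl N j N)) (strl F (ivl N i N)) X.

Lemma nuniext_supp i j X : lsat X -> nuniext i j X != 0%N ->
  tf N X /\ (forall l : 'I_N.+1, vdim X l = (i <= l) + (j <= l))%N.
Proof.
move=> sX; rewrite -lt0n => /card_gt0P[U]; rewrite inE => /and3P[sU iU jU].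
split=> [|l].
  by apply: (tf_exact sU); rewrite ?(tf_iso _ iU) ?(tf_iso _ jU) tf_ivl.
have lN : (l <= N)%N by rewrite -ltnS.
by rewrite (vdim_exact l sX sU) (vdim_iso l iU) (vdim_iso l jU) !vdim_ivl lN !andbT.
Qed.

Lemma submod_dlt S b i (V : 'M_(ldim (strl F S))) : submod V ->
  (forall l : 'I_N.+1, (i <= l)%N -> (b, l) \in S) ->
  (forall l : 'I_N.+1, i = l :> nat -> (dlt F S (b, l) <= V)%MS) ->
  forall l : 'I_N.+1, (i <= l)%N -> (dlt F S (b, l) <= V)%MS.
Proof.
move=> sV hS hi [l lN] /= il; elim: l lN il => [|l IH] lN il.
  by apply: hi => /=; lia.
have [e|ne] := eqVneq i l.+1; first exact: hi.
have lN' : (l < N.+1)%N by apply: leq_trans lN.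
have lN2 : (l < N)%N by lia.
have il' : (i <= l)%N by lia.
have s0 : (b, Ordinal lN') \in S by apply: hS.
have s1 : (b, Ordinal lN) \in S by apply: hS.
have e0 : step (inr (Some (Ordinal lN2))) (b, Ordinal lN') = Some (b, Ordinal lN).
  rewrite /step (_ : (b, Ordinal lN').2 = lsrc (Some (Ordinal lN2))) ?eqxx; last exact: val_inj.
  by congr (Some (_, _)); apply: val_inj.
have := dlt_lop F (inr (Some (Ordinal lN2))) s0; rewrite e0.
rewrite s1 => <-; apply: submx_trans (submodP _ sV).
exact: submxMr (IH lN' il').
Qed.

Lemma nuniext_rkal i X U : submod (M := X) U -> liso (subl U) (strl F (ivl N i N)) ->
  U *m lop X (inr None) = 0.
Proof.
move=> sU iU; have r0 : rkal (subl U) = 0%N by rewrite (rkal_iso iU) rkal_ivl.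
apply/eqP; rewrite -submx0 -(eqmxMr _ (eq_row_base U)) submx0.
have r1 : lop (subl U) (inr None) = 0 by apply/eqP; rewrite -mxrank_eq0 -/(rkal _) r0.
have := lhomP _ (incl_hom sU) (inr None); rewrite r1 mul0mx => e.
by apply/eqP; rewrite -e.
Qed.

Lemma dlt_sub S b (l : 'I_N.+1) (U : 'M_(ldim (strl F S))) : submod U ->
  (b, l) \in S -> vdim (subl U) l = vdim (strl F S) l -> (dlt F S (b, l) <= U)%MS.
Proof.
move=> sU bS e; have := dlt_lop F (inl l) bS; rewrite /= eqxx bS => <-.
apply: submx_trans (submxMl _ _) _.
apply: submx_trans (submodP (inl l) sU).
by rewrite -(geq_leqif (mxrank_leqif_sup (submxMl U _))) -vdim_subl // e.
Qed.

(** At [i] only the [true] leg is present, so a uniserial submodule from [i] contains that leg up to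
    its end. There the loop is nonzero, whereas it kills the submodule. *)
Lemma nuniext_legs0 i j : (i < j <= N)%N -> nuniext i j (strl F (legs N i j)) = 0%N.
Proof.
case/andP => ij jN; have iN : (i <= N)%N := leq_trans (ltnW ij) jN.
apply/eqP; rewrite cards_eq0; apply/set0Pn => -[U]; rewrite inE => /and3P[sU iU _].
have h : (dlt F (legs N i j) (true, top) <= U)%MS.
  apply: (submod_dlt (i := i)) => // [l il|l el]; first by rewrite inE.
  apply: dlt_sub => //; first by rewrite inE /= el.
  by rewrite vdim_legs (vdim_iso l iU) vdim_ivl -el leqnn iN (leqNgt j) ij.
have tA : (true, top) \in legs N i j by rewrite inE.
have fA : (false, top) \in legs N i j by rewrite inE.
have /eqP := dlt_lop F (inr None) tA; rewrite /= eqxx fA.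
have /submxP[D ->] := h; rewrite -mulmxA (nuniext_rkal sU iU) mulmx0 eq_sym.
by rewrite (negPf (dlt_neq0 F fA)).
Qed.

Lemma card_legs i j : #|legs N i j| = (#|ivl N i N| + #|ivl N j N|)%N.
Proof.
have lN (l : 'I_N.+1) : (l <= N)%N by rewrite -ltnS.
rewrite -(cardsID [set s : bas | s.1]); congr (_ + _)%N.
  rewrite -(card_imset (mem (ivl N i N)) (f := fun s : bas => (~~ s.1, s.2))); last first.
    by move=> [b l] [b' l'] /= [/(can_inj negbK) -> ->].
  apply: eq_card => -[b l]; rewrite !inE /=; apply/idP/imsetP => [|[[b' l']]].
    case: b; rewrite ?andbF // andbT => il; exists (false, l) => //.
    by rewrite inE /= il lN.
  move=> h [-> ->]; move: h; rewrite inE /= lN !andbT => /andP[-> ->] //.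
by apply: eq_card => -[b l]; rewrite !inE /= lN andbT; case: b.
Qed.

Lemma lop_dlt_tr S t g : t \in S ->
  lop (strl F S) g *m (dlt F S t)^T =
  if pre g t is Some u then (if u \in S then (dlt F S u)^T else 0) else 0.
Proof.
move=> tS; apply/colP => p; rewrite mxE (bigD1 (enum_rank_in tS t)) //= big1 => [|q qt].
  rewrite !mxE enum_rankK_in // eqxx mulr1 addr0 step_pre.
  case: (pre g t) => [u|]; last by rewrite mxE.
  have [uS|uS] := boolP (u \in S); first by rewrite !mxE.
  rewrite mxE (_ : (_ == _) = false) //; apply: contraNF uS => /eqP[->].
  exact: enum_valP.
rewrite !mxE (_ : (t == _) = false) ?mulr0 //.
by apply: contraNF qt => /eqP et; apply/eqP/enum_val_inj; rewrite enum_rankK_in.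
Qed.

(** Now the [false] leg is the longer one; it is a submodule with the [true] leg as quotient. *)
Lemma nuniext_legs1 i j : (i < j <= N)%N -> nuniext i j (strl F (legs N j i)) = 1%N.
Proof.
case/andP => ij jN; have iN : (i <= N)%N := leq_trans (ltnW ij) jN.
have lN (l : 'I_N.+1) : (l <= N)%N by rewrite -ltnS.
set S := legs N j i; set X := strl F S.
have fS (l : 'I_N.+1) : (i <= l)%N -> (false, l) \in S by move=> h; rewrite inE.
have tS (l : 'I_N.+1) : (j <= l)%N -> (true, l) \in S by move=> h; rewrite inE.
pose f : 'M[F]_(ldim (strl F (ivl N i N)), ldim X) :=
  \matrix_p dlt F S (enum_val p).
have hf : lhom f.
  apply: strl_from => -[b l] g; rewrite inE /= => /and3P[nb il _].
  case: b nb => // _; rewrite dlt_lop ?fS //; case: g => [v|[m|]] //=.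
    by case: eqP => // _; rewrite fS // inE /= il lN.
  case: eqP => // el; have im : (i <= ltgt (Some m))%N.
    by rewrite /= /bump leq0n add1n; move: il; rewrite el /=; lia.
  by rewrite -/(ltgt (Some m)); move: (ltgt _) im => v im; rewrite fS // inE /= im lN.
have dd s t : s \in S -> t \in S -> dlt F S s *m (dlt F S t)^T = (s == t)%:R%:M.
  move=> sS tS'; apply/matrixP => a a'; rewrite !ord1 !mxE.
  rewrite (bigD1 (enum_rank_in sS s)) //= big1 => [|p ps].
    by rewrite !mxE enum_rankK_in // eqxx mul1r addr0 eq_sym mulr1n.
  rewrite !mxE (_ : (s == _) = false) ?mul0r //.
  by apply: contraNF ps => /eqP es; apply/eqP/enum_val_inj; rewrite enum_rankK_in.
have iS s : s \in ivl N i N -> s \in S by case: s => [[] l]; rewrite !inE //= => /andP[].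
have ff : row_free f.
  have dual s t : s \in ivl N i N -> t \in ivl N i N ->
      dlt F S s *m (dlt F S t)^T = (s == t)%:R%:M by move=> sS tS'; apply: dd; apply: iS.
  exact: row_free_inv (strl_dual (X := X) (b := dlt F S) (c := fun s => (dlt F S s)^T) dual).
pose U : 'M_(ldim X) := <<f>>%MS.
have sU : submod U := submod_im hf.
have fU : (f :=: U)%MS := eqmx_sym (genmxE f).
have iU : liso (subl U) (strl F (ivl N i N)) by rewrite liso_sym; apply: (liso_subl sU hf ff).
pose h : 'M[F]_(ldim X, ldim (strl F (ivl N j N))) :=
  \matrix_(p, k) (dlt F S (true, (enum_val k).2))^T p 0.
have hh : lhom h.
  apply: (strl_to (X := X) (c := fun s => (dlt F S (true, s.2))^T)) => -[b l] g.
  rewrite inE /= => /and3P[nb jl _]; case: b nb => // _.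
  rewrite lop_dlt_tr ?tS //; case: g => [v|[m|]] /=.
  - by case: eqP => // _; rewrite tS // inE /= jl lN.
  - case: eqP => // el; rewrite -/(lsrc (Some m)).
    by move: (lsrc _) => v; rewrite !inE /= lN andbT.
  by rewrite xpair_eqE /=; case: eqP => // _; rewrite !inE.
have kh : row_full h.
  have dual s t : s \in ivl N j N -> t \in ivl N j N ->
      dlt F S (true, s.2) *m (dlt F S (true, t.2))^T = (s == t)%:R%:M.
    case: s t => [[] l] [[] l']; rewrite !inE //= !lN !andbT => jl jl'.
    by rewrite dd ?tS // !xpair_eqE.
  exact: row_full_inv (strl_dual (X := X) (b := fun s => dlt F S (true, s.2))
    (c := fun s => (dlt F S (true, s.2))^T) dual).
have fh : f *m h = 0.
  apply/matrixP => p k; rewrite mxE [RHS]mxE.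
  have : (dlt F S (enum_val p) *m (dlt F S (true, (enum_val k).2))^T) 0 0 = 0.
    have pS := iS _ (enum_valP p).
    have := enum_valP k; rewrite inE => /and3P[_ jk _].
    rewrite dd ?tS // (_ : (_ == _) = false) ?mxE ?mul0rn //.
    by have := enum_valP p; rewrite inE; case: (enum_val p) => [[] l].
  by rewrite mxE => e; rewrite -[RHS]e; apply: eq_bigr => q _; rewrite !mxE.
have khU : (kermx h :=: U)%MS.
  apply: eqmx_trans fU; apply: eqmx_sym; apply/eqmxP.
  have le : (f <= kermx h)%MS by rewrite sub_kermx fh.
  rewrite -(geq_leqif (mxrank_leqif_eq le)) mxrank_ker (eqP kh) (eqP ff) /=.
  by rewrite card_legs addKn.
have jU : liso (quol U) (strl F (ivl N j N)) := liso_quol sU hh kh khU.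
(* Uniqueness: a candidate fills the one-dimensional space at [i], hence contains the whole [false]
   leg, and has the same dimension. *)
rewrite -(cards1 U) /nuniext; apply: eq_card => V; rewrite !inE.
apply/and3P/eqP => [[sV iV jV]|-> //].
have h0 (l : 'I_N.+1) : (i <= l)%N -> (dlt F S (false, l) <= V)%MS.
  apply: submod_dlt => // {l}l el; apply: dlt_sub => //; first by rewrite fS // el.
  by rewrite vdim_legs (vdim_iso l iV) vdim_ivl -el leqnn iN (leqNgt j) ij.
have le : (f <= V)%MS.
  apply/row_subP => p; rewrite rowK; have := enum_valP p; rewrite inE.
  by case: (enum_val p) => [[] l] //= /andP[il _]; apply: h0.
apply: submod_eq => //; apply: eqmx_trans fU; apply: eqmx_sym; apply/eqmxP.
rewrite -(geq_leqif (mxrank_leqif_eq le)) (eqP ff).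
by have /= -> := liso_dim iV.
Qed.

End OneField.
End UniserialExtensions.

(** * Indicator functions of strings are good *)

Section StringIndicators.
Variable N : nat.
Local Notation lmodN := (lmod (lgen N)).
Local Notation bas := (bas N).
Local Notation top := (@ord_max N).
Variable K : finFieldType.
Implicit Type x : extn K.
Local Notation "M ^@ x" := (lext (emap x) M) (at level 8, x at level 7, format "M ^@ x").
Local Notation rels := (lrels N).
Local Notation good := (@good _ rels K).

Lemma ind_strl S x (Z : lmodN (efield x)) :
  ind (strl K S) x Z = (liso Z (strl (efield x) S))%:R.
Proof. by rewrite /ind (liso_rtrans _ (strl_ext (emap x) S)). Qed.

Lemma good_tf i : good (tfI (N := N) i (fun x X => 1)).
Proof. by apply: good_tfI => //; apply: good_one (@string_descent N K). Qed.

Lemma good_ivl k i : (k <= i <= N)%N -> good (ind (strl K (ivl N k i))).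
Proof.
move=> ki; pose p (v : {ffun 'I_N.+1 -> nat}) := [forall l : 'I_N.+1, v l == (k <= l <= i)%N].
apply: good_ext (good_vdim p (good_tf i)); first exact: cinv_ind.
move=> x X sX; rewrite ind_strl ivl_char // /tfI mulr1 -natrM mulnb.
by congr ((nat_of_bool (_ && _))%:R); apply: eq_forallb => l; rewrite ffunE.
Qed.

Definition loop0 : cfun (lgen N) K :=
  fun x X => ((vdim X top == 2%N) && (rkal X == 0%N))%:R.

(** For two dimensions at the last vertex, the number of simple submodules there minus one is q or 0
    according to the loop. That number is a convolution of good functions, and q may be divided
    out. *)
Lemma good_loop0 : good loop0.
Proof.
have ic : cinv loop0 by move=> x A B h; rewrite /loop0 (vdim_iso _ h) (rkal_iso h).
have g1 : good (fun x X => 1) := good_one (@string_descent N K).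
pose p1 (v : {ffun 'I_N.+1 -> nat}) := [forall l : 'I_N.+1, v l == (l == top)].
pose p2 (v : {ffun 'I_N.+1 -> nat}) := v top == 2%N.
have g2 := good_sub (good_conv (@string_descent N K) g1 (good_vdim p1 g1)) g1.
apply: (good_div (runit_qcard K 1) ic).
apply: good_ext (good_vdim p2 g2); first by move=> x A B h; rewrite (ic _ _ _ h).
move=> x X sX; rewrite /p2 ffunE /loop0; have [v2|] := eqVneq; last by rewrite mul0r mulr0.
have -> : conv (fun x X => 1) (fun x X => (p1 [ffun l => vdim X l])%:R * 1) x X =
    #|[set U : 'M_(ldim X) | submod U && is_simple_top (subl U)]|%:R.
  rewrite -sum1dep_card big_mkcondr natr_sum /conv; apply: eq_bigr => U _.
  rewrite mul1r mulr1 -[if _ then _ else _]/(nat_of_bool _).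
  rewrite (_ : p1 _ = is_simple_top (subl U)); last by apply: eq_forallb => l; rewrite ffunE.
  by case: is_simple_top.
by rewrite card_simple_top // mul1r natrD addrC addKr natrM expn1.
Qed.

(** Torsion submodules vanish at the last vertex, so dividing them out changes neither the dimension
    there nor whether the loop is zero. *)
Lemma good_tf_loop0 : good (tfI N loop0).
Proof.
apply: good_tfI good_loop0 _ => x X U sX sU tU.
have [hee hs ha ht a2] := elimT (lsatP X) sX.
have Ut : U *m lop X (inl top) = 0 by apply: (elimT (tor_sublP N sU) tU).
rewrite /loop0 (vdim_exact _ sX sU) (vdim_subl _ sU) Ut mxrank0 add0n.
congr ((nat_of_bool (_ && _))%:R); rewrite /rkal !mxrank_eq0.
have e := lhomP _ (proj_hom sU) (inr None).
apply/eqP/eqP => h.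
  by apply: (row_full_inj (proj_full U)); rewrite -e h mul0mx mulmx0.
rewrite h mulmx0 in e; move/eqP: e; rewrite (proj_ker (M := X)) => le.
have : (lop X (inr None) *m lop X (inl top) <= U *m lop X (inl top))%MS by apply: submxMr.
by rewrite Ut submx0 (ht None) => /eqP.
Qed.

Definition legv i j (v : {ffun 'I_N.+1 -> nat}) :=
  [forall l : 'I_N.+1, v l == ((i <= l) + (j <= l))%N].

Lemma legvP i j x (X : lmodN (efield x)) :
  reflect (forall l : 'I_N.+1, vdim X l = ((i <= l) + (j <= l))%N) (legv i j [ffun l => vdim X l]).
Proof.
by apply: (iffP forallP) => h l; have := h l; rewrite ffunE => /eqP.
Qed.

Lemma omega_legs i j x (X : lmodN (efield x)) : (i <= N)%N -> (j <= N)%N -> lsat X ->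
  (legv i j [ffun l => vdim X l])%:R * (tfI N (fun x X => 1) X - tfI N loop0 X) =
  (liso X (strl (efield x) (legs N i j)) || liso X (strl (efield x) (legs N j i)))%:R :> rat.
Proof.
move=> iN jN sX; apply/esym.
have [/orP h|nh] := boolP (_ || _).
  have [hv tX rX] : [/\ legv i j [ffun l => vdim X l], tf N X & (0 < rkal X)%N].
    case: h => h; rewrite (tf_iso _ h) (rkal_iso h) tf_legs rkal_legs //; split=> //;
      apply/legvP => l; rewrite (vdim_iso l h) vdim_legs //; exact: addnC.
  by rewrite hv mul1r /tfI tX !mul1r /loop0 (gtn_eqF rX) andbF subr0.
case: legvP => [hv|_]; last by rewrite mul0r.
rewrite mul1r /tfI; case tX: (tf N X); last by rewrite !mul0r subrr.
rewrite !mul1r /loop0 hv /= iN jN; have [_|rX] := posnP (rkal X); first by rewrite subrr.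
by rewrite (legs_char iN jN sX tX hv rX) in nh.
Qed.

Lemma good_legs_diag i : (i <= N)%N -> good (ind (strl K (legs N i i))).
Proof.
move=> iN; have g := good_vdim (legv i i) (good_sub (good_tf N) good_tf_loop0).
apply: good_ext g; first exact: cinv_ind.
by move=> x X sX; rewrite ind_strl omega_legs // orbb.
Qed.

Lemma nuniext_conv i j x (X : lmodN (efield x)) :
  conv (ind (strl K (ivl N j N))) (ind (strl K (ivl N i N))) x X = (nuniext i j X)%:R.
Proof.
rewrite /nuniext /nhall -sum1dep_card big_mkcondr natr_sum /conv; apply: eq_bigr => U _ /=.
by rewrite !ind_strl andbC; case: liso; case: liso; rewrite /= ?mulr0 ?mul0r ?mulr1.
Qed.

Lemma nuniext_iso i j F (X Y : lmodN F) : liso X Y -> nuniext i j X = nuniext i j Y.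
Proof. by apply: nhall_iso; apply: liso_refl. Qed.

(** The convolution of the two uniserial indicators is supported on M(i, j), M(j, i) and the direct
    sum, with values 0, 1 and a Hall number that is rational. The last contribution is the zero-loop
    case and can be subtracted. *)
Lemma good_legs_gt i j : (i < j <= N)%N -> good (ind (strl K (legs N j i))).
Proof.
move=> ij; have [ij' jN] := andP ij; have iN : (i <= N)%N := leq_trans (ltnW ij') jN.
set A := strl K (ivl N j N); set B := strl K (ivl N i N).
have gA : good (ind A) by apply: good_ivl; rewrite jN leqnn.
have gB : good (ind B) by apply: good_ivl; rewrite iN leqnn.
have rc : ratl (hallF A B (dsuml B A)).
  have [_ h] := gA; apply: ratl_ext (h B (dsuml B A) _ _) => [x||].
  - by rewrite hallF_hsum.
  - exact: strl_sat.
  - by rewrite sat_dsuml; apply/andP; split; apply: strl_sat.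
have g := good_sub (good_conv (@string_descent N K) gA gB)
  (good_scale rc (good_vdim (legv i j) good_tf_loop0)).
apply: good_ext g; first exact: cinv_ind.
move=> x X sX; rewrite ind_strl nuniext_conv.
have [/andP[tX /legvP hv]|nX] := boolP (tf N X && legv i j [ffun l => vdim X l]); last first.
  rewrite (_ : liso X _ = false); last first.
    apply: contraNF nX => h; rewrite (tf_iso _ h) tf_legs; apply/legvP => l.
    by rewrite (vdim_iso l h) vdim_legs addnC.
  rewrite (_ : _ * tfI N loop0 X = 0); last first.
    by rewrite /tfI mulrA -natrM mulnb andbC (negPf nX) mul0r.
  rewrite mulr0 subr0; have [->//|/(nuniext_supp sX)[tX hv]] := eqVneq (nuniext i j X) 0%N.
  by case/negP: nX; rewrite tX; apply/legvP.
have -> : legv i j [ffun l => vdim X l] by apply/legvP.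
rewrite mul1r /tfI tX mul1r /loop0 hv /= iN jN.
have [r0|r0] := posnP (rkal X).
  have h := sum_ivl_char iN jN sX tX hv r0.
  rewrite mulr1 (_ : liso X _ = false); last first.
    apply: (introF idP) => h'; have e := rkal_iso h'; have := rkal_legs (efield x) jN iN.
    by rewrite -e r0.
  rewrite /hallF nuniext_conv (@nuniext_iso _ _ _ X (dsuml B A)^@x) ?subrr //.
  apply: liso_trans h _; rewrite liso_sym; apply: liso_trans (lext_dsuml _ _ _) _.
  by apply: dsuml_iso; apply: strl_ext.
rewrite mulr0 subr0; case/orP: (legs_char iN jN sX tX hv r0) => h.
  rewrite (nuniext_iso i j h) nuniext_legs0 //; have [h'|//] := boolP (liso X (strl _ (legs N j i))).
  by have := nuniext_iso i j h'; rewrite (nuniext_iso i j h) nuniext_legs0 // nuniext_legs1.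
by rewrite (nuniext_iso i j h) nuniext_legs1 // h.
Qed.

(** For [i < j], M(i, j) is obtained from the unordered pair of [omega_legs] by removing M(j, i). *)
Lemma good_strl S : indec S -> good (ind (strl K S)).
Proof.
case=> [[k [i [ki ->]]]|[i [j [iN jN ->]]]]; first exact: good_ivl.
case: (ltngtP i j) => [ij|ji|->]; last 1 first.
- exact: good_legs_diag.
- have gj := @good_legs_gt i j; rewrite ij jN in gj.
  have g := good_sub (good_vdim (legv i j) (good_sub (good_tf N) good_tf_loop0)) (gj isT).
  apply: good_ext g; first exact: cinv_ind.
  move=> x X sX; rewrite omega_legs // !ind_strl.
  have [h|_] := boolP (liso X (strl _ (legs N i j))); last by rewrite subrr.
  rewrite (_ : liso X (strl _ (legs N j i)) = false) ?subr0 //.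
  apply: (introF idP) => h'; have ij' : (i < j <= N)%N by rewrite ij.
  by have := nuniext_iso i j h'; rewrite (nuniext_iso i j h) nuniext_legs0 // nuniext_legs1.
- by apply: good_legs_gt; rewrite ji.
Qed.

Theorem hall_polynomial (X Y M : lmodN K) : lsat X -> lsat Y -> lsat M ->
  exists P, forall x, hallF X Y M x = pev P x.
Proof.
move=> sX sY sM.
have [_ g] : good (ind X).
  apply: (@good_all _ _ _ (@string_descent N K) (fun Z => exists S, indec S /\ Z = strl K S)) sX.
    move=> Z [S [iS ->]]; split; [exact: strl_sat | exact: strl_gt0 | exact: good_strl].
  move=> Z sZ Z0; have [S [iS [W [sW h]]]] := split_string sZ Z0.
  by exists (strl K S), W; split=> //; exists S.
apply: ratl_int_poly; last by move=> x; rewrite hallF_card natr_int.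
by apply: ratl_ext (g Y M sY sM) => x; rewrite hallF_hsum.
Qed.

End StringIndicators.

(** * Representations as modules *)

Section Blocks.
Variables (F : finFieldType) (I : finType).
Implicit Types d : I -> nat.

Definition bdim d := #|{: {v : I & 'I_(d v)}}|.

(** [inc] and [prj] are the inclusions and projections of the direct sum of all vertex spaces, with
    basis the pairs of a vertex and a coordinate. *)
Definition inc d v : 'M[F]_(d v, bdim d) :=
  \matrix_(i, q) (Tagged (fun v => 'I_(d v)) i == enum_val q)%:R.
Definition prj d v : 'M[F]_(bdim d, d v) := (inc d v)^T.

Lemma inc_prj_entry d v w i j : (inc d v *m prj d w) i j =
  (Tagged (fun v => 'I_(d v)) i == Tagged (fun v => 'I_(d v)) j)%:R.
Proof.
rewrite mxE (bigD1 (enum_rank (Tagged (fun v => 'I_(d v)) i))) //= big1 => [|q qi].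
  by rewrite !mxE enum_rankK eqxx mul1r addr0 eq_sym.
rewrite !mxE (_ : (_ == enum_val q) = false) ?mul0r //.
by apply: contraNF qi => /eqP ->; rewrite enum_valK.
Qed.

Lemma inc_prj d v : inc d v *m prj d v = 1%:M.
Proof. by apply/matrixP => i j; rewrite inc_prj_entry !mxE eq_Tagged. Qed.

Lemma inc_prj0 d v w : v != w -> inc d v *m prj d w = 0.
Proof.
move=> vw; apply/matrixP => i j; rewrite inc_prj_entry mxE -tag_eqE /tag_eq /=.
by rewrite (negPf vw).
Qed.

Lemma sum_prj d : \sum_v prj d v *m inc d v = 1%:M.
Proof.
apply/matrixP => p q; rewrite summxE mxE.
pose T v := Tagged (fun v => 'I_(d v)) (i := v).
transitivity (\sum_v \sum_(i : 'I_(d v)) (T v i == enum_val p)%:R * (T v i == enum_val q)%:R : F).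
  by apply: eq_bigr => v _; rewrite mxE; apply: eq_bigr => i _; rewrite !mxE.
rewrite (sig_big_dep xpredT (fun _ => xpredT)
  (fun v i => (T v i == enum_val p)%:R * (T v i == enum_val q)%:R : F)) /=.
transitivity (\sum_(s : {v : I & 'I_(d v)}) (s == enum_val p)%:R * (s == enum_val q)%:R : F).
  by apply: eq_bigr => -[v i] _.
rewrite (bigD1 (enum_val p)) //= big1 ?addr0 => [|s sp]; last by rewrite (negPf sp) mul0r.
by rewrite eqxx mul1r (inj_eq enum_val_inj).
Qed.

Lemma row_full_prj d v : row_full (prj d v).
Proof. by apply/row_fullP; exists (inc d v); apply: inc_prj. Qed.

Definition blk d d' (g : forall v, 'M[F]_(d v, d' v)) : 'M[F]_(bdim d, bdim d') :=
  \sum_v prj d v *m g v *m inc d' v.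

Lemma inc_blk d d' (g : forall v, 'M[F]_(d v, d' v)) v :
  inc d v *m blk g = g v *m inc d' v.
Proof.
rewrite mulmx_sumr (bigD1 v) //= big1 ?addr0 => [|w wv].
  by rewrite !mulmxA inc_prj mul1mx.
by rewrite !mulmxA inc_prj0 ?mul0mx // eq_sym.
Qed.

Lemma blk_prj d d' (g : forall v, 'M[F]_(d v, d' v)) v :
  blk g *m prj d' v = prj d v *m g v.
Proof.
rewrite mulmx_suml (bigD1 v) //= big1 ?addr0 => [|w wv].
  by rewrite -!mulmxA inc_prj mulmx1.
by rewrite -!mulmxA inc_prj0 // !mulmx0.
Qed.

Lemma eq_inc m d (A B : 'M_(bdim d, m)) : (forall v, inc d v *m A = inc d v *m B) -> A = B.
Proof.
by move=> e; rewrite -[A]mul1mx -[B]mul1mx -sum_prj !mulmx_suml; apply: eq_bigr => v _; rewrite -!mulmxA e.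
Qed.

Lemma blk_inv d d' (g : forall v, 'M[F]_(d v, d' v)) (h : forall v, 'M[F]_(d' v, d v)) :
  (forall v, g v *m h v = 1%:M) -> blk g *m blk h = 1%:M.
Proof.
move=> e; apply: eq_inc => v.
by rewrite mulmxA inc_blk -mulmxA inc_blk mulmxA e mul1mx mulmx1.
Qed.

Lemma row_free_blk d d' (g : forall v, 'M[F]_(d v, d' v)) :
  (forall v, row_free (g v)) -> row_free (blk g).
Proof.
move=> h; apply/row_freeP; exists (blk (fun v => pinvmx (g v))).
by apply: blk_inv => v; apply: mulmxVp.
Qed.

Lemma row_full_blk d d' (g : forall v, 'M[F]_(d v, d' v)) :
  (forall v, row_full (g v)) -> row_full (blk g).
Proof.
move=> h; apply/row_fullP; exists (blk (fun v => pinvmx (g v))).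
by apply: blk_inv => v; apply: mulVpmx.
Qed.

Lemma sub_blk m d d' (g : forall v, 'M[F]_(d' v, d v)) (y : 'M_(m, bdim d)) :
  (y <= blk g)%MS = [forall v, (y *m prj d v <= g v)%MS].
Proof.
apply/idP/forallP => [/submxP[D ->] v|h].
  by rewrite -mulmxA blk_prj mulmxA submxMl.
rewrite -[y]mulmx1 -sum_prj mulmx_sumr; apply: summx_sub => v _.
have /submxP[D e] := h v; rewrite mulmxA e -mulmxA -inc_blk mulmxA.
exact: submxMl.
Qed.

End Blocks.

(* [act] and [dimv] are shadowed by names of mathcomp. *)
Import Defs.

Section Totals.
Variables (F : finFieldType) (Q : quiver).
Implicit Types M X Y : rep F Q.
Local Notation G := (vertex Q + arrow Q)%type.

(** The usual passage from a representation to a module: the sum of the vertex spaces, with the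
    vertices acting as idempotents. *)
Definition tot M : lmod G F :=
  Lmod (bdim (dimv M)) (fun g => match g with
    | inl v => prj F (dimv M) v *m inc F (dimv M) v
    | inr a => prj F (dimv M) (src a) *m act M a *m inc F (dimv M) (tgt a)
    end).

Lemma lhom_blk M X (g : forall v, 'M[F]_(dimv M v, dimv X v)) :
  is_hom g -> lhom (M := tot M) (N := tot X) (blk g).
Proof.
move/forallP => h; apply/lhomP => -[v|a] /=.
  by rewrite -mulmxA inc_blk !mulmxA blk_prj.
by rewrite -mulmxA inc_blk !mulmxA blk_prj -!(mulmxA (prj _ _ _)) (eqP (h a)).
Qed.

(** Commuting with the idempotents makes [f] block diagonal; its blocks are then a morphism of
    representations. *)
Lemma lhom_prj M X (f : 'M[F]_(ldim (tot M), ldim (tot X))) v : lhom f ->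
  prj F (dimv M) v *m (inc F (dimv M) v *m f *m prj F (dimv X) v) = f *m prj F (dimv X) v.
Proof.
move/lhomP/(_ (inl v)) => /= e; rewrite !mulmxA e -!mulmxA inc_prj.
by rewrite mulmx1.
Qed.

Lemma is_hom_tot M X (f : 'M[F]_(ldim (tot M), ldim (tot X))) : lhom f ->
  is_hom (M := M) (N := X) (fun v => inc F (dimv M) v *m f *m prj F (dimv X) v).
Proof.
move=> hf; apply/forallP => a; apply/eqP.
have /= e := lhomP _ hf (inr a).
have e1 := congr1 (fun A => inc F (dimv M) (src a) *m A *m prj F (dimv X) (tgt a)) e.
move: e1; rewrite /= !mulmxA inc_prj mul1mx => ->.
by rewrite -!mulmxA inc_prj mulmx1.
Qed.

Lemma iso_tot M X : iso M X = liso (tot M) (tot X).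
Proof.
apply/existsP/idP => [[g /andP[hg /forallP h]]|/lisoP[f [f' [hf hf' e e']]]].
  apply: (liso_hom (lhom_blk hg)); [apply: row_free_blk | apply: row_full_blk] => v;
    by have /andP[] := h v.
pose g (A B : rep F Q) (k : 'M[F]_(ldim (tot A), ldim (tot B))) v :=
  inc F (dimv A) v *m k *m prj F (dimv B) v.
have inv (A B : rep F Q) (k : 'M[F]_(ldim (tot A), ldim (tot B))) k' v :
    lhom k' -> k *m k' = 1%:M -> g A B k v *m g B A k' v = 1%:M.
  move=> hk e1; rewrite /g -[LHS]mulmxA lhom_prj // -mulmxA (mulmxA k) e1 mul1mx.
  exact: inc_prj.
exists (finfun (g M X f)); apply/andP; split.
  have /forallP h := is_hom_tot hf; apply/forallP => a; have := h a.
  by rewrite !ffunE.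
apply/forallP => v; rewrite ffunE; apply/andP; split.
  by apply: row_free_inv; apply: (inv _ _ f f').
by apply: row_full_inv; apply: (inv _ _ f' f).
Qed.

Section Submodules.
Variable M : rep F Q.
Implicit Type U : submodule M.

Definition big U : 'M[F]_(ldim (tot M)) := <<blk (val U)>>%MS.

Lemma is_submoduleP U : (forall v, <<val U v>>%MS = val U v) /\
  forall a, (val U (src a) *m act M a <= val U (tgt a))%MS.
Proof. by have /andP[/'forall_eqP ? /forallP ?] := valP U. Qed.

Lemma submod_big U : submod (big U).
Proof.
have [_ h] := is_submoduleP U.
apply: submod_gen => -[v|a] /=; rewrite !mulmxA blk_prj -!mulmxA.
  by rewrite -inc_blk !mulmxA submxMl.
have /submxP[D e] := h a.
by rewrite (mulmxA (val U _)) e -(mulmxA D) -inc_blk !mulmxA submxMl.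
Qed.

Lemma big_prj U v : <<big U *m prj F (dimv M) v>>%MS = val U v.
Proof.
have [<- _] := is_submoduleP U; apply/eq_genmx.
apply: eqmx_trans (eqmxMr _ (genmxE _)) _; rewrite blk_prj.
exact: eqmxMfull (row_full_prj F _ v).
Qed.

Lemma big_inj : injective big.
Proof. by move=> U V e; apply: val_inj; apply/mxfamP => v; rewrite -!big_prj e. Qed.

(** Stability under the idempotents makes [W] the sum of its vertex components. *)
Lemma big_onto (W : 'M[F]_(ldim (tot M))) : submod W -> exists U, big U = W.
Proof.
move=> sW; pose u := mxfam_of (fun v => <<W *m prj F (dimv M) v>>%MS).
have uE v : (u v :=: W *m prj F (dimv M) v)%MS by rewrite mxfam_ofE; apply: genmxE.
have su : is_submodule (M := M) u.
  apply/andP; split; apply/forallP; first by move=> v; rewrite mxfam_ofE genmx_id.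
  move=> a.
  rewrite (eqmxMr _ (uE _)) uE.
  have := submxMr (prj F (dimv M) (tgt a)) (submodP (inr a) sW).
  by rewrite /= -!mulmxA inc_prj mulmx1.
exists (exist _ u su); rewrite -[RHS](submodE sW); apply/eq_genmx/eqmxP/andP; split.
  apply: summx_sub => v _; have /submxP[D e] : (u v <= W *m prj F (dimv M) v)%MS by rewrite uE.
  rewrite /= e -!mulmxA mulmxA; apply: submx_trans (submxMl _ _) _.
  exact: (submodP (inl v) sW).
by rewrite sub_blk; apply/forallP => v /=; rewrite uE.
Qed.

Lemma subl_big U : liso (tot (sub_rep U)) (subl (big U)).
Proof.
apply: (liso_subl (submod_big U) (lhom_blk (sub_incl_hom U))).
  by apply: row_free_blk; apply: sub_incl_free.
apply: eqmx_trans (eqmx_sym (genmxE _)).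
apply: eqmx_sub => m y; rewrite !sub_blk; apply: eq_forallb => v.
by rewrite sub_incl_image.
Qed.

Lemma quol_big U : liso (quol (big U)) (tot (quo_rep U)).
Proof.
apply: (liso_quol (submod_big U) (lhom_blk (quo_proj_hom U))).
  by apply: row_full_blk; apply: quo_proj_full.
apply: eqmx_trans (eqmx_sym (genmxE _)).
apply: eqmx_sub => m y; rewrite sub_blk sub_kermx.
apply/eqP/forallP => [e v|h].
  by rewrite -quo_proj_ker -mulmxA -blk_prj mulmxA e mul0mx.
rewrite -[LHS]mulmx1 -sum_prj mulmx_sumr big1 // => v _.
rewrite mulmxA -[y *m _ *m _]mulmxA blk_prj mulmxA.
by have /eqP-> := etrans (quo_proj_ker U _) (h v); rewrite mul0mx.
Qed.

Lemma hall_number_tot X Y : hall_number X Y M = nhall (tot X) (tot Y) (tot M).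
Proof.
rewrite /hall_number /nhall -(card_imset _ big_inj); apply: eq_card => W.
rewrite !inE; apply/imsetP/and3P => [[U]|[sW iY iX]].
  rewrite inE !iso_tot (liso_ltrans (subl_big U)) -(liso_ltrans (quol_big U)).
  by move=> /andP[h h'] ->; rewrite submod_big.
have [U eU] := big_onto sW; exists U => //; rewrite inE !iso_tot.
by rewrite (liso_ltrans (subl_big U)) -(liso_ltrans (quol_big U)) eU iY iX.
Qed.

End Submodules.
End Totals.

Lemma tot_ext (K E : finFieldType) (iota : {rmorphism K -> E}) Q (M : rep K Q) :
  liso (tot (rep_ext iota M)) (lext iota (tot M)).
Proof.
have ei v : map_mx iota (inc K (dimv M) v) = inc E (dimv M) v.
  by apply/matrixP => i j; rewrite !mxE rmorph_nat.
have ep v : map_mx iota (prj K (dimv M) v) = prj E (dimv M) v.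
  by rewrite /prj -ei map_trmx.
have e g : lop (tot (rep_ext iota M)) g = lop (lext iota (tot M)) g.
  by case: g => [v|a] /=; rewrite !map_mxM ?ei ?ep.
apply: (@liso_free _ _ (tot (rep_ext iota M)) (lext iota (tot M)) (1%:M : 'M[E]_(bdim (dimv M)))) => //.
  by apply/lhomP => g; rewrite mulmx1 mul1mx e.
by rewrite row_free_unit unitmx1.
Qed.

Lemma lsat_tot n (F : finFieldType) (M : rep F (loop_quiver n)) :
  is_module M -> lsat (N := n.-1) (tot M).
Proof.
move=> /eqP hM; apply/lsatP; split=> /= [i j||c|c|].
- rewrite -mulmxA (mulmxA (inc _ _ _)); have [->|ij] := eqVneq i j.
    by rewrite inc_prj mul1mx.
  by rewrite inc_prj0 // mul0mx mulmx0.
- exact: sum_prj.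
- by rewrite -!mulmxA (mulmxA (inc _ _ _) (prj _ _ _)) inc_prj mul1mx.
- by rewrite -!mulmxA (mulmxA (inc _ _ _) (prj _ _ _)) inc_prj mul1mx.
- rewrite -!mulmxA (mulmxA (inc _ _ _) (prj _ _ _)) inc_prj mul1mx (mulmxA (act M None)).
  by rewrite -[act M None *m _]/(loop_action M *m loop_action M) hM mul0mx mulmx0.
Qed.

Theorem theorem1p1 (n : nat) (n_ge1 : (1 <= n)%N) (Fq : finFieldType) :
  has_hall_polynomials n Fq.
Proof.
move=> X Y M mX mY mM.
have [P hP] := hall_polynomial (lsat_tot mX) (lsat_tot mY) (lsat_tot mM).
(* The identity is checked in [rat], where the values of rational functions live. *)
exists P => E iota _; apply: (@intr_inj rat).
have e : hallF (tot X) (tot Y) (tot M) (Extn iota) =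
    (hall_number (rep_ext iota X) (rep_ext iota Y) (rep_ext iota M))%:R.
  rewrite hallF_card hall_number_tot.
  by rewrite (nhall_iso (tot_ext iota X) (tot_ext iota Y) (tot_ext iota M)).
by rewrite rmorph_nat -e hP.
Qed.
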